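(* Let $R$ be an indecomposable commutative unital ring, and let $\theta=(\{X_s\}_{s\in S},\{\theta_s\}_{s\in S})$ and $\gamma=(\{Y_t\}_{t\in T},\{\gamma_t\}_{t\in T})$ be almost ample, topologically principal topological partial actions of inverse semigroups $S$ and $T$ on spaces $X$ and $Y$, such that the groupoids of germs $S\ltimes X$ and $T\ltimes Y$ are Hausdorff. Then the following are equivalent: (1) $\theta$ and $\gamma$ are continuously orbit equivalent; (2) $S\ltimes X$ and $T\ltimes Y$ are isomorphic as topological groupoids; (3) the inverse semigroups $(S\ltimes X)^a$ and $(T\ltimes Y)^a$ are isomorphic; (4) the inverse semigroups $[[S\ltimes X]]$ and $[[T\ltimes Y]]$ are isomorphic; (5) there is a diagonal-preserving (ring or $R$-algebra) isomorphism between the Steinberg algebras $A_R(S\ltimes X)$ and $A_R(T\ltimes Y)$; (6) there is a diagonal-preserving (ring or $R$-algebra) isomorphism between the crossed products $A_R(X)\rtimes S$ and $A_R(Y)\rtimes T$ (with respect to the dual partial actions).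
   Context: Inverse semigroup notation: $E(S)$ idempotents, $s\le t$ iff $s=ts^*s$. A topological partial action $\theta$ of $S$ on $X$: open $X_s$, homeomorphisms $\theta_s:X_{s^*}\to X_s$, $s\mapsto\theta_s$ a partial homomorphism into the inverse semigroup $\mathcal{I}(X)$ of partial bijections ($\theta_{s^*}=\theta_s^{-1}$, $\theta_s\theta_t\le\theta_{st}$, $s\le t\Rightarrow\theta_s\le\theta_t$), and $X=\bigcup_{e\in E(S)}X_e$. Write $S_x=\{s:x\in X_{s^*}\}$, $S*X=\{(s,x):x\in X_{s^*}\}$. Almost ample: $X$ locally compact Hausdorff and each $X_s$ ultraparacompact (every open cover has a refinement by pairwise disjoint clopen sets). Topologically principal: the set $\Lambda(\theta)$ of $x$ such that every $s\in S_x$ with $\theta_s(x)=x$ has some $e\in E(S)\cap S_x$ with $e\le s$ is dense in $X$. Continuous orbit equivalence: a homeomorphism $\varphi:X\to Y$ and continuous $a:S*X\to T$, $b:T*Y\to S$ ($S,T$ discrete) with $a(s,x)\in T_{\varphi(x)}$, $b(t,y)\in S_{\varphi^{-1}(y)}$, $\varphi(\theta_s(x))=\gamma_{a(s,x)}(\varphi(x))$, $\varphi^{-1}(\gamma_t(y))=\theta_{b(t,y)}(\varphi^{-1}(y))$. Groupoid of germs $S\ltimes X$: germs $[s,x]$, $(s,x)\sim(t,y)$ iff $x=y$ and some $u\le s,t$ has $x\in X_{u^*}$; source $x$, range $\theta_s(x)$, product $[s,x][t,y]=[st,y]$, inverse $[s^*,\theta_s(x)]$, unit space $X$, topology with basis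 $[s,U]$, $U\subseteq X_{s^*}$ open. For an ample groupoid $\mathcal{G}$: $\mathcal{G}^a$ is the inverse semigroup of compact-open bisections under $UV=\{uv\}$; for $U\in\mathcal{G}^a$, $\tau_U=r\circ(s|_U)^{-1}:s(U)\to r(U)$; the topological full pseudogroup is $[[\mathcal{G}]]=\{\tau_U:U\in\mathcal{G}^a\}\subseteq\mathcal{I}(\mathcal{G}^{(0)})$. $A_R(\mathcal{G})$ is the $R$-span of characteristic functions of compact-open bisections with convolution; its diagonal is $\{f\in A_R(\mathcal{G}):\operatorname{supp}f\subseteq\mathcal{G}^{(0)}\}$. Dual partial action of $\theta$ on $A_R(X)$ (locally constant compactly supported functions): $D_s=\{f:\operatorname{supp}f\subseteq X_s\}$, $\alpha_s(f)=f\circ\theta_{s^*}$ extended by zero. Crossed product $A\rtimes S=\mathscr{L}/\mathscr{N}$ where $\mathscr{L}$ = finite sums $\sum a_s\delta_s$ ($a_s\in D_s$) with $(a_s\delta_s)(b_t\delta_t)=\alpha_s(\alpha_{s^*}(a_s)b_t)\delta_{st}$, $\mathscr{N}$ generated by $a\delta_r-a\delta_s$, $r\le s$, $a\in D_r$; its diagonal is the additive subgroup generated by the classes of $a\delta_e$, $e\in E(S)$, $a\in D_e$. A diagonal-preserving isomorphism maps diagonal onto diagonal. *)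

(* Defs.v *)
From HB Require Import structures.
From mathcomp Require Import all_boot all_algebra.
From mathcomp Require Import boolp classical_sets functions cardinality fsbigop.
From mathcomp Require Import topology.

Unset Implicit Arguments.
Unset Strict Implicit.
Unset Printing Implicit Defensive.
Import GRing.Theory.
Local Open Scope classical_set_scope.
Local Open Scope ring_scope.

(* Finite sums over a set of indices of an arbitrary type (sum over the
   finite support; every type is given its classical choice structure). *)
Definition fsum (R : nmodType) (I : Type) (A : set I) (F : I -> R) : R :=
  \sum_(i \in (A : set {classic I})) F i.

Definition ind (R : nzRingType) (G : Type) (U : set G) (g : G) : R :=
  if `[< U g >] then 1 else 0.
Arguments ind R {G}.
Arguments fsum {R I}.

Record invSemigroup := InvSemigroup {
  isg :> Type;
  imul : isg -> isg -> isg;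
  istar : isg -> isg;
  imulA : forall a b c, imul a (imul b c) = imul (imul a b) c;
  istar_l : forall s, imul (imul s (istar s)) s = s;
  istar_r : forall s, imul (imul (istar s) s) (istar s) = istar s;
  istar_uniq : forall s t, imul (imul s t) s = s -> imul (imul t s) t = t ->
                 t = istar s }.

Arguments imul {i}.
Arguments istar {i}.

Definition idem (S : invSemigroup) (e : S) := imul e e = e.

Definition isg_le (S : invSemigroup) (s t : S) := s = imul t (imul (istar s) s).

Arguments idem {S}.
Arguments isg_le {S}.

(* isomorphism between two (sub)semigroups SA, SB (carriers given as sets,
   closed under the products mA, mB) *)
Definition semigroup_iso_on (A B : Type) (SA : set A) (mA : A -> A -> A)
    (SB : set B) (mB : B -> B -> B) :=
  exists f : A -> B, set_bij SA SB f /\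
    forall a b, SA a -> SA b -> f (mA a b) = mB (f a) (f b).

Arguments semigroup_iso_on {A B}.

Definition isg_iso (S T : invSemigroup) :=
  semigroup_iso_on [set: S] (@imul S) [set: T] (@imul T).

(* Topological partial actions.  pdom s = X_s, pmap s = theta_s, which is
   meaningful on X_{s^*}. *)
Record partial_action (S : invSemigroup) (X : topologicalType) := PartialAction {
  pdom : S -> set X;
  pmap : S -> X -> X;
  pdom_open : forall s, open (pdom s);
  pmap_into : forall s x, pdom (istar s) x -> pdom s (pmap s x);
  pmap_cont : forall s, {within pdom (istar s), continuous (pmap s)};
  pmap_inv : forall s x, pdom (istar s) x -> pmap (istar s) (pmap s x) = x;
  pmap_inv' : forall s y, pdom s y ->
      pdom (istar s) (pmap (istar s) y) /\ pmap s (pmap (istar s) y) = y;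
  pmap_comp : forall s t x, pdom (istar t) x -> pdom (istar s) (pmap t x) ->
      pdom (istar (imul s t)) x /\ pmap (imul s t) x = pmap s (pmap t x);
  pmap_mono : forall s t, isg_le s t -> forall x, pdom (istar s) x ->
      pdom (istar t) x /\ pmap s x = pmap t x;
  pcover : forall x : X, exists e : S, idem e /\ pdom e x }.

Arguments pdom {S X}.
Arguments pmap {S X}.

Definition locally_compact_space (X : topologicalType) :=
  forall x : X, exists2 K : set X, compact K & nbhs x K.

Definition clopen_in (X : topologicalType) (A V : set X) :=
  V `<=` A /\ (exists O, open O /\ V = A `&` O) /\ (exists C, closed C /\ V = A `&` C).

Arguments clopen_in {X}.

Definition ultraparacompact (X : topologicalType) (A : set X) :=
  forall (I : Type) (U : I -> set X), (forall i, open (U i)) ->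
    A `<=` \bigcup_i U i ->
    exists (J : Type) (V : J -> set X),
      (forall j, clopen_in A (V j)) /\
      (forall j k, j <> k -> V j `&` V k = set0) /\
      A `<=` \bigcup_j V j /\
      (forall j, exists i, V j `<=` U i).

Arguments ultraparacompact {X}.

Definition almost_ample (S : invSemigroup) (X : topologicalType)
    (th : partial_action S X) :=
  locally_compact_space X /\ hausdorff_space X /\
  forall s, ultraparacompact (pdom th s).

Definition Lambda (S : invSemigroup) (X : topologicalType)
    (th : partial_action S X) : set X :=
  [set x | forall s : S, pdom th (istar s) x -> pmap th s x = x ->
     exists e : S, idem e /\ pdom th (istar e) x /\ isg_le e s].

Arguments Lambda {S X}.
Definition topologically_principal (S : invSemigroup) (X : topologicalType)
    (th : partial_action S X) := closure (Lambda th) = setT.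

(* Continuous orbit equivalence (S, T discrete; continuity of a on S*X
   means that each a(s, -) is locally constant on X_{s^*}). *)
Definition cont_cocycle (S T : invSemigroup) (X : topologicalType)
    (th : partial_action S X) (a : S -> X -> T) :=
  forall s x, pdom th (istar s) x ->
    exists2 U : set X, open U /\ U x &
      forall y, U y -> pdom th (istar s) y -> a s y = a s x.

Arguments cont_cocycle {S T X}.
Definition cont_orbit_equiv (S T : invSemigroup) (X Y : topologicalType)
    (th : partial_action S X) (ga : partial_action T Y) :=
  exists (phi : X -> Y) (psi : Y -> X) (a : S -> X -> T) (b : T -> Y -> S),
    [/\ cancel phi psi /\ cancel psi phi, continuous phi /\ continuous psi,
        cont_cocycle th a, cont_cocycle ga b &
    [/\ forall s x, pdom th (istar s) x -> pdom ga (istar (a s x)) (phi x),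
        forall t y, pdom ga (istar t) y -> pdom th (istar (b t y)) (psi y),
        forall s x, pdom th (istar s) x ->
           phi (pmap th s x) = pmap ga (a s x) (phi x) &
        forall t y, pdom ga (istar t) y ->
           psi (pmap ga t y) = pmap th (b t y) (psi y)]].

(* Topological groupoids, given as data: a type of "points" carrying the
   set garr of arrows, source, range, product (meaningful on composable
   pairs), inverse and the family of open sets of arrows. *)
Record topgroupoid := TopGroupoid {
  gcar : Type;
  garr : set gcar;
  gsrc : gcar -> gcar;
  grng : gcar -> gcar;
  gmul : gcar -> gcar -> gcar;
  ginv : gcar -> gcar;
  gopen : set (set gcar) }.
Arguments garr : clear implicits.
Arguments gsrc : clear implicits.
Arguments grng : clear implicits.
Arguments gmul : clear implicits.
Arguments ginv : clear implicits.
Arguments gopen : clear implicits.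

Definition gunits (G : topgroupoid) : set (gcar G) :=
  [set g | garr G g /\ gsrc G g = g].

Definition topgroupoid_iso (G H : topgroupoid) :=
  exists f : gcar G -> gcar H,
    [/\ set_bij (garr G) (garr H) f,
        forall g, garr G g -> f (gsrc G g) = gsrc H (f g) /\
                              f (grng G g) = grng H (f g) /\
                              f (ginv G g) = ginv H (f g),
        forall g h, garr G g -> garr G h -> gsrc G g = grng G h ->
                    f (gmul G g h) = gmul H (f g) (f h) &
        forall U, U `<=` garr G -> (gopen G U <-> gopen H (f @` U))].

Definition groupoid_hausdorff (G : topgroupoid) :=
  forall g h, garr G g -> garr G h -> g <> h ->
    exists U V, [/\ gopen G U, gopen G V, U g, V h & U `&` V = set0].

Definition gcompact (G : topgroupoid) (K : set (gcar G)) :=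
  K `<=` garr G /\
  forall (I : Type) (U : I -> set (gcar G)), (forall i, gopen G (U i)) ->
    K `<=` \bigcup_i U i ->
    exists2 F : set I, finite_set F & K `<=` \bigcup_(i in F) U i.

Definition bisection (G : topgroupoid) (U : set (gcar G)) :=
  [/\ U `<=` garr G, set_inj U (gsrc G) & set_inj U (grng G)].

Definition cobis (G : topgroupoid) : set (set (gcar G)) :=
  [set U | gopen G U /\ gcompact G U /\ bisection G U].

Definition bis_mul (G : topgroupoid) (U V : set (gcar G)) : set (gcar G) :=
  [set w | exists u v, [/\ U u, V v, gsrc G u = grng G v & w = gmul G u v]].

(* tau_U as a partial bijection of the unit space, given by its graph *)
Definition tau (G : topgroupoid) (U : set (gcar G)) : set (gcar G * gcar G) :=
  [set p | exists2 u, U u & p = (gsrc G u, grng G u)].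

Definition pb_mul (A : Type) (sg tu : set (A * A)) : set (A * A) :=
  [set p | exists y, tu (p.1, y) /\ sg (y, p.2)].

Definition full_pseudogroup (G : topgroupoid) : set (set (gcar G * gcar G)) :=
  [set tau G U | U in cobis G].

Section Steinberg.
Variable R : comNzRingType.

Definition steinberg (G : topgroupoid) : set (gcar G -> R) :=
  [set f | exists (n : nat) (c : 'I_n -> R) (U : 'I_n -> set (gcar G)),
      (forall i, cobis G (U i)) /\
      f = fun g => \sum_(i < n) c i * ind R (U i) g].

Definition conv (G : topgroupoid) (f h : gcar G -> R) : gcar G -> R :=
  fun g => if `[< garr G g >] then
              fsum [set a | garr G a /\ grng G a = grng G g]
                   (fun a => f a * h (gmul G (ginv G a) g))
            else 0.

Definition steinberg_diag (G : topgroupoid) : set (gcar G -> R) :=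
  [set f | steinberg G f /\ forall g, f g != 0 -> gunits G g].

Definition steinberg_diag_iso (alg : bool) (G H : topgroupoid) :=
  exists Phi : (gcar G -> R) -> (gcar H -> R),
    [/\ set_bij (steinberg G) (steinberg H) Phi,
        forall f h, steinberg G f -> steinberg G h ->
          Phi (fun g => f g + h g) = (fun g => Phi f g + Phi h g),
        forall f h, steinberg G f -> steinberg G h ->
          Phi (conv G f h) = conv H (Phi f) (Phi h),
        Phi @` steinberg_diag G = steinberg_diag H &
        alg -> forall r f, steinberg G f ->
          Phi (fun g => r * f g) = (fun g => r * Phi f g)].
End Steinberg.
Arguments conv {R G}.

(* The groupoid of germs S |x X.  A germ [s,x] is represented by its
   equivalence class, a set of pairs (t,y) in S*X. *)
Section Germs.
Variables (S : invSemigroup) (X : topologicalType) (th : partial_action S X).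

Definition in_SX (p : S * X) := pdom th (istar p.1) p.2.

Definition germ_rel (p q : S * X) :=
  p.2 = q.2 /\ exists u : S, [/\ isg_le u p.1, isg_le u q.1 & pdom th (istar u) p.2].

Definition germ (s : S) (x : X) : set (S * X) :=
  [set p | in_SX p /\ germ_rel p (s, x)].

Definition germ_arr : set (set (S * X)) :=
  [set A | exists s x, pdom th (istar s) x /\ A = germ s x].

Definition germ_src (A : set (S * X)) : set (S * X) :=
  [set p | exists2 q, A q & germ (imul (istar q.1) q.1) q.2 p].

Definition germ_rng (A : set (S * X)) : set (S * X) :=
  [set p | exists2 q, A q & germ (imul q.1 (istar q.1)) (pmap th q.1 q.2) p].

Definition germ_mul (A B : set (S * X)) : set (S * X) :=
  [set p | exists q r, [/\ A q, B r, q.2 = pmap th r.1 r.2 &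
                           germ (imul q.1 r.1) r.2 p]].

Definition germ_inv (A : set (S * X)) : set (S * X) :=
  [set p | exists2 q, A q & germ (istar q.1) (pmap th q.1 q.2) p].

Definition germ_basic (s : S) (U : set X) : set (set (S * X)) :=
  [set germ s x | x in U].

Definition germ_open (W : set (set (S * X))) :=
  W `<=` germ_arr /\
  forall A, W A -> exists s (U : set X),
     [/\ open U, U `<=` pdom th (istar s), germ_basic s U A & germ_basic s U `<=` W].

Definition germ_groupoid : topgroupoid :=
  @TopGroupoid (set (S * X)) germ_arr germ_src germ_rng germ_mul germ_inv germ_open.
End Germs.
Arguments germ_groupoid {S X}.

Section Crossed.
Variables (R : comNzRingType) (S : invSemigroup) (X : topologicalType)
          (th : partial_action S X).

Definition fsupp (f : X -> R) : set X := closure [set x | f x != 0].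

Definition lcc : set (X -> R) :=
  [set f | (forall x, exists2 U : set X, open U /\ U x & forall y, U y -> f y = f x)
           /\ compact (fsupp f)].

Definition Dual (s : S) : set (X -> R) := [set f | lcc f /\ fsupp f `<=` pdom th s].

Definition dual_act (s : S) (f : X -> R) : X -> R :=
  fun x => if `[< pdom th s x >] then f (pmap th (istar s) x) else 0.

(* elements of L: finite sums  sum_s a_s delta_s, represented by s |-> a_s *)
Definition cpL : set (S -> X -> R) :=
  [set a | finite_set [set s | a s <> (fun _ => 0)] /\ forall s, Dual s (a s)].

Definition cp_add (a b : S -> X -> R) : S -> X -> R := fun s x => a s x + b s x.
Definition cp_opp (a : S -> X -> R) : S -> X -> R := fun s x => - a s x.
Definition cp_scale (r : R) (a : S -> X -> R) : S -> X -> R := fun s x => r * a s x.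

(* (a_s delta_s)(b_t delta_t) = alpha_s(alpha_{s^*}(a_s) b_t) delta_{st} *)
Definition cp_mul (a b : S -> X -> R) : S -> X -> R :=
  fun u x => fsum [set p : S * S | imul p.1 p.2 = u]
     (fun p => dual_act p.1 (fun y => dual_act (istar p.1) (a p.1) y * b p.2 y) x).

Definition delta (s : S) (f : X -> R) : S -> X -> R :=
  fun u => if `[< u = s >] then f else (fun _ => 0).

Definition cp_ideal (I : set (S -> X -> R)) :=
  [/\ I `<=` cpL, I (fun _ _ => 0),
      forall a b, I a -> I b -> I (cp_add a b),
      forall a, I a -> I (cp_opp a) &
      forall a b, cpL a -> I b -> I (cp_mul a b) /\ I (cp_mul b a)].

Definition cpN : set (S -> X -> R) :=
  [set n | forall I, cp_ideal I ->
     (forall r s f, isg_le r s -> Dual r f -> I (cp_add (delta r f) (cp_opp (delta s f)))) ->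
     I n].

Definition cpDiag0 : set (S -> X -> R) :=
  [set d | forall I : set (S -> X -> R),
     I (fun _ _ => 0) -> (forall a b, I a -> I b -> I (cp_add a b)) ->
     (forall a, I a -> I (cp_opp a)) ->
     (forall e f, idem e -> Dual e f -> I (delta e f)) -> I d].
End Crossed.

Arguments cpL {R S X}.
Arguments cp_add {R S X}.
Arguments cp_opp {R S X}.
Arguments cp_scale {R S X}.
Arguments cp_mul {R S X}.
Arguments delta {R S X}.
Arguments Dual {R S X}.
Arguments cpN {R S X}.
Arguments cpDiag0 {R S X}.

(* A diagonal-preserving ring (alg = true: R-algebra) isomorphism
   A_R(X) >| S = L1/N1  -->  A_R(Y) >| T = L2/N2, given by a map Phi on
   representatives inducing a well-defined bijective homomorphism of the
   quotients that maps the diagonal onto the diagonal. *)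
Definition crossed_diag_iso (R : comNzRingType) (alg : bool)
    (S T : invSemigroup) (X Y : topologicalType)
    (th : partial_action S X) (ga : partial_action T Y) :=
  let L1 := cpL th in let L2 := cpL ga in
  let N1 := cpN th in let N2 := cpN ga in
  let eq1 a b := N1 (cp_add a (cp_opp b)) in
  let eq2 a b := N2 (cp_add a (cp_opp b)) in
  exists Phi : (S -> X -> R) -> (T -> Y -> R),
    [/\ forall a, L1 a -> L2 (Phi a),
        forall a b, L1 a -> L1 b -> (eq1 a b <-> eq2 (Phi a) (Phi b)),
        forall c, L2 c -> exists2 a, L1 a & eq2 (Phi a) c,
        forall a b, L1 a -> L1 b ->
           eq2 (Phi (cp_add a b)) (cp_add (Phi a) (Phi b)) /\
           eq2 (Phi (cp_mul th a b)) (cp_mul ga (Phi a) (Phi b)) &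
        [/\ forall a, cpDiag0 th a -> exists2 d, cpDiag0 ga d & eq2 (Phi a) d,
            forall d, cpDiag0 ga d -> exists2 a, cpDiag0 th a & eq2 (Phi a) d &
            alg -> forall r a, L1 a ->
               eq2 (Phi (cp_scale r a)) (cp_scale r (Phi a))]].

Arguments almost_ample {S X}.
Arguments topologically_principal {S X}.
Arguments cont_orbit_equiv {S T X Y}.
Arguments crossed_diag_iso R alg {S T X Y}.

Definition indecomposable (R : comNzRingType) :=
  forall e : R, e * e = e -> e = 0 \/ e = 1.

(* Main.v *)
(* By topological principality and Hausdorffness, the germ [s,x] is determined by
   the germ at x of the map theta_s.  Hence a continuous orbit equivalence amounts
   to a homeomorphism phi such that phi theta_s agrees near each point with some
   gamma_t phi and conversely; ultraparacompactness makes the choice of t locally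
   constant.  Such a phi induces an isomorphism of the groupoids of germs, and this
   induces all the other isomorphisms.

   Conversely, the idempotents of the diagonal of G^a, [[G]] or A_R(G) are the
   compact open subsets of X (R being indecomposable), so by Stone duality an
   isomorphism yields a homeomorphism phi : X -> Y.  For the bisection B = [s,V],
   the relations B W = theta_s(W) B, for W in V, show that an arrow h in the support
   of the image of B satisfies r(h) = phi theta_s phi^-1 (s(h)), while B^-1 B = V
   provides such an arrow over each point of phi(V).  As the support is open, it
   contains a germ bisection [t,O], so gamma_t = phi theta_s phi^-1 on O.

   Finally A_R(X) >| S is the Steinberg algebra of the groupoid of germs: the kernel
   of L -> A_R(G) is the ideal N because a term of a vanishing sum can, locally on
   its compact open support, be moved modulo N onto the index of another term. *)
Require Import Defs.
From mathcomp Require Import all_boot all_algebra.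
From mathcomp Require Import boolp classical_sets functions cardinality fsbigop.
From mathcomp Require Import topology.
Set Implicit Arguments.
Unset Strict Implicit.
Unset Printing Implicit Defensive.
Import GRing.Theory.
Local Open Scope classical_set_scope.
Local Open Scope ring_scope.

(** * Inverse semigroups *)

(** Ultraparacompactness serves twice: it makes the compact open sets a base, on which Stone duality
    and all local arguments rest, and it makes the cocycles locally constant. Topological
    principality acts through [germ_faithful], which gives both the well-definedness of [germ_map]
    and the injectivity of U -> tau_U.

    The way back from (3), (4) and (5) is one argument because it never asks the image of a
    bisection to be a bisection or a normaliser. It asks for an open set of arrows attached to that
    image and for control of sources and ranges under multiplication by diagonal idempotents;
    [diag_system] axiomatises this.

    Two devices are less visible. Locally constant functions and bisections are cut along compact
    open sets until each piece is constant or of the form [s,V]; [co_ind] is the induction that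
    permits it. And closure of the Steinberg algebra under convolution, which [diag_system]
    requires, is read off from the crossed product, whose map [psi] is multiplicative and onto. *)

Arguments imulA {i} a b c.

Section InverseSemigroup.
Variable S : invSemigroup.
Implicit Types s t u e f : S.

Lemma istarK s : istar (istar s) = s.
Proof. by apply/esym/istar_uniq; rewrite ?istar_r ?istar_l. Qed.

Lemma idem_star e : idem e -> istar e = e.
Proof. by move=> ee; apply/esym/istar_uniq; rewrite !ee. Qed.

Lemma idem_istarl s : idem (imul (istar s) s).
Proof. by rewrite /idem imulA istar_r. Qed.

Lemma idem_istarr s : idem (imul s (istar s)).
Proof. by rewrite /idem imulA istar_l. Qed.

(* The inverse x of ef satisfies x = fxe, which makes it idempotent. *)
Lemma idemM e f : idem e -> idem f -> idem (imul e f).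
Proof.
rewrite /idem => ee ff; set x := istar (imul e f).
have hx1 : imul (imul (imul e f) x) (imul e f) = imul e f by rewrite istar_l.
have hx2 : imul (imul x (imul e f)) x = x by rewrite istar_r.
have fxe : imul f (imul x e) = x.
  apply: istar_uniq.
    rewrite -[RHS]hx1 !imulA -[imul (imul e f) f]imulA ff.
    by rewrite -[imul (imul (imul (imul e f) x) e) e]imulA ee.
  rewrite -[in RHS]hx2 !imulA -[imul (imul (imul f x) e) e]imulA ee.
  by rewrite -[imul (imul (imul (imul f x) e) f) f]imulA ff.
have xx : imul x x = x.
  have fx : imul f x = x.
    by rewrite -{2}fxe -{1}fxe imulA ff.
  have xe : imul x e = x.
    by rewrite -{2}fxe -{1}fxe -!imulA ee.
  transitivity (imul (imul x e) (imul f x)); first by rewrite xe fx.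
  by rewrite -[RHS]hx2 !imulA.
have := idem_star xx; rewrite /x istarK => ->.
exact: xx.
Qed.

(** Both products are idempotent, so [ef] is its own inverse; but [fe] also satisfies the equations
    of an inverse of [ef]. *)
Lemma idemC e f : idem e -> idem f -> imul e f = imul f e.
Proof.
move=> ee ff; have ef := idemM ee ff; have fe := idemM ff ee.
rewrite -[LHS](idem_star ef); apply/esym/istar_uniq.
  rewrite !imulA -[imul (imul e f) f]imulA ff -[imul (imul (imul e f) e) e]imulA ee.
  by rewrite -[RHS]ef !imulA.
rewrite !imulA -[imul (imul f e) e]imulA ee -[imul (imul (imul f e) f) f]imulA ff.
by rewrite -[RHS]fe !imulA.
Qed.

Lemma istarM s t : istar (imul s t) = imul (istar t) (istar s).
Proof.
have idc := idemC (idem_istarl s) (idem_istarr t).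
apply/esym/istar_uniq.
  transitivity (imul s (imul (imul (imul t (istar t)) (imul (istar s) s)) t)).
    by rewrite !imulA.
  by rewrite -idc !imulA istar_l -!imulA (imulA t) istar_l.
transitivity (imul (istar t) (imul (imul (imul (istar s) s) (imul t (istar t))) (istar s))).
  by rewrite !imulA.
by rewrite idc !imulA istar_r -!imulA (imulA (istar s)) istar_r.
Qed.

Lemma idem_conj s e : idem e -> idem (imul (imul s e) (istar s)).
Proof.
move=> ee; rewrite /idem.
transitivity (imul s (imul (imul e (imul (istar s) s)) (imul e (istar s)))).
  by rewrite !imulA.
rewrite (idemC ee (idem_istarl s)) -(imulA _ e) (imulA e e) ee.
by rewrite !imulA istar_l.
Qed.

Lemma isg_leP s t : isg_le s t <-> exists2 e, idem e & s = imul t e.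
Proof.
split=> [st|[e ee ->]]; first by exists (imul (istar s) s) => //; exact: idem_istarl.
rewrite /isg_le istarM (idem_star ee) -imulA (imulA (istar t)).
rewrite -(idemC ee (idem_istarl t)) (imulA e e) ee (idemC ee (idem_istarl t)).
by rewrite !imulA istar_l.
Qed.

Lemma isg_le_refl s : isg_le s s.
Proof. by rewrite /isg_le imulA istar_l. Qed.

Lemma isg_le_trans s t u : isg_le s t -> isg_le t u -> isg_le s u.
Proof.
move=> /isg_leP[e ee ->] /isg_leP[f ff ->]; apply/isg_leP.
by exists (imul f e); [exact: idemM|rewrite imulA].
Qed.

Lemma isg_le_mull f t : idem f -> isg_le (imul f t) t.
Proof.
move=> ff; apply/isg_leP; exists (imul (imul (istar t) f) t).
  by have := idem_conj (istar t) ff; rewrite istarK.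
by rewrite !imulA (idemC (idem_istarr t) ff) -(imulA f) istar_l.
Qed.

Lemma isg_le_mulr t e : idem e -> isg_le (imul t e) t.
Proof. by move=> ee; apply/isg_leP; exists e. Qed.

Lemma isg_le_star s t : isg_le s t -> isg_le (istar s) (istar t).
Proof. by move=> /isg_leP[e ee ->]; rewrite istarM idem_star//; exact: isg_le_mull. Qed.

Lemma isg_leM s s' t t' :
  isg_le s s' -> isg_le t t' -> isg_le (imul s t) (imul s' t').
Proof.
move=> /isg_leP[e ee ->] /isg_leP[f ff ->].
apply: (@isg_le_trans _ (imul s' (imul e t'))).
  by rewrite imulA imulA; exact: isg_le_mulr.
by have /isg_leP[g gg ->] := isg_le_mull t' ee; rewrite imulA; exact: isg_le_mulr.
Qed.

Lemma isg_le_idem s e : idem e -> isg_le s e -> idem s.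
Proof. by move=> ee /isg_leP[f ff ->]; exact: idemM. Qed.

Lemma isg_le_common t u v : isg_le u t -> isg_le v t ->
  isg_le (imul u (imul (istar v) v)) v.
Proof.
move=> /isg_leP[e ee ->] vt; have vE : v = imul t (imul (istar v) v) := vt.
rewrite -imulA (idemC ee (idem_istarl v)) imulA -vE; exact: isg_le_mulr.
Qed.

End InverseSemigroup.

(** * Compact open sets and Stone duality *)

Section CompactOpen.
Variable X : topologicalType.
Implicit Types A B K U V : set X.

Lemma filter_seq_forall (F : set_system X) (I : eqType) (s : seq I) (B : I -> set X) :
  Filter F -> (forall i, i \in s -> F (B i)) ->
  F [set x | forall i, i \in s -> B i x].
Proof.
move=> FF; elim: s => [|i s IH] FB; first by apply: filterS filterT => x _ i.
apply: (@filterS _ F _ (B i `&` [set x | forall j, j \in s -> B j x])).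
  by move=> x [Bi Bs] j; rewrite in_cons => /predU1P[->//|/Bs].
apply: filterI; first by apply: FB; rewrite mem_head.
by apply: IH => j js; apply: FB; rewrite in_cons js orbT.
Qed.

(** Covers are indexed by arbitrary types so that this matches the form of [gcompact]. *)
Lemma compact_coverP K : compact K <->
  forall (I : Type) (U : I -> set X), (forall i, open (U i)) ->
    K `<=` \bigcup_i U i ->
    exists2 F : set I, finite_set F & K `<=` \bigcup_(i in F) U i.
Proof.
split=> [/compact_near_coveringP cK I U oU KU|cK F PF FK].
  (* [Fin] consists of the properties that hold of every large enough index set [D]; near covering
     along it yields one finite [D]. *)
  pose Fin := [set W : set (set I) |
    exists2 D0 : set I, finite_set D0 & forall D, D0 `<=` D -> W D].
  have FF : Filter Fin.
    split.
    - by exists set0.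
    - move=> P Q [D fD hD] [D' fD' hD']; exists (D `|` D'); first by rewrite finite_setU.
      by move=> E; rewrite subUset => -[/hD ? /hD' ?].
    - by move=> P Q PQ [D fD hD]; exists D => // E /hD/PQ.
  have [|D fD hD] := cK _ Fin (fun D x => exists2 i, D i & U i x) FF.
    move=> x Kx; have [i _ Uix] := KU _ Kx.
    exists (U i, [set D | D i]) => /=.
      split; first exact: open_nbhs_nbhs.
      by exists [set i] => // D; apply.
    by move=> [y D] [/= Uy Di]; exists i.
  by exists D => // x Kx; have [i Di Ui] := hD _ (@subset_refl _ D) _ Kx; exists i.
apply: contrapT => /set0P/negP; rewrite negbK => /eqP KF.
(* If [F] does not cluster in [K], the open sets missing some member of [F] cover [K]. The members
   attached to a finite subcover meet in a point of [K], which that subcover then fails to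
   contain. *)
pose I := {BU : set X * set X | F BU.1 /\ open BU.2 /\ BU.1 `&` BU.2 = set0}.
have [||D fD KD] := cK I (fun i => (sval i).2); first by case=> [[B U] [? []]].
  move=> x Kx; have : ~ cluster F x.
    by move=> cx; have : (K `&` cluster F) x by []; rewrite KF.
  move=> /existsNP[B] /existsNP[U] /not_implyP[FB] /not_implyP[nU BU].
  move: nU; rewrite nbhsE => -[O [oO Ox] OU].
  suff h : F (B, O).1 /\ open (B, O).2 /\ (B, O).1 `&` (B, O).2 = set0.
    by exists (exist _ (B, O) h).
  split => //; split => //=; apply: contrapT => /eqP/set0P[y [By Oy]].
  by apply: BU; exists y; split => //; exact: OU.
have /finite_seqP[s sD] : finite_set (D : set {classic I}) by [].
have FB := @filter_seq_forall F {classic I} s (fun i => (sval (i : I)).1) _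
  (fun i _ => (svalP (i : I)).1).
have [x [Kx xs]] := filter_ex (filterI FK (FB _)).
have [i Di xi] := KD _ Kx.
have si : (i : {classic I}) \in s by move: Di; rewrite sD.
have [_ [_ i0]] := svalP i.
have : ((sval i).1 `&` (sval i).2) x by split=> //; exact: (xs i si).
by rewrite i0.
Qed.

Definition compopen V := compact V /\ open V.

Definition co_base := forall x U, nbhs x U -> exists V, [/\ compopen V, V x & V `<=` U].

Lemma compopen0 : compopen set0.
Proof. by split; [exact: compact0|exact: open0]. Qed.

Lemma compopenU U V : compopen U -> compopen V -> compopen (U `|` V).
Proof. by move=> [? ?] [? ?]; split; [exact: compactU|exact: openU]. Qed.

Hypothesis hX : hausdorff_space X.

Lemma compopenI U V : compopen U -> compopen V -> compopen (U `&` V).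
Proof.
move=> [cU oU] [cV oV]; split; last exact: openI.
by apply: compact_closedI => //; exact: compact_closed.
Qed.

Lemma compopenD U V : compopen U -> compopen V -> compopen (U `\` V).
Proof.
move=> [cU oU] [cV oV]; rewrite setDE; have clV := compact_closed hX cV.
split; last by apply: openI => //; exact: closed_openC.
by apply: compact_closedI => //; exact: open_closedC.
Qed.

Hypothesis bX : co_base.

Lemma co_separated x y : x <> y -> exists V, [/\ compopen V, V x & ~ V y].
Proof.
move=> xy; have [|V [cV Vx sV]] := bX (x := x) (U := ~` [set y]).
  apply: open_nbhs_nbhs; split => //; apply: closed_openC.
  by apply: accessible_closed_set1; exact: hausdorff_accessible.
by exists V; split => // /sV; apply.
Qed.

(** A finite cover of [K] is made disjoint by removing from each piece what is already covered; the
    differences stay compact open. As these remainders are uncontrolled, [P] is required near each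
    point for all small [V], not for one. *)
Lemma co_ind (P : set X -> Prop) K : compopen K ->
  P set0 ->
  (forall V W, compopen V -> compopen W -> V `&` W = set0 ->
     P V -> P W -> P (V `|` W)) ->
  (forall x, K x -> exists2 U, open U /\ U x &
     forall V, compopen V -> V `<=` U -> V `<=` K -> P V) ->
  P K.
Proof.
move=> [cK oK] P0 PU Ploc.
pose good V := compopen V /\ forall W, compopen W -> W `<=` V -> W `<=` K -> P W.
have [||D fD KD] := (compact_coverP K).1 cK {V | good V} (fun p => sval p).
- by move=> [V [[]]].
- move=> x Kx; have [U [oU Ux] UP] := Ploc x Kx.
  have [V [cV Vx VU]] := bX (open_nbhs_nbhs (conj oU Ux)).
  have gV : good V by split=> // W cW WV; apply: UP => //; exact: subset_trans VU.
  by exists (exist _ V gV).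
have /finite_seqP[s sD] : finite_set (D : set {classic {V | good V}}) by [].
pose L (s : seq {V | good V}) := foldr (fun p A => sval p `|` A) set0 s.
have PL s' : compopen (K `&` L s') /\ P (K `&` L s').
  elim: s' => [|V s' [cs Ps]] /=; first by rewrite setI0; split => //; exact: compopen0.
  have [cV PV] := svalP V; set V' := sval V in cV PV *.
  have -> : K `&` (V' `|` L s') = (K `&` L s') `|` ((K `&` V') `\` (K `&` L s')).
    apply/seteqP; split=> x /=.
      move=> [Kx VLx]; case: (pselect (L s' x)) => Lx; [by left|right].
      by split=> [|[]//]; split => //; case: VLx.
    by case=> [[? ?]|[[? ?] ?]]; split => //; [right|left].
  have cKV : compopen (K `&` V') by exact: compopenI.
  have cD := compopenD cKV cs; split; first exact: compopenU.
  apply: PU => //; first by apply/seteqP; split => x // [? [_ ?]].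
  by apply: PV => // x [[]].
suff KE : K = K `&` L s by rewrite KE; exact: (PL s).2.
apply/seteqP; split => [x Kx|x []//]; split => //.
have [V DV Vx] := KD _ Kx.
have : (V : {classic {V | good V}}) \in s by move: DV; rewrite sD.
elim: s {sD PL} => // W s IH; rewrite in_cons => /predU1P[<-|/IH]; [by left|by right].
Qed.

End CompactOpen.

(** Refine the cover of X_e by a small neighbourhood of [x] and the complement of [x]: the piece
    containing [x] must lie in the neighbourhood. It is clopen only relative to X_e, but the
    neighbourhood has compact closure inside X_e, so the piece is compact and open in [X]. *)
Lemma almost_ample_base (S : invSemigroup) (X : topologicalType) (th : partial_action S X) :
  almost_ample th -> co_base X.
Proof.
move=> [lX [hX uX]] x U Ux; have [e [_ ex]] := pcover _ _ th x.
have [K cK Kx] := lX x.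
have [|V Vx VN] := @compact_regular X x K hX cK Kx (U `&` pdom th e `&` K).
  by do 2?apply: filterI => //; apply: open_nbhs_nbhs; split => //; exact: pdom_open.
have cV : compact (closure V).
  by apply: subclosed_compact cK _; [exact: closed_closure|move=> y /VN[]].
pose W (b : bool) := if b then V^° else ~` [set x].
have [||J [C [clC [_ [Ccov Cref]]]]] := uX e bool W.
- case=> /=; first exact: open_interior.
  by apply: closed_openC; apply: accessible_closed_set1; exact: hausdorff_accessible.
- by move=> y ey; case: (pselect (y = x)) => [->|yx]; [exists true|exists false].
have [j _ Cjx] := Ccov x ex; have [[] CW] := Cref j; last by have /(_ erefl) := CW x Cjx.
have [Ce [[O [oO CO]] [D [clD CD]]]] := clC j.
have CV : C j `<=` closure V.
  by move=> y /CW/interior_subset; exact: subset_closure.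
exists (C j); split => //; last by move=> y /CV/VN[[]].
split; last by rewrite CO; apply: openI => //; exact: pdom_open.
suff -> : C j = closure V `&` D by exact: compact_closedI.
apply/seteqP; split => y; first by move=> Cy; split; [exact: CV|move: Cy; rewrite CD => -[]].
by move=> [/VN[[_ ey] _] Dy]; rewrite CD.
Qed.

Lemma stone_point_map (X Y : topologicalType) (F : set X -> set Y) :
  hausdorff_space X -> co_base X -> hausdorff_space Y -> co_base Y ->
  set_bij (@compopen X) (@compopen Y) F ->
  (forall U V, compopen U -> compopen V -> F (U `&` V) = F U `&` F V) ->
  exists phi : X -> Y, forall V, compopen V -> forall x, V x <-> F V (phi x).
Proof.
move=> hX bX hY bY [Fco Finj Fsurj] FI.
have F0 : F set0 = set0.
  have [V cV FV] := Fsurj _ (@compopen0 Y).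
  by rewrite -(setI0 V) FI// ?FV ?set0I//; exact: compopen0.
have disj U V : compopen U -> compopen V -> U `&` V = set0 -> F U `&` F V = set0.
  by move=> cU cV UV; rewrite -FI// UV.
have /choice[phi phiP] : forall x, exists y, forall V, compopen V -> V x -> F V y.
  move=> x; have [V0 [cV0 V0x _]] := bX x setT filterT.
  apply: contrapT => /forallNP nF.
  have [cFV0 oFV0] : compopen (F V0) by exact: Fco.
  have [||D fD FD] := (compact_coverP _).1 cFV0
      {V | compopen V /\ V x} (fun p => ~` F (sval p)).
  - move=> [V [cV Vx]] /=; apply: closed_openC; apply: compact_closed => //.
    by have [] := Fco _ cV.
  - move=> y _; have /existsNP[V /not_implyP[cV /not_implyP[Vx FVy]]] := nF y.
    by exists (exist _ V (conj cV Vx)).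
  have /finite_seqP[s sD] : finite_set (D : set {classic {V | compopen V /\ V x}}) by [].
  (* Starting the intersection at [V0] keeps its image inside [F V0], the compact set covered by the
     complements of the sets [F V]. *)
  pose L s := foldr (fun (p : {V | compopen V /\ V x}) A => sval p `&` A) V0 s.
  have [cL Lx] : compopen (L s) /\ L s x.
    elim: {sD} s => [//|p s [cs Ls]] /=; have [cp px] := svalP p.
    by split; [exact: compopenI|split].
  have FL : F (L s) `<=` F V0 /\ forall p, p \in s -> F (L s) `<=` F (sval p).
    elim: {sD} s {cL Lx} => [|p s [IH1 IH2]] /=; first by split.
    have [cp px] := svalP p.
    have [cL Lx] : compopen (L s) /\ L s x.
      elim: s {IH1 IH2} => [//|q s [cs Ls]] /=; have [cq qx] := svalP q.
      by split; [exact: compopenI|split].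
    rewrite FI//; split; first by move=> y [_ /IH1].
    by move=> q; rewrite in_cons => /predU1P[->|/IH2 qs] y [] //; move=> _ /qs.
  suff FL0 : F (L s) = set0.
    have : L s = set0 by apply: Finj; rewrite ?inE ?F0//; exact: compopen0.
    by move=> L0; rewrite L0 in Lx.
  apply/seteqP; split=> // y FLy.
  have [p Dp] := FD _ (FL.1 _ FLy); apply.
  by apply: FL.2 FLy; move: Dp; rewrite sD.
exists phi => V cV x; split; first exact: phiP.
(* If [x] is not in [V], it has a compact open neighbourhood disjoint from [V], whose image contains
   [phi x] and is disjoint from [F V]. *)
move=> FVx; apply: contrapT => nVx; have [V1 [cV1 V1x _]] := bX x setT filterT.
have cD := compopenD hX cV1 cV.
have : (F (V1 `\` V) `&` F V) (phi x) by split => //; apply: phiP.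
by rewrite disj//; apply/seteqP; split => y // [[]].
Qed.

Lemma stone_duality (X Y : topologicalType) (F : set X -> set Y) :
  hausdorff_space X -> co_base X -> hausdorff_space Y -> co_base Y ->
  set_bij (@compopen X) (@compopen Y) F ->
  (forall U V, compopen U -> compopen V -> F (U `&` V) = F U `&` F V) ->
  exists (phi : X -> Y) (psi : Y -> X),
    [/\ cancel phi psi, cancel psi phi, continuous phi, continuous psi &
        forall V, compopen V -> forall x, V x <-> F V (phi x)].
Proof.
move=> hX bX hY bY Fb FI; have [Fco Finj Fsurj] := Fb.
have /choice[G GP] : forall W, exists V, compopen W -> compopen V /\ F V = W.
  move=> W; case: (pselect (compopen W)) => [/Fsurj[V cV <-]|nW]; first by exists V.
  by exists set0.
have Gco W : compopen W -> compopen (G W) by move=> /GP[].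
have FG W : compopen W -> F (G W) = W by move=> /GP[].
have GF V : compopen V -> G (F V) = V.
  move=> cV; have cF := Fco _ cV.
  by apply: Finj; rewrite ?inE; [exact: Gco| |rewrite FG].
have [phi phiP] := stone_point_map hX bX hY bY Fb FI.
have [psi psiP] : exists psi : Y -> X, forall W, compopen W -> forall y, W y <-> G W (psi y).
  apply: stone_point_map => //.
    split=> //.
    - move=> U V; rewrite !inE => cU cV GUV.
      by rewrite -(FG U)// GUV FG.
    - by move=> V cV; exists (F V); [exact: Fco|exact: GF].
  move=> U V cU cV; apply: Finj; rewrite ?inE.
  - by apply: Gco; exact: compopenI.
  - by apply: compopenI => //; exact: Gco.
  - by rewrite FI ?FG//; [exact: compopenI|exact: Gco|exact: Gco].
exists phi, psi; split.
- move=> x; apply: contrapT => /(co_separated hX bX)[V [cV Vx]]; apply.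
  by apply/(phiP _ cV)/(psiP _ (Fco _ cV)); rewrite GF.
- move=> y; apply: contrapT => /(co_separated hY bY)[V [cV Vx]]; apply.
  by apply/(psiP _ cV)/(phiP _ (Gco _ cV)); rewrite FG.
- move=> x N /bY[W [cW Wx WN]]; rewrite nbhsE.
  have [cG oG] := Gco _ cW; exists (G W) => //.
    by split => //; apply/phiP => //; rewrite FG.
  by move=> z Gz; apply: WN; rewrite -(FG W)//; apply/phiP.
- move=> y N /bX[V [cV Vx VN]]; rewrite nbhsE.
  have [cG oG] := Fco _ cV; exists (F V) => //.
    by split => //; apply/psiP => //; rewrite GF.
  by move=> z Gz; apply: VN; rewrite -(GF V)//; apply/psiP => //; exact: Fco.
- exact: phiP.
Qed.

(** * The groupoid of germs *)

Arguments germ {S X}.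
Arguments germ_basic {S X}.

Section Germs.
Variables (S : invSemigroup) (X : topologicalType) (th : partial_action S X).
Implicit Types (s t u e : S) (x y : X).
Local Notation dom s := (pdom th (istar s)).
Local Notation act s := (Defs.pmap th s).
Local Notation G := (germ_groupoid th).

Lemma dom_open s : open (dom s).
Proof. exact: pdom_open. Qed.

Lemma near_dom s x : dom s x -> \forall y \near x, dom s y.
Proof. by move=> sx; apply: open_nbhs_nbhs; split => //; exact: dom_open. Qed.

Lemma dom_star s x : dom (istar s) x <-> pdom th s x.
Proof. by rewrite istarK. Qed.

Lemma act_star s x : dom s x -> dom (istar s) (act s x).
Proof. by move=> sx; rewrite istarK; exact: pmap_into. Qed.

Lemma actK s x : dom s x -> act (istar s) (act s x) = x.
Proof. exact: pmap_inv. Qed.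

Lemma act_inj s x y : dom s x -> dom s y -> act s x = act s y -> x = y.
Proof. by move=> sx sy xy; rewrite -(actK sx) xy actK. Qed.

Lemma dom_mul s t x : dom t x -> dom s (act t x) -> dom (imul s t) x.
Proof. by move=> tx sx; have [] := pmap_comp _ _ th s t x tx sx. Qed.

Lemma act_mul s t x : dom t x -> dom s (act t x) -> act (imul s t) x = act s (act t x).
Proof. by move=> tx sx; have [] := pmap_comp _ _ th s t x tx sx. Qed.

Lemma dom_le s t x : isg_le s t -> dom s x -> dom t x.
Proof. by move=> st sx; have [] := pmap_mono _ _ th s t st x sx. Qed.

Lemma act_le s t x : isg_le s t -> dom s x -> act s x = act t x.
Proof. by move=> st sx; have [] := pmap_mono _ _ th s t st x sx. Qed.

Lemma dom_istarl s x : dom s x -> dom (imul (istar s) s) x.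
Proof. by move=> sx; apply: dom_mul => //; exact: act_star. Qed.

Lemma act_idem e x : idem e -> dom e x -> act e x = x.
Proof.
move=> ee ex; have ex' : dom e (act e x) by rewrite -{1}(idem_star ee); exact: act_star.
by rewrite -{1}ee act_mul// -{1}(idem_star ee) actK.
Qed.

Lemma dom_mul_idem s e x : idem e -> dom e x -> dom s x -> dom (imul s e) x.
Proof. by move=> ee ex sx; apply: dom_mul => //; rewrite act_idem. Qed.

Lemma act_cvg s x : dom s x -> act s y @[y --> x] --> act s x.
Proof.
move=> sx; have /subspace_continuousP/(_ _ sx) h := pmap_cont _ _ th s.
move=> U /h; rewrite /= /within /nbhs /= => hU.
by apply: filterS2 (near_dom sx) hU => y sy /(_ sy).
Qed.

Lemma near_act s x (P : X -> Prop) : dom s x ->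
  (\forall y \near act s x, P y) -> \forall y \near x, P (act s y).
Proof. by move=> sx; exact: act_cvg. Qed.

Definition germ_eq s t x := exists u, [/\ isg_le u s, isg_le u t & dom u x].

Lemma germ_eq_refl s x : dom s x -> germ_eq s s x.
Proof. by exists s; split => //; exact: isg_le_refl. Qed.

Lemma germ_eq_sym s t x : germ_eq s t x -> germ_eq t s x.
Proof. by move=> [u [us ut ux]]; exists u. Qed.

Lemma germ_eq_trans s t r x : germ_eq s t x -> germ_eq t r x -> germ_eq s r x.
Proof.
move=> [u [us ut ux]] [v [vt vr vx]]; exists (imul u (imul (istar v) v)); split.
- apply: isg_le_trans us; apply: isg_le_mulr; exact: idem_istarl.
- apply: isg_le_trans vr; exact: isg_le_common ut vt.
- by apply: dom_mul_idem => //; [exact: idem_istarl|exact: dom_istarl].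
Qed.

Lemma germ_eq_dom s t x : germ_eq s t x -> dom s x.
Proof. by move=> [u [us ut ux]]; exact: dom_le ux. Qed.

Lemma germ_eq_act s t x : germ_eq s t x -> act s x = act t x.
Proof. by move=> [u [us ut ux]]; rewrite -(act_le us)// (act_le ut). Qed.

Lemma germ_eq_near s t x : germ_eq s t x -> \forall y \near x, germ_eq s t y.
Proof. by move=> [u [us ut ux]]; apply: filterS (near_dom ux) => y uy; exists u. Qed.

Lemma germ_eq_mul s s' t t' x : germ_eq t t' x -> germ_eq s s' (act t x) ->
  germ_eq (imul s t) (imul s' t') x.
Proof.
move=> [v [vt vt' vx]] [u [us us' ux]]; exists (imul u v); split; try exact: isg_leM.
by apply: dom_mul => //; rewrite (act_le vt).
Qed.

Lemma germ_eq_star s s' x : germ_eq s s' x -> germ_eq (istar s) (istar s') (act s x).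
Proof.
move=> [u [us us' ux]]; exists (istar u); split; try exact: isg_le_star.
by rewrite -(act_le us)//; exact: act_star.
Qed.

Lemma germP s x t y : germ th s x (t, y) <-> y = x /\ germ_eq t s x.
Proof.
split=> [[_ [/= -> [u [? ? ?]]]]|[-> [u [us ut ux]]]]; first by split => //; exists u.
by split; [exact: dom_le ux|split => //; exists u].
Qed.

Lemma eq_germP s x t y : dom s x -> germ th s x = germ th t y <-> x = y /\ germ_eq s t x.
Proof.
move=> sx; split=> [E|[<- st]].
  have : germ th s x (s, x) by apply/germP; split => //; exact: germ_eq_refl.
  by rewrite E => /germP[-> ].
apply/seteqP; split=> -[r z] /germP[-> h]; apply/germP; split => //.
  exact: germ_eq_trans st.
by apply: germ_eq_trans h _; exact: germ_eq_sym.
Qed.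

(* The germ at x of any idempotent defined at x, without a choice of idempotent. *)
Definition unit_germ x : set (S * X) :=
  [set p | p.2 = x /\ exists e, [/\ idem e, isg_le e p.1 & dom e x]].

Lemma germ_idem e x : idem e -> dom e x -> germ th e x = unit_germ x.
Proof.
move=> ee ex; apply/seteqP; split=> -[t y].
  move=> /germP[-> [u [ut ue ux]]]; split => //; exists u; split => //.
  exact: isg_le_idem ue.
move=> [/= -> [f [ff ft fx]]]; apply/germP; split => //; exists (imul f e); split.
- by apply: isg_le_trans ft; exact: isg_le_mulr.
- exact: isg_le_mull.
- exact: dom_mul_idem.
Qed.

Lemma idem_at x : exists2 e, idem e & dom e x.
Proof. by have [e [ee ex]] := pcover _ _ th x; exists e => //; rewrite idem_star. Qed.

Lemma unit_germ_inj : injective unit_germ.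
Proof.
move=> x y xy; have [e ee ex] := idem_at x.
have : unit_germ x (e, x) by split => //; exists e; split => //; exact: isg_le_refl.
by rewrite xy => -[].
Qed.

Lemma garr_germ s x : dom s x -> garr G (germ th s x).
Proof. by move=> sx; exists s, x. Qed.

Lemma garr_unit x : garr G (unit_germ x).
Proof. by have [e ee ex] := idem_at x; rewrite -(germ_idem ee ex); exact: garr_germ. Qed.

Lemma gsrc_germ s x : dom s x -> gsrc G (germ th s x) = unit_germ x.
Proof.
move=> sx; have E t y : germ th s x (t, y) -> germ th (imul (istar t) t) y = unit_germ x.
  move=> /germP[-> /germ_eq_dom tx]; apply: germ_idem; first exact: idem_istarl.
  exact: dom_istarl.
apply/seteqP; split=> p; first by move=> [[t y] /E E1 /=]; rewrite E1.
have sxx : germ th s x (s, x) by apply/germP; split => //; exact: germ_eq_refl.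
by rewrite -(E _ _ sxx); exists (s, x).
Qed.

Lemma grng_germ s x : dom s x -> grng G (germ th s x) = unit_germ (act s x).
Proof.
move=> sx; have E t y : germ th s x (t, y) ->
    germ th (imul t (istar t)) (act t y) = unit_germ (act s x).
  move=> /germP[-> ts]; rewrite -(germ_eq_act ts); have tx := germ_eq_dom ts.
  apply: germ_idem; first exact: idem_istarr.
  by have := dom_istarl (act_star tx); rewrite istarK.
apply/seteqP; split=> p; first by move=> [[t y] /E E1 /=]; rewrite E1.
have sxx : germ th s x (s, x) by apply/germP; split => //; exact: germ_eq_refl.
by rewrite -(E _ _ sxx); exists (s, x).
Qed.

Lemma gmul_germ s t x : dom t x -> dom s (act t x) ->
  gmul G (germ th s (act t x)) (germ th t x) = germ th (imul s t) x.
Proof.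
move=> tx sx.
have E s' t' y z : germ th s (act t x) (s', y) -> germ th t x (t', z) ->
    germ th (imul s' t') z = germ th (imul s t) x.
  move=> /germP[_ ss] /germP[-> tt]; apply/eq_germP.
    by apply: germ_eq_dom (germ_eq_mul tt _); rewrite (germ_eq_act tt); exact: ss.
  by split => //; apply: germ_eq_mul => //; rewrite (germ_eq_act tt).
apply/seteqP; split=> p.
  by move=> [[s' y] [[t' z] [/= sy tz _]]]; rewrite (E _ _ _ _ sy tz).
have sxx : germ th s (act t x) (s, act t x) by apply/germP; split => //; exact: germ_eq_refl.
have txx : germ th t x (t, x) by apply/germP; split => //; exact: germ_eq_refl.
by exists (s, act t x), (t, x).
Qed.

Lemma ginv_germ s x : dom s x -> ginv G (germ th s x) = germ th (istar s) (act s x).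
Proof.
move=> sx; have E t y : germ th s x (t, y) ->
    germ th (istar t) (act t y) = germ th (istar s) (act s x).
  move=> /germP[-> ts]; apply/eq_germP.
    by apply: act_star; exact: germ_eq_dom ts.
  by split; [exact: germ_eq_act|exact: germ_eq_star].
apply/seteqP; split=> p; first by move=> [[t y] /E E1 /=]; rewrite E1.
have sxx : germ th s x (s, x) by apply/germP; split => //; exact: germ_eq_refl.
by exists (s, x).
Qed.

Lemma gsrc_unit x : gsrc G (unit_germ x) = unit_germ x.
Proof. by have [e ee ex] := idem_at x; rewrite -{1}(germ_idem ee ex) gsrc_germ. Qed.

Lemma grng_unit x : grng G (unit_germ x) = unit_germ x.
Proof. by have [e ee ex] := idem_at x; rewrite -{1}(germ_idem ee ex) grng_germ// act_idem. Qed.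

Lemma ginv_unit x : ginv G (unit_germ x) = unit_germ x.
Proof.
have [e ee ex] := idem_at x.
by rewrite -{1}(germ_idem ee ex) ginv_germ// act_idem// idem_star// germ_idem.
Qed.

Lemma gmul_unitr s x : dom s x -> gmul G (germ th s x) (unit_germ x) = germ th s x.
Proof.
move=> sx; have [e ee ex] := idem_at x.
rewrite -(germ_idem ee ex) -{1}(act_idem ee ex) gmul_germ ?act_idem//.
have se : dom (imul s e) x by exact: dom_mul_idem.
apply/eq_germP => //; split => //; exists (imul s e).
by split => //; [exact: isg_le_refl|exact: isg_le_mulr].
Qed.

Lemma gmul_unitl s x : dom s x ->
  gmul G (unit_germ (act s x)) (germ th s x) = germ th s x.
Proof.
move=> sx; have [e ee ex] := idem_at (act s x).
have se : dom (imul e s) x by exact: dom_mul.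
rewrite -(germ_idem ee ex) gmul_germ//; apply/eq_germP => //.
split => //; exists (imul e s).
by split => //; [exact: isg_le_refl|exact: isg_le_mull].
Qed.

Lemma garr_ind (P : set (S * X) -> Prop) :
  (forall s x, dom s x -> P (germ th s x)) -> forall g, garr G g -> P g.
Proof. by move=> h g [s [x [sx ->]]]; exact: h. Qed.

Lemma gunitsP g : gunits G g <-> exists x, g = unit_germ x.
Proof.
split=> [[gG]|[x ->]]; last by split; [exact: garr_unit|exact: gsrc_unit].
by move: g gG; apply: garr_ind => s x sx; rewrite gsrc_germ// => <-; exists x.
Qed.

(** Openness is restated with neighbourhood filters on [X] and any fixed representative of the germ.
    A basic set may use another representative, but equality of two germs persists at nearby
    points. *)
Lemma gopenP W : gopen G W <-> W `<=` garr G /\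
  forall s x, dom s x -> W (germ th s x) -> \forall y \near x, W (germ th s y).
Proof.
split=> [[Warr Wop]|[Warr Wop]]; split => //.
  move=> s x sx /Wop[t [U [oU Ut [y Uy yx] UW]]].
  move: yx => /eq_germP; move=> /(_ (Ut _ Uy))[yx ts]; subst y.
  have Ux : \forall y \near x, U y by apply: open_nbhs_nbhs.
  apply: filterS2 Ux (germ_eq_near ts) => y Uy' ts'; apply: UW; exists y => //.
  by apply/eq_germP; [exact: Ut|].
move=> A WA; have AG := Warr _ WA; move: A AG WA; apply: garr_ind => s x sx WA.
exists s, ([set y | W (germ th s y)]° `&` dom s); split.
- by apply: openI; [exact: open_interior|exact: dom_open].
- by move=> y [].
- by exists x => //; split => //; exact: Wop.
- by move=> _ [y [Wy _] <-]; exact: interior_subset Wy.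
Qed.

Lemma gopen_arr W : gopen G W -> W `<=` garr G.
Proof. by case. Qed.

Lemma gopenI U V : gopen G U -> gopen G V -> gopen G (U `&` V).
Proof.
move=> /gopenP[Ua Uo] /gopenP[Va Vo]; apply/gopenP; split=> [g []|s x sx [Ux Vx]].
  by move=> /Ua.
by apply: filterS2 (Uo _ _ sx Ux) (Vo _ _ sx Vx).
Qed.

Lemma gopen_unit W x : gopen G W -> W (unit_germ x) -> \forall y \near x, W (unit_germ y).
Proof.
move=> /gopenP[_ Wo]; have [e ee ex] := idem_at x; rewrite -(germ_idem ee ex).
move=> /(Wo _ _ ex) We; apply: filterS2 We (near_dom ex) => y We ey.
by rewrite -(germ_idem ee ey).
Qed.

(** The last hypothesis is continuity of [m] on [V], phrased for the bare family [gopen]. *)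
Lemma gcompact_image (m : X -> set (S * X)) V : compact V ->
  (forall x, V x -> garr G (m x)) ->
  (forall W x, gopen G W -> V x -> W (m x) -> \forall y \near x, W (m y)) ->
  gcompact G (m @` V).
Proof.
move=> /compact_coverP cV Va Vo; split; first by move=> _ [x Vx <-]; exact: Va.
move=> I W oW VW.
have [||F fF VF] := cV I (fun i => [set y | W i (m y)]°).
- by move=> i; exact: open_interior.
- move=> x Vx; have [i _ Wi] := VW _ (imageP m Vx); exists i => //.
  exact: Vo.
by exists F => // _ [x Vx <-]; have [i Fi /interior_subset Wi] := VF _ Vx; exists i.
Qed.

Lemma germ_basic_open s U : open U -> U `<=` dom s -> gopen G (germ_basic th s U).
Proof.
move=> oU Us; split; first by move=> _ [x Ux <-]; apply: garr_germ; exact: Us.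
by move=> A UA; exists s, U; split.
Qed.

Lemma germ_basic_cobis s V : compopen V -> V `<=` dom s -> cobis G (germ_basic th s V).
Proof.
move=> [cV oV] Vs; split; first exact: germ_basic_open.
split.
  apply: gcompact_image => // [x /Vs|W x /gopenP[_ Wo] /Vs sx Wx]; first exact: garr_germ.
  exact: Wo.
split.
- by move=> _ [x /Vs sx <-]; exact: garr_germ.
- move=> g h; rewrite !inE => -[x /Vs sx <-] [y /Vs sy <-].
  by rewrite !gsrc_germ// => /unit_germ_inj ->.
- move=> g h; rewrite !inE => -[x /Vs sx <-] [y /Vs sy <-].
  by rewrite !grng_germ// => /unit_germ_inj /act_inj ->.
Qed.

Lemma unit_cobis V : compopen V -> cobis G (unit_germ @` V).
Proof.
move=> [cV oV]; split.
  apply/gopenP; split; first by move=> _ [x _ <-]; exact: garr_unit.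
  move=> s x sx [y Vy ys]; have [e ee ey] := idem_at y.
  move: ys; rewrite -(germ_idem ee ey) => /(eq_germP s x ey)[yx es]; subst y.
  have Vx : \forall y \near x, V y by exact: open_nbhs_nbhs.
  apply: filterS2 Vx (germ_eq_near es) => y Vy' es'; exists y => //.
  rewrite -(germ_idem ee (germ_eq_dom es')); apply/eq_germP; [exact: germ_eq_dom es'|by []].
split.
  apply: gcompact_image => // [x _|W x oW _ Wx]; first exact: garr_unit.
  exact: gopen_unit.
split.
- by move=> _ [x _ <-]; exact: garr_unit.
- by move=> g h; rewrite !inE => -[x _ <-] [y _ <-]; rewrite !gsrc_unit.
- by move=> g h; rewrite !inE => -[x _ <-] [y _ <-]; rewrite !grng_unit.
Qed.

Definition src_set (U : set (set (S * X))) : set X :=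
  [set x | exists2 g, U g & gsrc G g = unit_germ x].

Lemma src_set_compact U : gcompact G U -> compact (src_set U).
Proof.
move=> [Ua cU]; apply/compact_coverP => I O oO UO.
pose W i := [set g | garr G g /\ exists2 x, O i x & gsrc G g = unit_germ x].
have [||F fF UF] := cU I W.
- move=> i; apply/gopenP; split=> [g []//|s x sx [_ [y Oy]]].
  rewrite gsrc_germ// => /unit_germ_inj xy; subst y.
  have Ox : \forall y \near x, O i y by exact: open_nbhs_nbhs.
  apply: filterS2 Ox (near_dom sx) => y Oy' sy; split; first exact: garr_germ.
  by exists y => //; rewrite gsrc_germ.
- move=> g Ug; have gG := Ua _ Ug; move: g gG Ug; apply: garr_ind => s x sx Ug.
  have [|i _ Oi] := UO x; first by exists (germ th s x) => //; rewrite gsrc_germ.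
  by exists i => //; split; [exact: garr_germ|exists x => //; rewrite gsrc_germ].
exists F => // x [g Ug gx]; have [i Fi [_ [y Oy]]] := UF _ Ug.
by rewrite gx => /unit_germ_inj xy; exists i => //; rewrite xy.
Qed.

Lemma src_set_open U : gopen G U -> open (src_set U).
Proof.
move=> /gopenP[Ua Uo]; rewrite openE => x [g Ug]; have gG := Ua _ Ug; move: g gG Ug.
apply: garr_ind => s y sy Us; rewrite gsrc_germ// => /unit_germ_inj yx; subst y.
apply: filterS2 (Uo _ _ sy Us) (near_dom sy) => y Uy sy'.
by exists (germ th s y) => //; rewrite gsrc_germ.
Qed.

Lemma src_set_cobis U : cobis G U -> compopen (src_set U).
Proof. by move=> [oU [cU _]]; split; [exact: src_set_compact|exact: src_set_open]. Qed.

(* By density it suffices to compare [s,y] and [t,y] at y in Lambda, where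
   t*s fixes y and hence acts there as an idempotent; Hausdorffness then
   propagates the equality to x. *)
Lemma germ_faithful s t x : topologically_principal th -> groupoid_hausdorff G ->
  dom s x -> dom t x -> (\forall y \near x, act s y = act t y) -> germ_eq s t x.
Proof.
move=> prin hG sx tx st; apply: contrapT => nst.
have [|U [V [oU oV Us Vt UV]]] := hG _ _ (garr_germ sx) (garr_germ tx).
  by move=> /eq_germP; move=> /(_ sx)[].
have /gopenP[_ /(_ _ _ sx Us) Uo] := oU.
have /gopenP[_ /(_ _ _ tx Vt) Vo] := oV.
have clx : closure (Lambda th) x by rewrite prin.
have [y [Ly [[[[Uy Vy] sty] sy] ty]]] := clx _ (filterI (filterI (filterI (filterI Uo Vo) st)
  (near_dom sx)) (near_dom tx)).
have tsy : dom (istar t) (act s y) by rewrite sty; exact: act_star.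
have [|e [ee [ey ets]]] := Ly (imul (istar t) s) (dom_mul sy tsy).
  by rewrite act_mul// sty actK.
have geqy : germ_eq s t y.
  exists (imul t e); split; last exact: dom_mul_idem.
    apply: (@isg_le_trans _ _ (imul t (imul (istar t) s))).
      by apply: isg_leM => //; exact: isg_le_refl.
    by rewrite imulA; apply: isg_le_mull; exact: idem_istarr.
  exact: isg_le_mulr.
suff : (U `&` V) (germ th s y) by rewrite UV.
split => //; have -> : germ th s y = germ th t y by apply/eq_germP.
exact: Vy.
Qed.

End Germs.

(** * Orbit equivalences as germwise conjugacies *)

Definition loc_equiv (S T : invSemigroup) (X Y : topologicalType)
    (th : partial_action S X) (ga : partial_action T Y) (phi : X -> Y) :=
  forall s x, pdom th (istar s) x -> exists t, pdom ga (istar t) (phi x) /\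
    \forall y \near x, phi (Defs.pmap th s y) = Defs.pmap ga t (phi y).

Definition orbit_homeo (S T : invSemigroup) (X Y : topologicalType)
    (th : partial_action S X) (ga : partial_action T Y) (phi : X -> Y) (psi : Y -> X) :=
  [/\ cancel phi psi, cancel psi phi, continuous phi, continuous psi &
      loc_equiv th ga phi /\ loc_equiv ga th psi].

Lemma orbit_homeo_sym (S T : invSemigroup) (X Y : topologicalType)
    (th : partial_action S X) (ga : partial_action T Y) phi psi :
  orbit_homeo th ga phi psi -> orbit_homeo ga th psi phi.
Proof. by case=> ? ? ? ? []; split. Qed.

Lemma loc_equiv_cocycle (S T : invSemigroup) (X Y : topologicalType)
    (th : partial_action S X) (ga : partial_action T Y) (phi : X -> Y) :
  (forall s, ultraparacompact (pdom th s)) -> continuous phi -> loc_equiv th ga phi ->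
  exists a, cont_cocycle th a /\ forall s x, pdom th (istar s) x ->
    pdom ga (istar (a s x)) (phi x) /\
    phi (Defs.pmap th s x) = Defs.pmap ga (a s x) (phi x).
Proof.
move=> uX cphi lphi.
suff /choice[a aP] : forall s, exists a : X -> T,
    (forall x, pdom th (istar s) x -> exists2 U : set X, open U /\ U x &
      forall y, U y -> pdom th (istar s) y -> a y = a x) /\
    forall x, pdom th (istar s) x -> pdom ga (istar (a x)) (phi x) /\
      phi (Defs.pmap th s x) = Defs.pmap ga (a x) (phi x).
  by exists a; split=> [s x|s x]; have [a1 a2] := aP s; [exact: a1|exact: a2].
move=> s; pose P t := [set y | pdom ga (istar t) (phi y) /\
  phi (Defs.pmap th s y) = Defs.pmap ga t (phi y)].
have [||J [V [clV [dV [Vcov Vref]]]]] := uX (istar s) T (fun t => (P t)°).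
- by move=> t; exact: open_interior.
- move=> x /lphi[t [tx nt]]; exists t => //.
  have tx' : \forall y \near x, pdom ga (istar t) (phi y) by apply: cphi; exact: near_dom.
  by apply: filterS2 tx' nt => y; split.
have /choice[tj tjP] := Vref.
have /choice[a aP] : forall x, exists t, pdom th (istar s) x -> exists2 j, V j x & t = tj j.
  move=> x; case: (pselect (pdom th (istar s) x)) => [/Vcov[j _ Vj]|nx].
    by exists (tj j) => _; exists j.
  (* Off the domain any value will do; the cover of [Y] by domains shows that [T] is inhabited. *)
  by have [e _] := pcover _ _ ga (phi x); exists e.
exists a; split=> x sx; last first.
  by have [j Vj ->] := aP x sx; have := tjP j _ Vj; move=> /interior_subset.
have [j Vj aj] := aP x sx; have [_ [[O [oO VO]] _]] := clV j.
exists O; first by split => //; move: Vj; rewrite VO => -[].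
move=> y Oy sy; have [k Vk ak] := aP y sy.
have Vjy : V j y by rewrite VO.
rewrite aj ak; congr tj; apply: contrapT => kj.
by have : (V k `&` V j) y by []; rewrite dV.
Qed.

Lemma coe_orbit_homeo (S T : invSemigroup) (X Y : topologicalType)
    (th : partial_action S X) (ga : partial_action T Y) :
  almost_ample th -> almost_ample ga ->
  cont_orbit_equiv th ga <-> exists phi psi, orbit_homeo th ga phi psi.
Proof.
move=> [_ [_ uX]] [_ [_ uY]]; split.
  move=> [phi [psi [a [b [[pK qK] [cp cq] ca cb [da db ea eb]]]]]].
  exists phi, psi; split => //; split.
    move=> s x sx; exists (a s x); split; first exact: da.
    have [U [oU Ux] aU] := ca s x sx.
    have Ux' : \forall y \near x, U y by exact: open_nbhs_nbhs.
    by apply: filterS2 Ux' (near_dom sx) => y Uy sy; rewrite ea// aU.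
  move=> t y ty; exists (b t y); split; first exact: db.
  have [U [oU Uy] bU] := cb t y ty.
  have Uy' : \forall y' \near y, U y' by exact: open_nbhs_nbhs.
  by apply: filterS2 Uy' (near_dom ty) => z Uz tz; rewrite eb// bU.
move=> [phi [psi [pK qK cp cq [lp lq]]]].
have [a [ca aP]] := loc_equiv_cocycle uX cp lp.
have [b [cb bP]] := loc_equiv_cocycle uY cq lq.
exists phi, psi, a, b; split => //; split.
- by move=> s x /aP[].
- by move=> s x /bP[].
- by move=> s x /aP[].
- by move=> s x /bP[].
Qed.

(** * The map of germs induced by a germwise conjugacy *)

Section GermMap.
Variables (S T : invSemigroup) (X Y : topologicalType).
Variables (th : partial_action S X) (ga : partial_action T Y).
Variables (phi : X -> Y) (psi : Y -> X).
Local Notation G := (germ_groupoid th).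
Local Notation H := (germ_groupoid ga).

Definition conj_at s x t := [/\ pdom th (istar s) x, pdom ga (istar t) (phi x) &
  \forall y \near x, phi (Defs.pmap th s y) = Defs.pmap ga t (phi y)].

(** The union over all representatives of the germ and all suitable [t] avoids any choice;
    [germ_mapE] shows that they all give the same germ. *)
Definition germ_map (A : set (S * X)) : set (T * Y) :=
  [set p | exists s x t, [/\ A = germ th s x, conj_at s x t & germ ga t (phi x) p]].

Hypotheses (pK : cancel phi psi) (qK : cancel psi phi).
Hypotheses (cphi : continuous phi) (cpsi : continuous psi).

Lemma near_homeo x (P : Y -> Prop) :
  (\forall y \near x, P (phi y)) -> \forall z \near phi x, P z.
Proof.
move=> hP; have h : psi z @[z --> phi x] --> psi (phi x) by exact: cpsi.
rewrite pK in h.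
by have := h _ hP; rewrite /nbhs /=; apply: filterS => z /=; rewrite qK.
Qed.

Hypotheses (pga : topologically_principal ga) (hH : groupoid_hausdorff H).

Lemma germ_mapE s x t : conj_at s x t -> germ_map (germ th s x) = germ ga t (phi x).
Proof.
move=> [sx tx st]; apply/seteqP; split=> p; last by exists s, x, t.
move=> [s' [x' [t' [E [sx' tx' st'] tp]]]].
move: E => /(eq_germP _ _ sx)[xx ss]; subst x'.
suff -> : germ ga t (phi x) = germ ga t' (phi x) by [].
apply/eq_germP => //; split => //; apply: germ_faithful => //.
apply: near_homeo; apply: filterS (filterI (filterI st st') (germ_eq_near ss)) => y [[<- <-]].
by move=> /germ_eq_act ->.
Qed.

Lemma germ_map_unit x : germ_map (unit_germ th x) = unit_germ ga (phi x).
Proof.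
have [e ee ex] := idem_at th x; have [f ff fx] := idem_at ga (phi x).
rewrite -(germ_idem ee ex) -(germ_idem ff fx); apply: germ_mapE; split => //.
have fx' : \forall y \near x, pdom ga (istar f) (phi y) by apply: cphi; exact: near_dom.
by apply: filterS2 (near_dom ex) fx' => y ey fy; rewrite !act_idem.
Qed.

Lemma conj_at_act s x t : conj_at s x t -> phi (Defs.pmap th s x) = Defs.pmap ga t (phi x).
Proof. by move=> [_ _ /nbhs_singleton]. Qed.

Lemma conj_at_star s x t :
  conj_at s x t -> conj_at (istar s) (Defs.pmap th s x) (istar t).
Proof.
move=> c; have [sx tx st] := c; split; first exact: act_star.
  by rewrite (conj_at_act c); exact: act_star.
have ssx := act_star sx.
have E : \forall y \near x, [/\ pdom ga (istar t) (phi y) &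
    phi (Defs.pmap th s y) = Defs.pmap ga t (phi y)].
  have tx' : \forall y \near x, pdom ga (istar t) (phi y) by apply: cphi; exact: near_dom.
  by apply: filterS2 tx' st => y; split.
have := near_act ssx; rewrite (actK sx) => /(_ _ E) {}E.
apply: filterS2 E (near_dom ssx) => y [ty sty] sy.
have : Defs.pmap th s (Defs.pmap th (istar s) y) = y.
  by rewrite -{1}(istarK s) actK.
by move=> yE; rewrite yE in sty; rewrite sty actK.
Qed.

Lemma conj_atM s s' x t t' : conj_at s' x t' -> conj_at s (Defs.pmap th s' x) t ->
  conj_at (imul s s') x (imul t t').
Proof.
move=> c' c; have [sx' tx' st'] := c'; have [sx tx st] := c.
rewrite (conj_at_act c') in tx; split; [exact: dom_mul|exact: dom_mul|].
have tnear : \forall y \near x, pdom ga (istar t) (phi (Defs.pmap th s' y)).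
  apply: (near_act (P := fun y => pdom ga (istar t) (phi y))) => //.
  by apply: cphi; apply: near_dom; rewrite (conj_at_act c').
have tnear' : \forall y \near x, pdom ga (istar t') (phi y) by apply: cphi; exact: near_dom.
apply: filterS (filterI (filterI (filterI st' (near_act sx' st)) (filterI (near_dom sx')
  (near_act sx' (near_dom sx)))) (filterI tnear tnear')) => y [[[e1 e2] [d1 d2]] [d3 d4]].
rewrite act_mul// e2 e1 act_mul//.
by rewrite -e1.
Qed.

Lemma conj_at_near s x t : conj_at s x t -> \forall y \near x, conj_at s y t.
Proof.
move=> [sx tx st].
have tx' : \forall y \near x, pdom ga (istar t) (phi y) by apply: cphi; exact: near_dom.
apply: filterS (filterI (filterI (near_dom sx) tx') (nbhs_interior st)).
by move=> y [[]].
Qed.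

Hypothesis lphi : loc_equiv th ga phi.

Lemma conj_at_ex s x : pdom th (istar s) x -> exists t, conj_at s x t.
Proof. by move=> sx; have [t [tx st]] := lphi sx; exists t. Qed.

Lemma germ_map_open U : gopen G U -> gopen H (germ_map @` U).
Proof.
move=> /gopenP[Ua Uo]; apply/gopenP; split.
  move=> _ [A UA <-]; have AG := Ua _ UA; move: A AG UA; apply: garr_ind => s x sx _.
  by have [t c] := conj_at_ex sx; rewrite (germ_mapE c); apply: garr_germ; case: c.
move=> t z tz [A UA]; have AG := Ua _ UA; move: A AG UA; apply: garr_ind => s x sx Us.
have [t' c] := conj_at_ex sx; rewrite (germ_mapE c); have [_ tx' _] := c.
move=> /(eq_germP _ _ tx')[zx tt]; subst z.
apply: near_homeo; have Hc := conj_at_near c.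
have tt' : \forall y \near x, germ_eq ga t' t (phi y) by apply: cphi; exact: germ_eq_near.
apply: filterS (filterI (filterI (Uo _ _ sx Us) Hc) tt') => y [[Uy cy] gy].
exists (germ th s y) => //; rewrite (germ_mapE cy); apply/eq_germP => //.
by case: cy.
Qed.

End GermMap.

Lemma germ_mapK (S T : invSemigroup) (X Y : topologicalType)
    (th : partial_action S X) (ga : partial_action T Y) phi psi :
  orbit_homeo th ga phi psi ->
  topologically_principal th -> groupoid_hausdorff (germ_groupoid th) ->
  topologically_principal ga -> groupoid_hausdorff (germ_groupoid ga) ->
  forall A, garr (germ_groupoid th) A -> germ_map ga th psi (germ_map th ga phi A) = A.
Proof.
move=> [pK qK cp cq [lp lq]] pth hG pga hH; apply: garr_ind => s x sx.
have [t c] := conj_at_ex lp sx.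
have -> := germ_mapE pK qK cq pga hH c.
rewrite (@germ_mapE _ _ _ _ ga th psi phi qK pK cp pth hG _ _ s) ?pK//.
have [_ tx st] := c; split=> //; first by rewrite pK.
by apply: (near_homeo pK qK cq); apply: filterS st => y sty; rewrite -sty !pK.
Qed.

Lemma orbit_homeo_iso (S T : invSemigroup) (X Y : topologicalType)
    (th : partial_action S X) (ga : partial_action T Y) phi psi :
  orbit_homeo th ga phi psi ->
  topologically_principal th -> groupoid_hausdorff (germ_groupoid th) ->
  topologically_principal ga -> groupoid_hausdorff (germ_groupoid ga) ->
  topgroupoid_iso (germ_groupoid th) (germ_groupoid ga).
Proof.
move=> o pth hG pga hH; have K := germ_mapK o pth hG pga hH.
have K' := germ_mapK (orbit_homeo_sym o) pga hH pth hG.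
have [pK qK cp cq [lp lq]] := o.
have E s x t : conj_at th ga phi s x t -> germ_map th ga phi (germ th s x) = germ ga t (phi x).
  exact: (germ_mapE pK qK cq pga hH).
have Eu := germ_map_unit th pK qK cp cq pga hH.
have arr A : garr (germ_groupoid th) A -> garr (germ_groupoid ga) (germ_map th ga phi A).
  move: A; apply: garr_ind => s x sx; have [t c] := conj_at_ex lp sx.
  by rewrite (E _ _ _ c); apply: garr_germ; case: c.
have arr' A : garr (germ_groupoid ga) A -> garr (germ_groupoid th) (germ_map ga th psi A).
  have E' y t s : conj_at ga th psi t y s -> germ_map ga th psi (germ ga t y) = germ th s (psi y).
    exact: (germ_mapE qK pK cp pth hG).
  move: A; apply: garr_ind => s x sx; have [t c] := conj_at_ex lq sx.
  by rewrite (E' _ _ _ c); apply: garr_germ; case: c.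
exists (germ_map th ga phi); split.
- split=> //.
  + by move=> A B; rewrite !inE => aA aB AB; rewrite -(K A)// AB K.
  + by move=> B aB; exists (germ_map ga th psi B); [exact: arr'|exact: K'].
- apply: garr_ind => s x sx; have [t c] := conj_at_ex lp sx; have [_ tx _] := c.
  rewrite gsrc_germ// grng_germ// ginv_germ// (E _ _ _ c) gsrc_germ// grng_germ//.
  rewrite ginv_germ// !Eu (conj_at_act c); split => //; split => //.
  by rewrite (E _ _ _ (conj_at_star cp c)) (conj_at_act c).
- move=> g h gG hG'; move: g gG h hG'; apply: garr_ind => s x sx; apply: garr_ind => s' x' sx'.
  rewrite gsrc_germ// grng_germ// => /unit_germ_inj xx; subst x.
  have [t c] := conj_at_ex lp sx; have [t' c'] := conj_at_ex lp sx'.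
  rewrite gmul_germ// (E _ _ _ c) (E _ _ _ c') (E _ _ _ (conj_atM cp c' c)).
  rewrite (conj_at_act c') gmul_germ//; first by case: c'.
  by rewrite -(conj_at_act c'); case: c.
- move=> U Ua; split=> [|oU]; first exact: germ_map_open.
  have -> : U = germ_map ga th psi @` (germ_map th ga phi @` U).
    apply/seteqP; split=> A.
      move=> UA; exists (germ_map th ga phi A); first by exists A.
      by apply: K; exact: Ua.
    by move=> [_ [B UB <-] <-]; rewrite K//; exact: Ua.
  exact: germ_map_open.
Qed.

(** * Compact open bisections *)

Section Cobis.
Variables (S : invSemigroup) (X : topologicalType) (th : partial_action S X).
Implicit Types (s t u e : S) (x y : X) (V : set X).
Local Notation dom s := (pdom th (istar s)).
Local Notation act s := (Defs.pmap th s).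
Local Notation G := (germ_groupoid th).

Lemma act_compopen s V : compopen V -> V `<=` dom s -> compopen (act s @` V).
Proof.
move=> [cV oV] Vs; split.
  by apply: continuous_compact cV; apply: continuous_subspaceW Vs _; exact: pmap_cont.
rewrite openE => _ [x Vx <-]; have sx := Vs _ Vx.
have Vx' : \forall y \near x, V y by exact: open_nbhs_nbhs.
have ssx := act_star sx.
have := @near_act _ _ th (istar s) (act s x) V ssx; rewrite (actK sx) => /(_ Vx') Vn.
apply: filterS2 Vn (near_dom ssx) => y Vy sy; exists (act (istar s) y) => //.
by rewrite -{1}(istarK s) actK.
Qed.

Lemma arr_unit g : garr G g -> exists x, gsrc G g = unit_germ th x.
Proof. by move: g; apply: garr_ind => s x sx; exists x; rewrite gsrc_germ. Qed.

Lemma arr_at g x : garr G g -> gsrc G g = unit_germ th x ->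
  exists2 s, dom s x & g = germ th s x.
Proof.
move: g; apply: garr_ind => s y sy; rewrite gsrc_germ// => /unit_germ_inj yx; subst y.
by exists s.
Qed.

Lemma gmulP g h : garr G g -> garr G h -> gsrc G g = grng G h ->
  [/\ garr G (gmul G g h), gsrc G (gmul G g h) = gsrc G h & grng G (gmul G g h) = grng G g].
Proof.
move=> gG; move: g gG h; apply: garr_ind => s y sy; apply: garr_ind => t x tx.
rewrite gsrc_germ// grng_germ// => /unit_germ_inj yx; subst y.
have stx := dom_mul tx sy.
by rewrite gmul_germ// !gsrc_germ// !grng_germ// act_mul//; split => //; exact: garr_germ.
Qed.

Lemma bis_mul_unitr (U : set (set (S * X))) V : U `<=` garr G ->
  bis_mul G U (unit_germ th @` V) = [set g | U g /\ exists2 x, V x & gsrc G g = unit_germ th x].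
Proof.
move=> Ua; apply/seteqP; split=> g.
  move=> [u [v [Uu [x Vx <-] + ->]]].
  rewrite grng_unit => ux; have [s sx us] := arr_at (Ua _ Uu) ux.
  rewrite us gmul_unitr// in Uu *; split => //; exists x => //.
  by rewrite -us.
move=> [Ug [x Vx gx]]; exists g, (unit_germ th x); split => //.
  by rewrite grng_unit.
by have [s sx gs] := arr_at (Ua _ Ug) gx; rewrite gs gmul_unitr.
Qed.

Lemma bis_mul_unitl (U : set (set (S * X))) V : U `<=` garr G ->
  bis_mul G (unit_germ th @` V) U = [set g | U g /\ exists2 x, V x & grng G g = unit_germ th x].
Proof.
move=> Ua; apply/seteqP; split=> g.
  move=> [v [u [[x Vx <-] Uu + ->]]]; rewrite gsrc_unit => ux.
  have [y uy] := arr_unit (Ua _ Uu); have [s sy us] := arr_at (Ua _ Uu) uy.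
  have sx : act s y = x by apply: (@unit_germ_inj _ _ th); rewrite ux us grng_germ.
  have -> : gmul G (unit_germ th x) u = u by rewrite us -sx gmul_unitl.
  by split => //; exists x.
move=> [Ug [x Vx gx]]; exists (unit_germ th x), g; split => //.
  by rewrite gsrc_unit.
have [y gy] := arr_unit (Ua _ Ug); have [s sy gs] := arr_at (Ua _ Ug) gy.
by rewrite -gx gs grng_germ// gmul_unitl.
Qed.

(** Since [U] has a single arrow over each source, covering the sources by those of the sets U [&] W
    i already covers the arrows. *)
Lemma gcompact_src U : gopen G U -> set_inj U (gsrc G) -> compact (src_set th U) -> gcompact G U.
Proof.
move=> oU iU /compact_coverP cU; split; first exact: gopen_arr oU.
move=> I W oW UW; have [||F fF UF] := cU I (fun i => src_set th (U `&` W i)).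
- by move=> i; apply: src_set_open; exact: gopenI.
- by move=> x [g Ug gx]; have [i _ Wg] := UW _ Ug; exists i => //; exists g.
exists F => // g Ug; have [x gx] := arr_unit (gopen_arr oU Ug).
have [|i Fi [h [Uh Wh] hx]] := UF x; first by exists g.
by exists i => //; rewrite (iU g h)// ?inE// gx hx.
Qed.

Hypothesis hX : hausdorff_space X.

(** Compactness is the delicate part: the sources of UV form a closed subset of the compact set of
    sources of [V]. A point [x] outside it either is not a source of [V], or is the source of an
    arrow [t,x] of [V] whose range is not a source of [U]; as source sets are compact, hence closed
    in [X], either case persists nearby. *)
Lemma cobis_mul U (V : set (set (S * X))) : cobis G U -> cobis G V -> cobis G (bis_mul G U V).
Proof.
move=> cU cV; have [oU [gU [Ua Us Ur]]] := cU; have [oV [gV [Va Vs Vr]]] := cV.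
have prodG g : bis_mul G U V g -> garr G g.
  by move=> [u [v [Uu Vv uv ->]]]; case: (gmulP (Ua _ Uu) (Va _ Vv) uv).
have op : gopen G (bis_mul G U V).
  apply/gopenP; split => // r z rz [u [v [Uu Vv uv E]]].
  have [x vx] := arr_unit (Va _ Vv); have [t tx vt] := arr_at (Va _ Vv) vx.
  have ux : gsrc G u = unit_germ th (act t x) by rewrite uv vt grng_germ.
  have [s sx us] := arr_at (Ua _ Uu) ux; subst u v.
  move: E; rewrite gmul_germ// => /(eq_germP _ _ rz)[zx rst]; subst z.
  have /gopenP[_ /(_ _ _ sx Uu) oUx] := oU; have /gopenP[_ /(_ _ _ tx Vv) oVx] := oV.
  apply: filterS (filterI (filterI (near_act tx oUx) oVx) (filterI (germ_eq_near rst)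
    (filterI (near_dom tx) (near_act tx (near_dom sx))))) => y [[Uy Vy] [ry [ty sy]]].
  exists (germ th s (act t y)), (germ th t y); split => //.
    by rewrite gsrc_germ// grng_germ.
  by rewrite gmul_germ//; apply/eq_germP => //; exact: germ_eq_dom ry.
have inj_src : set_inj (bis_mul G U V) (gsrc G).
  move=> g h; rewrite !inE => -[u [v [Uu Vv uv ->]]] [u' [v' [Uu' Vv' uv' ->]]].
  have [_ -> _] := gmulP (Ua _ Uu) (Va _ Vv) uv.
  have [_ -> _] := gmulP (Ua _ Uu') (Va _ Vv') uv'.
  move=> vv; have E : v = v' by apply: Vs; rewrite ?inE.
  by congr gmul => //; apply: Us; rewrite ?inE// uv uv' E.
split => //; split; last first.
  split => // g h; rewrite !inE => -[u [v [Uu Vv uv ->]]] [u' [v' [Uu' Vv' uv' ->]]].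
  have [_ _ ->] := gmulP (Ua _ Uu) (Va _ Vv) uv.
  have [_ _ ->] := gmulP (Ua _ Uu') (Va _ Vv') uv'.
  move=> vv; have E : u = u' by apply: Ur; rewrite ?inE.
  by congr gmul => //; apply: Vr; rewrite ?inE// -uv -uv' E.
apply: gcompact_src => //.
have [csV _] := src_set_cobis cV; have [csU _] := src_set_cobis cU.
apply: (subclosed_compact _ csV); last first.
  move=> x [_ [u [v [Uu Vv uv ->]]]].
  by have [_ -> _] := gmulP (Ua _ Uu) (Va _ Vv) uv => vx; exists v.
rewrite -[X in closed X]setCK; apply: open_closedC; rewrite openE => x nx.
case: (pselect (src_set th V x)) => [[v Vv vx]|nVx]; last first.
  have : \forall y \near x, ~ src_set th V y.
    by apply: open_nbhs_nbhs; split => //; apply: closed_openC; exact: (compact_closed hX csV).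
  apply: filterS => y nVy [_ [u [v [Uu Vv uv ->]]]].
  by have [_ -> _] := gmulP (Ua _ Uu) (Va _ Vv) uv => vy; apply: nVy; exists v.
have [t tx vt] := arr_at (Va _ Vv) vx; subst v.
have nUx : ~ src_set th U (act t x).
  move=> [u Uu ux]; apply: nx; exists (gmul G u (germ th t x)).
    by exists u, (germ th t x); split => //; rewrite grng_germ.
  have [_ -> _] : [/\ garr G (gmul G u (germ th t x)), gsrc G (gmul G u (germ th t x)) =
      gsrc G (germ th t x) & grng G (gmul G u (germ th t x)) = grng G u].
    by apply: gmulP; [exact: Ua|exact: Va|rewrite grng_germ].
  by [].
have nU : \forall y \near act t x, ~ src_set th U y.
  by apply: open_nbhs_nbhs; split => //; apply: closed_openC; exact: (compact_closed hX csU).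
have /gopenP[_ /(_ _ _ tx Vv) oVx] := oV.
apply: filterS (filterI (near_act tx nU) (filterI oVx (near_dom tx))) => y [nUy [Vy ty]].
move=> [_ [u [v [Uu Vv' uv ->]]]].
have [_ -> _] := gmulP (Ua _ Uu) (Va _ Vv') uv => vy.
apply: nUy; exists u => //; rewrite uv.
have -> : v = germ th t y by apply: Vs; rewrite ?inE// vy gsrc_germ.
by rewrite grng_germ.
Qed.

Lemma germ_idem_unit s x : dom s x -> act s x = x ->
  germ th (imul s s) x = germ th s x -> germ th s x = unit_germ th x.
Proof.
move=> sx sxx; have ssx : dom (imul s s) x by apply: dom_mul => //; rewrite sxx.
move=> /(eq_germP _ _ ssx)[_ ss].
(* Multiplying the equality of the germs of ss and [s] by [istar s] on the left cancels one factor
   and leaves an idempotent on one side, an element below [s] on the other. *)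
have E := germ_eq_mul (germ_eq_sym ss) (germ_eq_refl (act_star sx)).
rewrite -(germ_idem (idem_istarl s) (dom_istarl sx)); apply/eq_germP => //.
split => //; have h := germ_eq_dom (germ_eq_sym E); rewrite imulA in E h.
apply: germ_eq_sym; apply: germ_eq_trans E _.
exists (imul (imul (istar s) s) s); split => //; first exact: isg_le_refl.
by apply: isg_le_mull; exact: idem_istarl.
Qed.

(** Write an arrow [g] of [U] as vw with both factors in [U]. Then [v] has the range of [g] and [w]
    its source, so both equal [g]; thus gg = g and [g] is a unit. *)
Lemma cobis_idem U : cobis G U -> bis_mul G U U = U -> U = unit_germ th @` (src_set th U).
Proof.
move=> [oU [gU [Ua Us Ur]]] UU.
have unitU g x : U g -> gsrc G g = unit_germ th x -> g = unit_germ th x.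
  move=> Ug gx; have [s sx gs] := arr_at (Ua _ Ug) gx; subst g.
  have : bis_mul G U U (germ th s x) by rewrite UU.
  move=> [v [w [Uv Uw vw E]]]; have [_ E1 E2] := gmulP (Ua _ Uv) (Ua _ Uw) vw.
  have vE : v = germ th s x by apply: Ur; rewrite ?inE// -E2 E.
  have wE : w = germ th s x by apply: Us; rewrite ?inE// -E1 E.
  subst v w; move: vw; rewrite gsrc_germ// grng_germ// => /unit_germ_inj sxx.
  apply: germ_idem_unit => //; rewrite -gmul_germ -?sxx//.
apply/seteqP; split=> [g Ug|_ [x [g Ug gx] <-]]; last by rewrite -(unitU g x).
have [x gx] := arr_unit (Ua _ Ug); exists x; first by exists g.
by rewrite (unitU g x).
Qed.

End Cobis.

(** * Reconstruction of the partial action from its diagonal *)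

(* What the inverse semigroups of (3) and (4) and the Steinberg algebra have in
   common: [ds_unit V] is the idempotent given by the units over V, [ds_bis s V]
   the element given by the bisection [s,V], and [ds_supp a] an open set of
   arrows carrying a. *)
Record diag_system (S : invSemigroup) (X : topologicalType) (th : partial_action S X)
    (A : Type) (SA DA : set A) (mul : A -> A -> A) := DiagSystem {
  ds_unit : set X -> A;
  ds_bis : S -> set X -> A;
  ds_supp : A -> set (set (S * X));
  ds_diag : DA `<=` SA;
  ds_closed : forall a b, SA a -> SA b -> SA (mul a b);
  ds_unitP : forall a, DA a /\ mul a a = a <-> exists2 V, compopen V & a = ds_unit V;
  ds_unitI : forall V W, compopen V -> compopen W ->
    mul (ds_unit V) (ds_unit W) = ds_unit (V `&` W);
  ds_unit_inj : forall V W, compopen V -> compopen W -> ds_unit V = ds_unit W -> V = W;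
  ds_bisP : forall s V, compopen V -> V `<=` pdom th (istar s) -> SA (ds_bis s V);
  ds_bis_unit : forall s V W, compopen V -> V `<=` pdom th (istar s) ->
    compopen W -> W `<=` V ->
    mul (ds_bis s V) (ds_unit W) = mul (ds_unit (Defs.pmap th s @` W)) (ds_bis s V);
  ds_bis_star : forall s V, compopen V -> V `<=` pdom th (istar s) ->
    mul (ds_bis (istar s) (Defs.pmap th s @` V)) (ds_bis s V) = ds_unit V;
  ds_supp_open : forall a, SA a -> gopen (germ_groupoid th) (ds_supp a);
  ds_supp_rng : forall a V W x g, SA a -> compopen V -> compopen W ->
    mul a (ds_unit V) = mul (ds_unit W) a -> ds_supp a g ->
    gsrc (germ_groupoid th) g = unit_germ th x -> V x ->
    exists2 y, W y & grng (germ_groupoid th) g = unit_germ th y;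
  ds_supp_src : forall a b V x, SA a -> SA b -> compopen V -> mul a b = ds_unit V -> V x ->
    exists2 g, ds_supp b g & gsrc (germ_groupoid th) g = unit_germ th x }.

Lemma diag_system_loc_equiv (S T : invSemigroup) (X Y : topologicalType)
    (th : partial_action S X) (ga : partial_action T Y)
    (A B : Type) (SA DA : set A) (SB DB : set B) mA mB
    (sA : diag_system th SA DA mA) (sB : diag_system ga SB DB mB) (f : A -> B) phi psi :
  co_base X -> hausdorff_space X ->
  cancel phi psi -> cancel psi phi -> continuous phi ->
  (forall a, SA a -> SB (f a)) ->
  (forall a b, SA a -> SA b -> f (mA a b) = mB (f a) (f b)) ->
  (forall V, compopen V -> exists W, [/\ compopen W, f (ds_unit sA V) = ds_unit sB W &
     forall x, V x <-> W (phi x)]) ->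
  loc_equiv th ga phi.
Proof.
move=> bX hX pK qK cp fS fM fU s x sx.
have SAu V : compopen V -> SA (ds_unit sA V).
  move=> cV; apply: (ds_diag sA).
  by have [] := (ds_unitP sA (ds_unit sA V)).2 (ex_intro2 _ _ V cV erefl).
have [V [cV Vx Vs]] := bX _ _ (near_dom sx).
have cs := act_compopen cV Vs.
have sV : SA (ds_bis sA s V) by exact: ds_bisP.
have sV' : SA (ds_bis sA (istar s) (Defs.pmap th s @` V)).
  by apply: ds_bisP => // _ [y /Vs sy <-]; exact: act_star.
have [V' [cV' fV' VV']] := fU _ cV.
have E : mB (f (ds_bis sA (istar s) (Defs.pmap th s @` V))) (f (ds_bis sA s V)) = ds_unit sB V'.
  by rewrite -fM// ds_bis_star.
have [h Wh hx] := ds_supp_src (fS _ sV') (fS _ sV) cV' E ((VV' x).1 Vx).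
have oW := ds_supp_open sB (fS _ sV); set W := ds_supp sB _ in Wh oW.
have [t tx ht] := arr_at (gopen_arr oW Wh) hx.
exists t; split => //.
have /gopenP[_ /(_ t (phi x) tx)] := oW; rewrite -ht => /(_ Wh) nW.
have nV : \forall y \near x, V y by apply: open_nbhs_nbhs; split => //; case: cV.
have nW' : \forall y \near x, W (germ ga t (phi y)) := cp x _ nW.
have nt : \forall y \near x, pdom ga (istar t) (phi y) by apply: cp; exact: near_dom.
apply: filterS (filterI (filterI nW' nt) nV) => y [[Wy ty] Vy].
(* The commutation relation for [V1] places the range of the arrow at phi(y) in the image of
   theta_s(V1), so only some point [z] of [V1] is obtained at first, depending on [V1]. *)
have key V1 : compopen V1 -> V1 `<=` V -> V1 y ->
    exists2 z, V1 z & phi (Defs.pmap th s z) = Defs.pmap ga t (phi y).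
  move=> cV1 V1V V1y; have [W1 [cW1 fW1 VW1]] := fU _ cV1.
  have cs1 := act_compopen cV1 (subset_trans V1V Vs).
  have [W2 [cW2 fW2 VW2]] := fU _ cs1.
  have E1 : mB (f (ds_bis sA s V)) (ds_unit sB W1) = mB (ds_unit sB W2) (f (ds_bis sA s V)).
    rewrite -fW1 -fW2 -!fM//; [by congr f; exact: ds_bis_unit|exact: SAu|exact: SAu].
  have [z Wz] := ds_supp_rng (fS _ sV) cW1 cW2 E1 Wy (gsrc_germ ty) ((VW1 y).1 V1y).
  rewrite grng_germ// => /unit_germ_inj zE.
  have : W2 (phi (psi z)) by rewrite qK.
  by move=> /VW2[z' Vz' z'E]; exists z' => //; rewrite z'E qK.
have [z Vz zE] := key _ cV (@subset_refl _ V) Vy; rewrite -zE.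
(* Since theta_s is injective on [V], shrinking [V1] cannot change [z]. If [z] differed from [y], a
   smaller [V1] around [y] would exclude it. *)
congr (phi (Defs.pmap th s _)); apply: contrapT => /(co_separated hX bX)[U [cU Uy Uz]].
have [|? []//|//|z' [Uz' Vz'] z'E] := key (U `&` V); first exact: compopenI.
by apply: Uz; rewrite (act_inj (Vs _ Vz) (Vs _ Vz'))//; apply: (can_inj pK); rewrite zE z'E.
Qed.
Lemma set_bij_inverse (A B : Type) (SA : set A) (SB : set B) (f : A -> B) (a0 : A) :
  set_bij SA SB f -> exists g : B -> A, [/\ forall a, SA a -> g (f a) = a,
    forall b, SB b -> f (g b) = b & forall b, SB b -> SA (g b)].
Proof.
move=> [fS finj fsurj].
have /choice[g gP] : forall b, exists a, SB b -> SA a /\ f a = b.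
  move=> b; case: (pselect (SB b)) => [/fsurj[a Sa <-]|nb]; first by exists a.
  by exists a0.
exists g; split=> [a Sa|b /gP[]//|b /gP[]//].
by have [Sg fg] := gP _ (fS _ Sa); apply: finj; rewrite ?inE.
Qed.

Lemma diag_system_orbit_homeo (S T : invSemigroup) (X Y : topologicalType)
    (th : partial_action S X) (ga : partial_action T Y)
    (A B : Type) (SA DA : set A) (SB DB : set B) mA mB
    (sA : diag_system th SA DA mA) (sB : diag_system ga SB DB mB) (f : A -> B) :
  co_base X -> hausdorff_space X -> co_base Y -> hausdorff_space Y ->
  set_bij SA SB f -> f @` DA = DB ->
  (forall a b, SA a -> SA b -> f (mA a b) = mB (f a) (f b)) ->
  exists phi psi, orbit_homeo th ga phi psi.
Proof.
move=> bX hX bY hY fb fD fM; have [fS finj fsurj] := fb.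
(* The unit over the empty set serves as an inhabitant of [A], needed to define [g] off [SB]. *)
have [g [gf fg gS]] := set_bij_inverse (ds_unit sA set0) fb.
have gM a b : SB a -> SB b -> g (mB a b) = mA (g a) (g b).
  move=> Sa Sb; rewrite -{1}(fg a)// -{1}(fg b)// -fM ?gf//; [|exact: gS|exact: gS].
  by apply: (ds_closed sA); exact: gS.
have uD V : compopen V -> DA (ds_unit sA V) /\ mA (ds_unit sA V) (ds_unit sA V) = ds_unit sA V.
  by move=> cV; apply/(ds_unitP sA); exists V.
have uS V : compopen V -> SA (ds_unit sA V) by move=> /uD[/(ds_diag sA)].
have uD' V : compopen V -> DB (ds_unit sB V) /\ mB (ds_unit sB V) (ds_unit sB V) = ds_unit sB V.
  by move=> cV; apply/(ds_unitP sB); exists V.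
have uS' V : compopen V -> SB (ds_unit sB V) by move=> /uD'[/(ds_diag sB)].
have fU V : compopen V -> exists2 W, compopen W & f (ds_unit sA V) = ds_unit sB W.
  move=> cV; have [dV iV] := uD _ cV; apply/(ds_unitP sB); split.
    by rewrite -fD; exists (ds_unit sA V).
  by rewrite -fM ?iV//; exact: uS.
have gU W : compopen W -> exists2 V, compopen V & g (ds_unit sB W) = ds_unit sA V.
  move=> cW; have [dW iW] := uD' _ cW; apply/(ds_unitP sA); split.
    have [a Da <-] : (f @` DA) (ds_unit sB W) by rewrite fD.
    by rewrite gf//; exact: (ds_diag sA).
  by rewrite -gM ?iW//; exact: uS'.
have /choice[F FP] : forall V, exists W,
    compopen V -> compopen W /\ f (ds_unit sA V) = ds_unit sB W.
  move=> V; case: (pselect (compopen V)) => [/fU[W cW E]|nV]; last by exists set0.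
  by exists W.
have [||phi [psi [pK qK cp cq FE]]] := stone_duality (F := F) hX bX hY bY.
- split=> [V /FP[]//|V W|W cW].
    rewrite !inE => cV cW FVW; have [_ fV] := FP _ cV; have [_ fW] := FP _ cW.
    apply: (ds_unit_inj (d := sA)) => //; apply: finj; rewrite ?inE; [exact: uS|exact: uS|].
    by rewrite fV fW FVW.
  have [V cV gW] := gU _ cW; exists V => //; have [cF fV] := FP _ cV.
  by apply: (ds_unit_inj (d := sB)) => //; rewrite -fV -gW fg//; exact: uS'.
- move=> V W cV cW; have cVW := compopenI hX cV cW.
  have [cFV fV] := FP _ cV; have [cFW fW] := FP _ cW; have [cFVW fVW] := FP _ cVW.
  apply: (ds_unit_inj (d := sB)) => //; first exact: compopenI.
  by rewrite -fVW -ds_unitI// fM ?fV ?fW ?ds_unitI//; exact: uS.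
exists phi, psi; split => //; split.
  apply: (diag_system_loc_equiv (sA := sA) (sB := sB) bX hX pK qK cp fS fM).
  by move=> V cV; have [cF fV] := FP _ cV; exists (F V); split => // x; exact: FE.
apply: (diag_system_loc_equiv (sA := sB) (sB := sA) bY hY qK pK cq gS gM).
move=> W cW; have [V cV gW] := gU _ cW; exists V; split => // y.
have [cF fV] := FP _ cV.
suff -> : W = F V by rewrite (FE _ cV (psi y)) qK.
by apply: (ds_unit_inj (d := sB)) => //; rewrite -fV -gW fg//; exact: uS'.
Qed.

(** * Bisections and the full pseudogroup as diagonal systems *)

Section Systems.
Variables (S : invSemigroup) (X : topologicalType) (th : partial_action S X).
Local Notation dom s := (pdom th (istar s)).
Local Notation act s := (Defs.pmap th s).
Local Notation G := (germ_groupoid th).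
Hypothesis hX : hausdorff_space X.

Lemma unit_arr (V : set X) : unit_germ th @` V `<=` garr G.
Proof. by move=> _ [x _ <-]; exact: garr_unit. Qed.

Lemma germ_basic_arr s V : V `<=` dom s -> germ_basic th s V `<=` garr G.
Proof. by move=> Vs _ [x /Vs sx <-]; exact: garr_germ. Qed.

Lemma image_unit_inj : injective (fun V : set X => unit_germ th @` V).
Proof.
suff h V W : unit_germ th @` V = unit_germ th @` W -> V `<=` W.
  by move=> V W VW; apply/seteqP; split; exact: h.
move=> VW x Vx; have : (unit_germ th @` W) (unit_germ th x) by rewrite -VW; exists x.
by move=> [y Wy /unit_germ_inj <-].
Qed.

Lemma bis_mul_unitI V W :
  bis_mul G (unit_germ th @` V) (unit_germ th @` W) = unit_germ th @` (V `&` W).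
Proof.
rewrite bis_mul_unitr; last exact: unit_arr.
apply/seteqP; split=> [_ [[x Vx <-] [y Wy]]|_ [x [Vx Wx] <-]].
  by rewrite gsrc_unit => /unit_germ_inj xy; exists x => //; split => //; rewrite xy.
by split; exists x => //; rewrite gsrc_unit.
Qed.

Lemma bis_mul_basic_unit s V W : V `<=` dom s -> W `<=` V ->
  bis_mul G (germ_basic th s V) (unit_germ th @` W) =
  bis_mul G (unit_germ th @` (act s @` W)) (germ_basic th s V).
Proof.
move=> Vs WV; rewrite bis_mul_unitr ?bis_mul_unitl; try exact: germ_basic_arr.
apply/seteqP; split=> [_ [[x Vx <-] [y Wy]]|_ [[x Vx <-] [_ [y Wy <-]]]].
  rewrite gsrc_germ; last exact: Vs.
  move=> /unit_germ_inj xy; subst y; split; first by exists x.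
  by exists (act s x); [exists x|rewrite grng_germ//; exact: Vs].
rewrite grng_germ; last exact: Vs.
move=> /unit_germ_inj /(act_inj (Vs _ Vx) (Vs _ (WV _ Wy))) xy; subst y.
by split; exists x => //; rewrite gsrc_germ//; exact: Vs.
Qed.

Lemma bis_mul_basic_star s V : V `<=` dom s ->
  bis_mul G (germ_basic th (istar s) (act s @` V)) (germ_basic th s V) = unit_germ th @` V.
Proof.
move=> Vs.
have E x : V x -> gmul G (germ th (istar s) (act s x)) (germ th s x) = unit_germ th x.
  move=> /Vs sx; rewrite gmul_germ//; last exact: act_star.
  by apply: germ_idem; [exact: idem_istarl|exact: dom_istarl].
apply/seteqP; split=> [_ [_ [_ [[_ [x Vx <-] <-] [y Vy <-] + ->]]]|_ [x Vx <-]].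
  rewrite gsrc_germ ?grng_germ; [|exact: Vs|by apply: act_star; exact: Vs].
  move=> /unit_germ_inj /(act_inj (Vs _ Vx) (Vs _ Vy)) xy; subst y.
  by rewrite E//; exists x.
exists (germ th (istar s) (act s x)), (germ th s x); split; rewrite ?E//.
- by exists (act s x) => //; exists x.
- by exists x.
- by rewrite gsrc_germ ?grng_germ//; [exact: Vs|apply: act_star; exact: Vs].
Qed.

Lemma cobis_arr U : cobis G U -> U `<=` garr G.
Proof. by move=> [_ [_ []]]. Qed.

Definition cobis_system : diag_system th (cobis G) (cobis G) (@bis_mul G).
Proof.
apply: (@DiagSystem _ _ _ _ _ _ _ (fun V => unit_germ th @` V) (germ_basic th) id) => //.
- by move=> U V; exact: cobis_mul.
- move=> U; split=> [[cU UU]|[V cV ->]].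
    by exists (src_set th U); [exact: src_set_cobis|exact: cobis_idem].
  by split; [exact: unit_cobis|rewrite bis_mul_unitI setIid].
- by move=> V W _ _; exact: bis_mul_unitI.
- by move=> V W _ _; exact: image_unit_inj.
- by move=> s V; exact: germ_basic_cobis.
- by move=> s V W cV Vs _; exact: bis_mul_basic_unit.
- by move=> s V cV; exact: bis_mul_basic_star.
- by move=> U [].
- move=> U V W x g cU cV cW E Ug gx Vx; have Ua := cobis_arr cU.
  have : bis_mul G (unit_germ th @` W) U g by rewrite -E bis_mul_unitr//; split => //; exists x.
  by rewrite bis_mul_unitl// => -[].
- move=> U W V x cU cW cV E Vx.
  have : bis_mul G U W (unit_germ th x) by rewrite E; exists x.
  move=> [u [w [Uu Ww uw wE]]]; exists w => //.
  by have [_ <- _] := gmulP (cobis_arr cU Uu) (cobis_arr cW Ww) uw; rewrite -wE gsrc_unit.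
Qed.

Lemma tau_mul U W : U `<=` garr G -> W `<=` garr G ->
  tau G (bis_mul G U W) = pb_mul (gcar G) (tau G U) (tau G W).
Proof.
move=> Ua Wa; apply/seteqP; split=> [_ [_ [u [w [Uu Ww uw ->]]] ->]|[x z] [y /= [[w Ww [-> ->]]]]].
  have [_ -> ->] := gmulP (Ua _ Uu) (Wa _ Ww) uw.
  by exists (grng G w); split; [exists w|exists u => //; rewrite uw].
move=> [u Uu [uw ->]]; exists (gmul G u w); first by exists u, w; split.
by have [_ -> ->] := gmulP (Ua _ Uu) (Wa _ Ww) (esym uw).
Qed.

Hypotheses (pth : topologically_principal th) (hG : groupoid_hausdorff G).

(** If tau_U and tau_W agree, then above each source the two bisections contain germs [s,x] and
    [t,x] of maps that coincide near [x], so the germs are equal by [germ_faithful]. *)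
Lemma tau_inj U W : cobis G U -> cobis G W -> tau G U = tau G W -> U = W.
Proof.
suff h U' W' : cobis G U' -> cobis G W' -> tau G U' = tau G W' -> U' `<=` W'.
  by move=> cU cW UW; apply/seteqP; split; exact: h.
move=> [oU [_ [Ua _ _]]] [oW [_ [Wa Ws _]]] UW g Ug.
have inW k : U' k -> exists2 h, W' h & gsrc G k = gsrc G h /\ grng G k = grng G h.
  move=> Uk; have : tau G W' (gsrc G k, grng G k) by rewrite -UW; exists k.
  by move=> [h Wh [E1 E2]]; exists h.
have [h Wh [gh _]] := inW _ Ug.
have [x hx] := arr_unit (Wa _ Wh); have [t tx ht] := arr_at (Wa _ Wh) hx.
rewrite hx in gh; have [s sx gs] := arr_at (Ua _ Ug) gh.
have /gopenP[_ /(_ s x sx)] := oU; rewrite -gs => /(_ Ug) nU.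
have /gopenP[_ /(_ t x tx)] := oW; rewrite -ht => /(_ Wh) nW.
suff -> : g = h by [].
rewrite gs ht; apply/eq_germP => //; split => //; apply: germ_faithful => //.
apply: filterS (filterI (filterI nU nW) (filterI (near_dom sx) (near_dom tx))).
move=> y [[Uy Wy] [sy ty]]; have [k Wk] := inW _ Uy.
rewrite gsrc_germ// grng_germ// => -[ky kr].
have kE : k = germ th t y by apply: Ws; rewrite ?inE// -ky gsrc_germ.
by apply: (@unit_germ_inj _ _ th); rewrite kr kE grng_germ.
Qed.

Definition pseudogroup_system :
  diag_system th (full_pseudogroup G) (full_pseudogroup G) (@pb_mul (gcar G)).
Proof.
have tmul U W : cobis G U -> cobis G W ->
    pb_mul (gcar G) (tau G U) (tau G W) = tau G (bis_mul G U W).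
  by move=> cU cW; rewrite tau_mul//; exact: cobis_arr.
have bstar s V : compopen V -> V `<=` dom s ->
    cobis G (germ_basic th (istar s) (act s @` V)).
  move=> cV Vs; apply: germ_basic_cobis; first exact: act_compopen.
  by move=> _ [x /Vs sx <-]; exact: act_star.
(* The arrows attached to [P] are the union of all bisections with tau_U = P. There is only one, by
   [tau_inj], but the union needs no choice. *)
apply: (@DiagSystem _ _ _ _ _ _ _ (fun V => tau G (unit_germ th @` V))
  (fun s V => tau G (germ_basic th s V))
  (fun P => \bigcup_(U in [set U | cobis G U /\ tau G U = P]) U)) => //.
- move=> _ _ [U cU <-] [W cW <-]; rewrite tmul//; exists (bis_mul G U W) => //.
  exact: cobis_mul.
- move=> P; split=> [[[U cU <-]]|[V cV ->]].
    rewrite tmul// => /tau_inj UU; exists (src_set th U); first exact: src_set_cobis.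
    by congr tau; apply: cobis_idem => //; apply: UU => //; exact: cobis_mul.
  split; first by exists (unit_germ th @` V) => //; exact: unit_cobis.
  by rewrite tmul ?bis_mul_unitI ?setIid//; exact: unit_cobis.
- by move=> V W cV cW; rewrite tmul ?bis_mul_unitI//; exact: unit_cobis.
- move=> V W cV cW /tau_inj VW; apply: image_unit_inj.
  by apply: VW; exact: unit_cobis.
- by move=> s V cV Vs; exists (germ_basic th s V) => //; exact: germ_basic_cobis.
- move=> s V W cV Vs cW WV; have cW' : compopen (act s @` W).
    by apply: act_compopen => //; exact: subset_trans Vs.
  by rewrite !tmul ?bis_mul_basic_unit//; solve [exact: unit_cobis | exact: germ_basic_cobis].
- move=> s V cV Vs; rewrite tmul ?bis_mul_basic_star//; first exact: bstar.
  exact: germ_basic_cobis.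
- move=> P _; apply/gopenP; split=> [g [U [cU _] /(cobis_arr cU)]//|s x sx [U [cU UP] Us]].
  have [/gopenP[_ /(_ _ _ sx Us)] nU _] := cU.
  by apply: filterS nU => y Uy; exists U.
- move=> P V W x g _ cV cW E [U [cU UP] Ug] gx Vx; subst P; have Ua := cobis_arr cU.
  rewrite tmul// in E; last exact: unit_cobis.
  rewrite tmul// in E; last exact: unit_cobis.
  have : tau G (bis_mul G (unit_germ th @` W) U) (gsrc G g, grng G g).
    by rewrite -E bis_mul_unitr//; exists g => //; split => //; exists x.
  by rewrite bis_mul_unitl// => -[h [_ [y Wy hy]] [_ gh]]; exists y => //; exact: (etrans gh hy).
- move=> _ _ V x [U cU <-] [W cW <-] cV E Vx; rewrite tmul// in E.
  have : tau G (bis_mul G U W) (unit_germ th x, unit_germ th x).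
    by rewrite E; exists (unit_germ th x); [exists x|rewrite gsrc_unit grng_unit].
  move=> [_ [u [w [Uu Ww uw ->]]] [E1 _]]; exists w; first by exists W.
  by rewrite E1; have [_ <- _] := gmulP (cobis_arr cU Uu) (cobis_arr cW Ww) uw.
Qed.

End Systems.

(** * Transport along groupoid isomorphisms *)

(** [topgroupoid] carries data without axioms; these closure properties are what transport along an
    isomorphism requires. *)
Definition groupoid_closed (G : topgroupoid) :=
  [/\ forall g, garr G g -> [/\ garr G (gsrc G g), garr G (grng G g), garr G (ginv G g) &
        gsrc G (ginv G g) = grng G g],
      forall g h, garr G g -> garr G h -> gsrc G g = grng G h -> garr G (gmul G g h) &
      forall U, gopen G U -> U `<=` garr G].

Lemma germ_groupoid_closed (S : invSemigroup) (X : topologicalType) (th : partial_action S X) :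
  groupoid_closed (germ_groupoid th).
Proof.
split.
- apply: garr_ind => s x sx; rewrite gsrc_germ// grng_germ// ginv_germ//.
  have ssx := act_star sx; rewrite gsrc_germ//.
  by split => //; [exact: garr_unit|exact: garr_unit|exact: garr_germ].
- by move=> g h gG hG gh; have [] := gmulP gG hG gh.
- exact: gopen_arr.
Qed.

(** An isomorphism is a pair of halves, so that each transport lemma, proved for one half or both,
    also applies with [f] and [f'] exchanged. *)
Definition iso_half (G H : topgroupoid) (f : gcar G -> gcar H) (f' : gcar H -> gcar G) :=
  [/\ forall g, garr G g -> garr H (f g) /\ f' (f g) = g,
      forall g, garr G g -> [/\ f (gsrc G g) = gsrc H (f g), f (grng G g) = grng H (f g) &
                                f (ginv G g) = ginv H (f g)],
      forall g h, garr G g -> garr G h -> gsrc G g = grng G h ->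
                    f (gmul G g h) = gmul H (f g) (f h) &
      forall U, gopen G U -> gopen H (f @` U)].

Lemma topgroupoid_iso_halves (G H : topgroupoid) (g0 : gcar G) :
  groupoid_closed G -> groupoid_closed H -> topgroupoid_iso G H ->
  exists f f', iso_half (G := G) (H := H) f f' /\ iso_half f' f.
Proof.
move=> [Gc Gm Go] [Hc Hm Ho] [f [fb fs fm fo]].
have [f' [f'f ff' f'G]] := set_bij_inverse g0 fb; have [fG finj fsurj] := fb.
exists f, f'; split; split.
- by move=> g gG; split; [exact: fG|exact: f'f].
- by move=> g /fs[? []].
- exact: fm.
- by move=> U oU; apply/fo => //; exact: Go.
- by move=> h hH; split; [exact: f'G|exact: ff'].
- move=> h hH; have [s1 r1 i1 _] := Gc _ (f'G _ hH); have [] := fs _ (f'G _ hH).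
  rewrite ff'// => <- [<- <-].
  by rewrite !f'f.
- move=> h k hH kH hk; have hk' : gsrc G (f' h) = grng G (f' k).
    have [s1 _ _ _] := Gc _ (f'G _ hH); have [_ s2 _ _] := Gc _ (f'G _ kH).
    apply: finj; rewrite ?inE//; have [-> _] := fs _ (f'G _ hH).
    by have [_ [-> _]] := fs _ (f'G _ kH); rewrite !ff'.
  rewrite -{1}(ff' h)// -{1}(ff' k)// -fm ?f'f//; try exact: f'G.
  by apply: Gm => //; exact: f'G.
- move=> U oU; have Ua := Ho _ oU; apply/fo.
    by move=> _ [h Uh <-]; apply: f'G; exact: Ua.
  suff -> : f @` (f' @` U) = U by [].
  apply/seteqP; split=> [_ [_ [h Uh <-] <-]|h Uh]; first by rewrite ff'//; exact: Ua.
  by exists (f' h); [exists h|rewrite ff'//; exact: Ua].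
Qed.

Section Transport.
Variables (G H : topgroupoid) (f : gcar G -> gcar H) (f' : gcar H -> gcar G).
Hypotheses (Gc : groupoid_closed G) (Hc : groupoid_closed H).
Hypotheses (hf : iso_half f f') (hf' : iso_half f' f).

Lemma iso_arr g : garr G g -> garr H (f g).
Proof. by move=> gG; have [/(_ _ gG)[]] := hf. Qed.

Lemma isoK g : garr G g -> f' (f g) = g.
Proof. by move=> gG; have [/(_ _ gG)[]] := hf. Qed.

Lemma iso_src g : garr G g -> f (gsrc G g) = gsrc H (f g).
Proof. by move=> gG; have [_ /(_ _ gG)[]] := hf. Qed.

Lemma iso_rng g : garr G g -> f (grng G g) = grng H (f g).
Proof. by move=> gG; have [_ /(_ _ gG)[]] := hf. Qed.

Lemma iso_inj g h : garr G g -> garr G h -> f g = f h -> g = h.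
Proof. by move=> gG hG gh; rewrite -(isoK gG) gh isoK. Qed.

Lemma imageK U : U `<=` garr G -> f' @` (f @` U) = U.
Proof.
move=> Ua; apply/seteqP; split=> [_ [_ [g Ug <-] <-]|g Ug].
  by rewrite isoK//; exact: Ua.
by exists (f g); [exists g|rewrite isoK//; exact: Ua].
Qed.

Lemma image_arr U : U `<=` garr G -> f @` U `<=` garr H.
Proof. by move=> Ua _ [g /Ua gG <-]; exact: iso_arr. Qed.

Lemma iso_src_inj g h : garr G g -> garr G h ->
  gsrc H (f g) = gsrc H (f h) -> gsrc G g = gsrc G h.
Proof.
have [c _ _] := Gc; move=> gG hG; rewrite -!iso_src//; apply: iso_inj.
  by have [] := c _ gG.
by have [] := c _ hG.
Qed.

Lemma iso_rng_inj g h : garr G g -> garr G h ->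
  grng H (f g) = grng H (f h) -> grng G g = grng G h.
Proof.
have [c _ _] := Gc; move=> gG hG; rewrite -!iso_rng//; apply: iso_inj.
  by have [] := c _ gG.
by have [] := c _ hG.
Qed.

Lemma iso_comp g h : garr G g -> garr G h ->
  gsrc G g = grng G h <-> gsrc H (f g) = grng H (f h).
Proof.
have [c _ _] := Gc; move=> gG hG; rewrite -iso_src// -iso_rng//; split=> [->//|].
by apply: iso_inj; [have [] := c _ gG|have [] := c _ hG].
Qed.

Lemma iso_cobis U : cobis G U -> cobis H (f @` U).
Proof.
move=> [oU [[_ cU] [Ua Us Ur]]]; split; first by have [_ _ _] := hf; exact.
split; last first.
  split; first exact: image_arr.
  - move=> _ _ /set_mem[g Ug <-] /set_mem[h Uh <-] E.
    by congr f; apply: Us; rewrite ?inE//; apply: iso_src_inj => //; exact: Ua.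
  - move=> _ _ /set_mem[g Ug <-] /set_mem[h Uh <-] E.
    by congr f; apply: Ur; rewrite ?inE//; apply: iso_rng_inj => //; exact: Ua.
split; first exact: image_arr.
move=> I W oW UW; have [||F fF UF] := cU I (fun i => f' @` (W i)).
- by move=> i; have [_ _ _] := hf'; exact.
- move=> g Ug; have [i _ Wg] := UW _ (imageP f Ug); exists i => //.
  by exists (f g) => //; rewrite isoK//; exact: Ua.
exists F => // _ [g Ug <-]; have [i Fi [h Wh hg]] := UF _ Ug; exists i => //.
have [_ _ /(_ _ (oW i) _ Wh) hH] := Hc.
suff -> : f g = h by [].
by have [/(_ _ hH)[_ <-]] := hf'; rewrite hg.
Qed.

Lemma iso_bis_mul U V : U `<=` garr G -> V `<=` garr G ->
  f @` (bis_mul G U V) = bis_mul H (f @` U) (f @` V).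
Proof.
have [_ _ fm _] := hf; move=> Ua Va; apply/seteqP; split.
  move=> _ [_ [u [v [Uu Vv uv ->]]] <-]; exists (f u), (f v); split.
  - by exists u.
  - by exists v.
  - by apply/iso_comp => //; [exact: Ua|exact: Va].
  - by apply: fm => //; [exact: Ua|exact: Va].
move=> _ [_ [_ [[u Uu <-] [v Vv <-] + ->]]].
move=> /(iso_comp (Ua _ Uu) (Va _ Vv)) uv; exists (gmul G u v).
  by exists u, v; split.
by apply: fm => //; [exact: Ua|exact: Va].
Qed.

Definition pair_map (p : gcar G * gcar G) : gcar H * gcar H := (f p.1, f p.2).

Lemma iso_tau U : U `<=` garr G -> tau H (f @` U) = pair_map @` (tau G U).
Proof.
move=> Ua; apply/seteqP; split.
  move=> _ [_ [u Uu <-] ->]; exists (gsrc G u, grng G u); first by exists u.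
  by rewrite /pair_map /= iso_src ?iso_rng//; exact: Ua.
move=> _ [_ [u Uu ->] <-]; exists (f u); first by exists u.
by rewrite /pair_map /= iso_src ?iso_rng//; exact: Ua.
Qed.

End Transport.

Section TransportIso.
Variables (G H : topgroupoid) (f : gcar G -> gcar H) (f' : gcar H -> gcar G).
Hypotheses (Gc : groupoid_closed G) (Hc : groupoid_closed H).
Hypotheses (hf : iso_half f f') (hf' : iso_half f' f).

Let cobis_sub U : cobis G U -> U `<=` garr G.
Proof. by move=> [_ [_ []]]. Qed.

Let cobis_sub' U : cobis H U -> U `<=` garr H.
Proof. by move=> [_ [_ []]]. Qed.

Lemma iso_cobis_semigroup :
  semigroup_iso_on (cobis G) (@bis_mul G) (cobis H) (@bis_mul H).
Proof.
exists (fun U => f @` U); split; last first.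
  by move=> U V cU cV; apply: (iso_bis_mul Gc hf); exact: cobis_sub.
split=> [U cU|U V|V cV].
- exact: (iso_cobis Gc Hc hf hf').
- rewrite !inE => cU cV UV.
  by rewrite -(imageK hf (cobis_sub cU)) UV (imageK hf)//; exact: cobis_sub.
- exists (f' @` V); first exact: (iso_cobis Hc Gc hf' hf).
  by apply: (imageK hf'); exact: cobis_sub'.
Qed.

Lemma pair_mapK (P : set (gcar G * gcar G)) :
  (forall p, P p -> garr G p.1 /\ garr G p.2) -> pair_map f' @` (pair_map f @` P) = P.
Proof.
move=> Pa; apply/seteqP; split=> [_ [_ [[g h] Pgh <-] <-]|[g h] Pgh].
  by have [gG hG] := Pa _ Pgh; rewrite /pair_map /= !(isoK hf).
exists (f g, f h); first by exists (g, h).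
by have [gG hG] := Pa _ Pgh; rewrite /pair_map /= !(isoK hf).
Qed.

Lemma tau_arr U p : U `<=` garr G -> tau G U p -> garr G p.1 /\ garr G p.2.
Proof. by have [c _ _] := Gc; move=> Ua [u /Ua uG ->]; have [] := c _ uG. Qed.

Lemma iso_pseudogroup :
  semigroup_iso_on (full_pseudogroup G) (@pb_mul (gcar G))
                   (full_pseudogroup H) (@pb_mul (gcar H)).
Proof.
exists (fun P => pair_map f @` P); split; last first.
  move=> _ _ [U cU <-] [V cV <-].
  have Ua := cobis_sub cU; have Va := cobis_sub cV.
  apply/seteqP; split.
    move=> _ [[a c] [b [/= Vab Ubc]] <-]; exists (f b); split.
      by exists (a, b).
    by exists (b, c).
  move=> [_ _] [_ [/= [[a b] Vab [<- <-]] [[b' c] Ubc [bb <-]]]].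
  have [_ bG] := tau_arr Va Vab; have [b'G _] := tau_arr Ua Ubc.
  exists (a, c) => //; exists b; split => //.
  by have -> : b = b' by apply: (iso_inj hf bG b'G).
split.
- move=> _ [U cU <-]; exists (f @` U); first exact: (iso_cobis Gc Hc hf hf').
  by apply: (iso_tau hf); exact: cobis_sub.
- move=> _ _ /set_mem[U cU <-] /set_mem[V cV <-] UV.
  rewrite -[LHS]pair_mapK; last by move=> p; apply: tau_arr; exact: cobis_sub.
  by rewrite UV pair_mapK// => p; apply: tau_arr; exact: cobis_sub.
- move=> _ [V cV <-]; exists (tau G (f' @` V)).
    by exists (f' @` V) => //; exact: (iso_cobis Hc Gc hf' hf).
  rewrite -(iso_tau hf); first by rewrite (imageK hf')//; exact: cobis_sub'.
  by apply: (image_arr hf'); exact: cobis_sub'.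
Qed.

End TransportIso.

(** * Steinberg algebras *)

Section SteinbergBasics.
Variables (R : comNzRingType) (G : topgroupoid).

Lemma indE (T : Type) (U : set T) x : U x -> ind R U x = 1.
Proof. by move=> Ux; rewrite /ind asboolT. Qed.

Lemma ind0 (T : Type) (U : set T) x : ~ U x -> ind R U x = 0.
Proof. by move=> Ux; rewrite /ind asboolF. Qed.

Lemma ind_neq0 (T : Type) (U : set T) x : ind R U x != 0 -> U x.
Proof. by rewrite /ind; case: asboolP => //; rewrite eqxx. Qed.

Lemma eq_ind (T T' : Type) (U : set T) (V : set T') x y : (U x <-> V y) -> ind R U x = ind R V y.
Proof.
move=> UV; case: (pselect (U x)) => Ux; first by rewrite !indE//; exact/UV.
by rewrite !ind0// => /UV.
Qed.

Lemma steinberg_garr f g : steinberg R G f -> ~ garr G g -> f g = 0.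
Proof.
move=> [n [c [U [cU ->]]]] ng; apply: big1 => i _; rewrite ind0 ?mulr0//.
by have [_ [_ [Ua _ _]]] := cU i => /Ua.
Qed.

Lemma steinberg_ind U : cobis G U -> steinberg R G (ind R U).
Proof.
move=> cU; exists 1%N, (fun _ => 1), (fun _ => U); split => //.
by apply/funext => g; rewrite big_ord1 mul1r.
Qed.

Lemma steinberg0 : steinberg R G (fun _ => 0).
Proof.
exists 0%N, (fun _ => 1), (fun _ => set0); split; first by case.
by apply/funext => g; rewrite big_ord0.
Qed.

Lemma steinbergD f h : steinberg R G f -> steinberg R G h ->
  steinberg R G (fun g => f g + h g).
Proof.
move=> [m [c [U [cU ->]]]] [n [d [V [cV ->]]]].
exists (m + n)%N, (fun i => match fintype.split i with inl j => c j | inr k => d k end),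
  (fun i => match fintype.split i with inl j => U j | inr k => V k end); split.
  by move=> i; case: (fintype.split i).
apply/funext => g; rewrite big_split_ord; congr (_ + _); apply: eq_bigr => i _.
  by rewrite (unsplitK (inl i)).
by rewrite (unsplitK (inr i)).
Qed.

Lemma steinbergZ r f : steinberg R G f -> steinberg R G (fun g => r * f g).
Proof.
move=> [m [c [U [cU ->]]]]; exists m, (fun i => r * c i), U; split => //.
by apply/funext => g; rewrite mulr_sumr; apply: eq_bigr => i _; rewrite mulrA.
Qed.

Lemma steinberg_sum (I : Type) (r : seq I) (F : I -> gcar G -> R) :
  (forall i, steinberg R G (F i)) -> steinberg R G (fun g => \sum_(i <- r) F i g).
Proof.
move=> sF; elim: r => [|i r IH].
  rewrite (_ : (fun _ => _) = fun _ => 0); first exact: steinberg0.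
  by apply/funext => g; rewrite big_nil.
rewrite (_ : (fun _ => _) = fun g => F i g + \sum_(j <- r) F j g); first exact: steinbergD.
by apply/funext => g; rewrite big_cons.
Qed.

End SteinbergBasics.

(** The carrier contains points that are not arrows, where [h] is uncontrolled; elements of the
    Steinberg algebra vanish there, hence the extension by zero. *)
Definition push (R : comNzRingType) (G H : topgroupoid) (h : gcar H -> gcar G)
    (u : gcar G -> R) : gcar H -> R :=
  fun k => if `[< garr H k >] then u (h k) else 0.

Section SteinbergTransport.
Variables (R : comNzRingType) (G H : topgroupoid) (f : gcar G -> gcar H) (f' : gcar H -> gcar G).
Hypotheses (Gc : groupoid_closed G) (Hc : groupoid_closed H).
Hypotheses (hf : iso_half f f') (hf' : iso_half f' f).

Lemma pushE (u : gcar G -> R) g : garr G g -> push f' u (f g) = u g.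
Proof. by move=> gG; rewrite /push asboolT ?(isoK hf)//; exact: (iso_arr hf). Qed.

Lemma push_steinberg u : steinberg R G u -> steinberg R H (push f' u).
Proof.
move=> [n [c [U [cU ->]]]]; exists n, c, (fun i => f @` (U i)); split.
  by move=> i; exact: (iso_cobis Gc Hc hf hf').
apply/funext => h; rewrite /push; case: asboolP => hH.
  apply: eq_bigr => i _; congr (_ * _); apply: eq_ind; split.
    by move=> Uh; exists (f' h) => //; exact: (isoK hf').
  move=> [g Ug <-]; rewrite (isoK hf)//.
  by have [_ [_ [Ua _ _]]] := cU i; exact: Ua.
rewrite big1// => i _; rewrite ind0 ?mulr0// => -[g Ug gh]; apply: hH; rewrite -gh.
by apply: (iso_arr hf); have [_ [_ [Ua _ _]]] := cU i; exact: Ua.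
Qed.

Lemma push_conv u v : push f' (conv u v) = conv (push f' u) (push f' v) :> (gcar H -> R).
Proof.
apply/funext => h; rewrite {1}/push {1}/conv [in RHS]/conv; case: asboolP => // hH.
have gG := iso_arr hf' hH; have fg := isoK hf' hH.
move: (f' h) gG fg => g gG <- {h hH}; rewrite asboolT//.
have [c cm _] := Gc; have [_ ci fm _] := hf.
have fi a : garr G a -> grng G a = grng G g ->
    f (gmul G (ginv G a) g) = gmul H (ginv H (f a)) (f g).
  move=> aG ag; have [_ _ iG isrc] := c _ aG.
  by rewrite fm ?isrc//; have [_ _ ->] := ci _ aG.
rewrite /fsum (@reindex_fsbig _ _ _ {classic (gcar G)} {classic (gcar H)} f
  [set a | garr G a /\ grng G a = grng G g]).
  apply: eq_fsbigr => a /set_mem[aG ag]; have [_ _ iG isrc] := c _ aG.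
  rewrite pushE// -fi// pushE//; apply: cm => //; by rewrite isrc.
split.
- by move=> a [aG ag]; split; [exact: (iso_arr hf)|rewrite -!(iso_rng hf)// ag].
- move=> a b; rewrite !inE => -[aG _] [bG _]; exact: (iso_inj hf aG bG).
- move=> b [bH bg]; exists (f' b); last exact: (isoK hf').
  split; first exact: (iso_arr hf').
  apply: (iso_rng_inj Gc hf) => //; first exact: (iso_arr hf').
  by rewrite (isoK hf').
Qed.

Lemma push_diag u : steinberg_diag R G u -> steinberg_diag R H (push f' u).
Proof.
move=> [su du]; split; first exact: push_steinberg.
move=> h; rewrite /push; case: asboolP => [hH|]; last by rewrite eqxx.
move=> /du[gG gs]; split => //.
by rewrite -{1}(isoK hf' hH) -(iso_src hf)// gs (isoK hf').
Qed.

End SteinbergTransport.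

Section SteinbergIso.
Variables (R : comNzRingType) (G H : topgroupoid) (f : gcar G -> gcar H) (f' : gcar H -> gcar G).
Hypotheses (Gc : groupoid_closed G) (Hc : groupoid_closed H).
Hypotheses (hf : iso_half f f') (hf' : iso_half f' f).

Lemma pushK u : steinberg R G u -> push f (push f' u) = u.
Proof.
move=> su; apply/funext => g; rewrite {1}/push; case: asboolP => gG; first by rewrite (pushE hf).
by rewrite (steinberg_garr su).
Qed.

Lemma steinberg_iso_of_groupoid_iso : steinberg_diag_iso R true G H.
Proof.
have pS := push_steinberg Gc Hc hf hf'; have pS' := push_steinberg Hc Gc hf' hf.
exists (push f'); split.
- split=> [u|u v|v sv]; first exact: pS.
    by rewrite !inE => su sv uv; rewrite -(pushK su) uv pushK.
  by exists (push f v); [exact: pS'|apply/funext => h; rewrite {1}/push; case: asboolP => hH;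
    [rewrite (pushE hf')|rewrite (steinberg_garr sv)]].
- move=> u v _ _; apply/funext => h; rewrite /push; case: asboolP => //.
  by rewrite addr0.
- by move=> u v _ _; exact: (push_conv Gc hf hf').
- apply/seteqP; split=> [_ [u du <-]|v dv]; first exact: (push_diag Gc Hc hf hf').
  exists (push f v); first exact: (push_diag Hc Gc hf' hf).
  have [sv _] := dv; apply/funext => h; rewrite {1}/push; case: asboolP => hH.
    by rewrite (pushE hf').
  by rewrite (steinberg_garr sv).
- move=> _ r u _; apply/funext => h; rewrite /push; case: asboolP => //.
  by rewrite mulr0.
Qed.

End SteinbergIso.

(** * Finite sums over arbitrary index types *)

Section FiniteSums.
Variables (R : nmodType) (I : Type).

Lemma fsum_seq (A : set I) (r : seq {classic I}) (F : I -> R) : uniq r ->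
  (forall i, i \in r -> A i) -> (forall i : {classic I}, A i -> i \notin r -> F i = 0) ->
  fsum A F = \sum_(i <- r) F i.
Proof.
move=> ur rA F0; rewrite /fsum (fsbigE r)//.
rewrite big_seq_cond [RHS]big_seq_cond; apply: eq_bigl => i.
by case: (boolP (i \in r)) => //= /rA/mem_set ->.
Qed.

Lemma fsum1 (A : set I) (i : I) (F : I -> R) : A i ->
  (forall j, A j -> j <> i -> F j = 0) -> fsum A F = F i.
Proof.
move=> Ai F0; rewrite (@fsum_seq A [:: i : {classic I}])//; first by rewrite big_seq1.
- by move=> j; rewrite inE => /eqP ->.
- by move=> j Aj; rewrite inE => /eqP ji; exact: F0.
Qed.

Lemma fsum_neq0 (A : set I) (F : I -> R) : fsum A F <> 0 -> exists2 i, A i & F i <> 0.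
Proof.
move=> AF; apply: contrapT => /forall2NP nF; apply: AF; apply: fsbig1 => i Ai.
by have [//|/contrapT] := nF i.
Qed.

End FiniteSums.

(** * The Steinberg algebra of the groupoid of germs as a diagonal system *)

Section SteinbergGerms.
Variables (R : comNzRingType) (S : invSemigroup) (X : topologicalType) (th : partial_action S X).
Local Notation dom s := (pdom th (istar s)).
Local Notation act s := (Defs.pmap th s).
Local Notation G := (germ_groupoid th).
Hypotheses (hX : hausdorff_space X) (hG : groupoid_hausdorff G).
Implicit Types (a b f : gcar G -> R).

Lemma gmulKV g h : garr G g -> garr G h -> gsrc G g = grng G h ->
  gmul G (ginv G g) (gmul G g h) = h.
Proof.
move=> gG; move: g gG h; apply: garr_ind => s y sy; apply: garr_ind => t x tx.
rewrite gsrc_germ// grng_germ// => /unit_germ_inj yx; subst y.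
have stx := dom_mul tx sy; have ssx := act_star sy.
rewrite gmul_germ// ginv_germ//; rewrite -act_mul// in ssx *.
rewrite gmul_germ//; apply/eq_germP; first exact: dom_mul.
split => //; exists (imul (istar s) (imul s t)); split; first exact: isg_le_refl.
  by rewrite imulA; apply: isg_le_mull; exact: idem_istarl.
exact: dom_mul.
Qed.

Lemma garr_inv g : garr G g -> [/\ garr G (ginv G g), gsrc G (ginv G g) = grng G g,
  grng G (ginv G g) = gsrc G g & ginv G (ginv G g) = g].
Proof.
move: g; apply: garr_ind => s x sx; have ssx := act_star sx.
rewrite ginv_germ// ginv_germ// !gsrc_germ// !grng_germ// actK// istarK.
by split => //; exact: garr_germ.
Qed.

Lemma gmulVK g h : garr G g -> garr G h -> grng G g = grng G h ->
  gmul G g (gmul G (ginv G g) h) = h.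
Proof.
move=> gG hG' gh; have [iG isrc irng ii] := garr_inv gG.
by rewrite -{1}ii gmulKV// isrc.
Qed.

Lemma gmul_runit g x : garr G g -> gsrc G g = unit_germ th x -> gmul G g (unit_germ th x) = g.
Proof. by move=> gG gx; have [s sx ->] := arr_at gG gx; exact: gmul_unitr. Qed.

(** The usual proof that compact sets in a Hausdorff space are closed, carried out with the bare
    family [gopen]. *)
Lemma gopen_avoid K g : gcompact G K -> garr G g -> ~ K g ->
  exists W, [/\ gopen G W, W g & W `&` K = set0].
Proof.
move=> [Ka cK] gG nKg.
pose I := {AB : set (gcar G) * set (gcar G) |
  [/\ gopen G AB.1, gopen G AB.2, AB.1 g & AB.1 `&` AB.2 = set0]}.
have [||F fF KF] := cK I (fun i => (sval i).2); first by move=> [AB []].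
  move=> k Kk; have [|A [B [oA oB Ag Bk AB]]] := hG gG (Ka _ Kk).
    by move=> gk; apply: nKg; rewrite gk.
  by exists (exist _ (A, B) (And4 oA oB Ag AB)).
have /finite_seqP[r rF] : finite_set (F : set {classic I}) by [].
pose L := foldr (fun (i : I) A => (sval i).1 `&` A) (garr G).
have [oL Lg LF] : [/\ gopen G (L r), L r g & forall i, i \in r -> L r `<=` (sval (i : I)).1].
  elim: (r) => [|i r' [oL Lg LF]] /=.
    split => //; apply/gopenP; split => // s x sx _.
    by apply: filterS (near_dom sx) => y; exact: garr_germ.
  have [oA _ Ag _] := svalP i; split => //; first exact: gopenI.
  by move=> j; rewrite in_cons => /predU1P[->|/LF jL]; [exact: subIsetl|move=> k [_ /jL]].
exists (L r); split => //; apply/seteqP; split => // k [Lk Kk].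
have [i Fi ik] := KF _ Kk; have [_ _ _ <-] := svalP i; split => //.
by apply: LF Lk; move: Fi; rewrite rF.
Qed.

(** By Hausdorffness of the groupoid a compact open bisection is closed too, so its indicator is
    locally constant. All local constancy in the Steinberg algebra comes from here. *)
Lemma ind_near U s x : cobis G U -> dom s x ->
  \forall y \near x, ind R U (germ th s y) = ind R U (germ th s x).
Proof.
move=> [oU [gU _]] sx; case: (pselect (U (germ th s x))) => Ux.
  have /gopenP[_ /(_ _ _ sx Ux)] := oU.
  by apply: filterS => y Uy; rewrite !indE.
have [W [/gopenP[_ oW] Wx WU]] := gopen_avoid gU (garr_germ sx) Ux.
apply: filterS (oW _ _ sx Wx) => y Wy; rewrite !ind0// => Uy.
by have : (W `&` U) (germ th s y) by []; rewrite WU.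
Qed.

Lemma steinberg_near f s x : steinberg R G f -> dom s x ->
  \forall y \near x, f (germ th s y) = f (germ th s x).
Proof.
move=> [n [c [U [cU ->]]]] sx.
have : \forall y \near x, forall i : 'I_n, ind R (U i) (germ th s y) = ind R (U i) (germ th s x).
  by apply: filter_forall => i; exact: ind_near.
by apply: filterS => y E; apply: eq_bigr => i _; rewrite E.
Qed.

Lemma steinberg_near_unit f x : steinberg R G f ->
  \forall y \near x, f (unit_germ th y) = f (unit_germ th x).
Proof.
move=> sf; have [e ee ex] := idem_at th x.
apply: filterS2 (steinberg_near sf ex) (near_dom ex) => y fy ey.
by rewrite -(germ_idem ee ex) -fy germ_idem.
Qed.

Lemma open_nz (f : X -> R) : (forall x, \forall y \near x, f y = f x) ->
  open [set x | f x != 0] /\ closed [set x | f x != 0].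
Proof.
move=> cf; split; first by rewrite openE => x /= fx; apply: filterS (cf x) => y /= ->.
rewrite -[X in closed X]setCK; apply: open_closedC; rewrite openE => x /= fx.
by apply: filterS (cf x) => y /= ->.
Qed.

(** The set is clopen by local constancy and lies in the finite union of the source sets of the
    bisections that make up [f], which is compact. *)
Lemma steinberg_unit_supp f : steinberg R G f -> compopen [set x | f (unit_germ th x) != 0].
Proof.
move=> sf; have [oN cN] := open_nz (fun x => steinberg_near_unit x sf).
split => //; have [n [c [U [cU fE]]]] := sf.
have cK : compact (\bigcup_(i in [set` enum 'I_n]) src_set th (U i)).
  rewrite bigcup_seq; apply: bigsetU_compact => i _.
  by have [] := src_set_cobis (cU i).
apply: (subclosed_compact cN cK) => x /= fx; apply: contrapT => nK; move: fx.
rewrite fE big1 ?eqxx// => i _; rewrite ind0 ?mulr0// => Ux; apply: nK.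
exists i; first by rewrite /= mem_enum.
by exists (unit_germ th x) => //; exact: gsrc_unit.
Qed.

Lemma conv_unitl a b g : (forall h, a h != 0 -> gunits G h) -> garr G g ->
  conv a b g = a (grng G g) * b g.
Proof.
move=> ua; move: g; apply: garr_ind => s x sx; rewrite /conv asboolT; last exact: garr_germ.
rewrite grng_germ// (fsum1 (i := unit_germ th (act s x))).
- by rewrite ginv_unit gmul_unitl.
- by split; [exact: garr_unit|exact: grng_unit].
- move=> k [kG kr] kx.
  have [->|/eqP/ua/gunitsP[y ky]] := pselect (a k = 0); first by rewrite mul0r.
  by case: kx; rewrite -kr ky grng_unit.
Qed.

Lemma conv_unitr a b g x : (forall h, b h != 0 -> gunits G h) -> garr G g ->
  gsrc G g = unit_germ th x -> conv a b g = a g * b (unit_germ th x).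
Proof.
move=> ub gG gx; rewrite /conv asboolT//.
have [iG isrc irng ii] := garr_inv gG.
have E : gmul G (ginv G g) g = unit_germ th x.
  by rewrite -{2}(gmul_runit gG gx) gmulKV ?grng_unit//; exact: garr_unit.
rewrite (fsum1 (i := g)) ?E// => k [kG kr] kx.
have [->|/eqP/ub/gunitsP[y ky]] := pselect (b (gmul G (ginv G k) g) = 0); first by rewrite mulr0.
  have [jG jsrc jrng jj] := garr_inv kG; case: kx.
  have jg : gsrc G (ginv G k) = grng G g by rewrite jsrc.
  have [_ E1 E2] := gmulP jG gG jg.
  have kg := gmulVK kG gG kr; rewrite ky in kg E1 E2.
  rewrite grng_unit in E2; rewrite jrng in E2.
  by rewrite -kg gmul_runit.
Qed.

(** The range of an arrow of UV determines its first factor in the bisection [U], so the convolution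
    sum has at most one nonzero term, equal to 1. *)
Lemma conv_ind U V : cobis G U -> cobis G V ->
  conv (ind R U) (ind R V) = ind R (bis_mul G U V).
Proof.
move=> [_ [_ [Ua Us Ur]]] [_ [_ [Va _ _]]]; apply/funext => g; rewrite /conv.
case: asboolP => [gG|ng]; last first.
  rewrite ind0// => -[u [v [Uu Vv uv gE]]]; apply: ng; rewrite gE.
  by have [] := gmulP (Ua _ Uu) (Va _ Vv) uv.
case: (pselect (bis_mul G U V g)) => [[u [v [Uu Vv uv gE]]]|nUV].
  rewrite [RHS]indE; last by exists u, v.
  have uG := Ua _ Uu; have vG := Va _ Vv; have [_ gs gr] := gmulP uG vG uv.
  rewrite (fsum1 (i := u)).
  - by rewrite indE// gE gmulKV// indE// mulr1.
  - by rewrite gE gr.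
  - move=> k [kG kr] ku; rewrite ind0 ?mul0r// => Uk; apply: ku.
    by apply: Ur; rewrite ?inE// kr gE gr.
rewrite ind0// /fsum; apply: fsbig1 => k [kG kr].
case: (pselect (U k)) => Uk; last by rewrite ind0 ?mul0r.
rewrite [X in _ * X]ind0 ?mulr0// => Vk; apply: nUV.
exists k, (gmul G (ginv G k) g); split => //; last by rewrite gmulVK.
have [jG jsrc jrng jj] := garr_inv kG.
have jg : gsrc G (ginv G k) = grng G g by rewrite jsrc.
by have [_ _ ->] := gmulP jG gG jg.
Qed.

Lemma ind_unit_diag V h : ind R (unit_germ th @` V) h != 0 -> gunits G h.
Proof. by move=> h0; have [x _ <-] := ind_neq0 h0; apply/gunitsP; exists x. Qed.

(** Closure under convolution is taken as a hypothesis here and supplied by [steinberg_conv], once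
    the crossed product has been compared with the Steinberg algebra. *)
Definition steinberg_system (hR : indecomposable R) :
  (forall a b, steinberg R G a -> steinberg R G b -> steinberg R G (conv a b)) ->
  diag_system th (steinberg R G) (steinberg_diag R G) conv.
Proof.
move=> sM.
have iinj (U V : set (gcar G)) : ind R U = ind R V -> U = V.
  move=> UV; apply/seteqP; split=> g Ug; apply: (@ind_neq0 R).
    by rewrite -UV indE ?oner_neq0.
  by rewrite UV indE ?oner_neq0.
apply: (@DiagSystem _ _ _ _ _ _ _ (fun V => ind R (unit_germ th @` V))
  (fun s V => ind R (germ_basic th s V)) (fun a => [set g | garr G g /\ a g != 0])).
- by move=> a [].
- exact: sM.
- move=> a; split=> [[[sa da] aa]|[V cV ->]].
    exists [set x | a (unit_germ th x) != 0]; first exact: steinberg_unit_supp.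
    (* On units convolution of diagonal elements is pointwise, so an idempotent takes idempotent
       values in [R]; indecomposability makes it an indicator. *)
    have a01 x : a (unit_germ th x) = 0 \/ a (unit_germ th x) = 1.
      apply: hR; rewrite -[in RHS]aa conv_unitl ?grng_unit//; exact: garr_unit.
    apply/funext => g; case: (pselect (exists x, g = unit_germ th x)) => [[x ->]|ng].
      case: (a01 x) => ax; rewrite ax.
        by rewrite ind0// => -[y /= + /unit_germ_inj yx]; rewrite yx ax eqxx.
      by rewrite indE//; exists x => //=; rewrite ax oner_neq0.
    rewrite ind0; last by move=> [x _ xg]; apply: ng; exists x.
    by apply: contrapT => /eqP/da/gunitsP.
  split; first by split; [apply: steinberg_ind; exact: unit_cobis|exact: ind_unit_diag].
  by rewrite conv_ind ?bis_mul_unitI ?setIid//; exact: unit_cobis.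
- by move=> V W cV cW; rewrite conv_ind ?bis_mul_unitI//; exact: unit_cobis.
- by move=> V W _ _ /iinj; exact: image_unit_inj.
- by move=> s V cV Vs; apply: steinberg_ind; exact: germ_basic_cobis.
- move=> s V W cV Vs cW WV; have cW' : compopen (act s @` W).
    by apply: act_compopen => //; exact: subset_trans Vs.
  by rewrite !conv_ind ?bis_mul_basic_unit//; solve [exact: unit_cobis | exact: germ_basic_cobis].
- move=> s V cV Vs; rewrite conv_ind ?bis_mul_basic_star//; last exact: germ_basic_cobis.
  apply: germ_basic_cobis; first exact: act_compopen.
  by move=> _ [x /Vs sx <-]; exact: act_star.
- move=> a sa; apply/gopenP; split=> [g []//|s x sx [_ ax]].
  apply: filterS2 (steinberg_near sa sx) (near_dom sx) => y ay sy.
  by split; [exact: garr_germ|rewrite ay].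
- move=> a V W x g sa cV cW E [gG ag] gx Vx.
  have : @conv R G a (ind R (unit_germ th @` V)) g != 0.
    by rewrite (conv_unitr a (@ind_unit_diag V) gG gx) indE ?mulr1//; exists x.
  rewrite E conv_unitl//; last exact: ind_unit_diag.
  case: (pselect ((unit_germ th @` W) (grng G g))) => [[y Wy yg] _|nW]; first by exists y.
  by rewrite ind0// mul0r eqxx.
- move=> a b V x sa sb cV E Vx.
  have : @conv R G a b (unit_germ th x) != 0 by rewrite E indE ?oner_neq0//; exists x.
  rewrite /conv asboolT; last exact: garr_unit.
  move=> /eqP/fsum_neq0[k [kG kr] kab].
  have [jG jsrc jrng jj] := garr_inv kG.
  have jg : gsrc G (ginv G k) = grng G (unit_germ th x) by rewrite jsrc.
  have [mG ms mr] := gmulP jG (garr_unit th x) jg.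
  exists (gmul G (ginv G k) (unit_germ th x)); last by rewrite ms gsrc_unit.
  by split => //; apply/eqP => b0; apply: kab; rewrite b0 mulr0.
Qed.

End SteinbergGerms.

(** * Crossed products *)

Section DualIdeals.
Variables (R : comNzRingType) (S : invSemigroup) (X : topologicalType) (th : partial_action S X).
Hypothesis hX : hausdorff_space X.
Implicit Types (s t : S) (f : X -> R) (V : set X).

Definition nz f : set X := [set x | f x != 0].

Definition loc_const f := forall x, \forall y \near x, f y = f x.

(** The nonzero set of a locally constant function is already closed, so the closure in [fsupp]
    disappears. *)
Lemma DualP s f : Dual th s f <-> [/\ loc_const f, compact (nz f) & nz f `<=` pdom th s].
Proof.
have E : loc_const f -> fsupp R X f = nz f.
  by move=> lf; rewrite /fsupp -(closure_id _).1//; have [] := open_nz lf.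
split=> [[[lf cf] sf]|[lf cf sf]].
  have lf' : loc_const f.
    move=> x; have [U [oU Ux] fU] := lf x.
    have : \forall y \near x, U y by exact: open_nbhs_nbhs.
    by apply: filterS => y /fU.
  by rewrite (E lf') in cf sf.
split; last by rewrite E.
split; last by rewrite E.
move=> x; have : nbhs x [set y | f y = f x] := lf x.
  rewrite nbhsE => -[U [oU Ux] fU].
by exists U => // y /fU.
Qed.

Lemma Dual_compopen s f : Dual th s f -> compopen (nz f).
Proof. by move=> /DualP[lf cf _]; split => //; have [] := open_nz lf. Qed.

Lemma Dual_loc_const s f : Dual th s f -> loc_const f.
Proof. by move=> /DualP[]. Qed.

Lemma Dual_pdom s f x : Dual th s f -> f x != 0 -> pdom th s x.
Proof. by move=> /DualP[_ _ sf] fx; exact: sf. Qed.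

Lemma Dual_intro s f K : loc_const f -> compact K -> nz f `<=` K -> nz f `<=` pdom th s ->
  Dual th s f.
Proof.
move=> lf cK fK fs; apply/DualP; split => //.
by apply: (subclosed_compact _ cK) => //; have [] := open_nz lf.
Qed.

Lemma Dual0 s : Dual th s (fun _ => 0 : R).
Proof.
apply: (@Dual_intro _ _ set0); last by move=> x; rewrite /nz /= eqxx.
- by move=> x; apply: filterS filterT.
- exact: compact0.
- by move=> x; rewrite /nz /= eqxx.
Qed.

Lemma DualD s f g : Dual th s f -> Dual th s g -> Dual th s (fun x => f x + g x).
Proof.
move=> /DualP[lf cf sf] /DualP[lg cg sg].
have fgU : nz (fun x => f x + g x) `<=` nz f `|` nz g.
  move=> x; rewrite /nz /=; case: (eqVneq (f x) 0) => [->|]; last by left.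
  by rewrite add0r; right.
apply: (Dual_intro _ (compactU cf cg)) => //.
  by move=> x; apply: filterS2 (lf x) (lg x) => y -> ->.
by move=> x /fgU[/sf|/sg].
Qed.

Lemma DualZ s f r : Dual th s f -> Dual th s (fun x => r * f x).
Proof.
move=> /DualP[lf cf sf].
have fgU : nz (fun x => r * f x) `<=` nz f.
  by move=> x; rewrite /nz /=; apply: contra_neq => ->; rewrite mulr0.
apply: (Dual_intro _ cf) => //; last by move=> x /fgU/sf.
by move=> x; apply: filterS (lf x) => y ->.
Qed.

Lemma DualN s f : Dual th s f -> Dual th s (fun x => - f x).
Proof.
move=> /(DualZ (-1)); rewrite (_ : (fun x => -1 * f x) = fun x => - f x)//.
by apply/funext => x; rewrite mulN1r.
Qed.

Lemma pdom_le r s x : isg_le r s -> pdom th r x -> pdom th s x.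
Proof.
by move=> /isg_le_star rs rx; apply/dom_star; apply: (dom_le rs); apply/dom_star.
Qed.

Lemma Dual_sub r s f : nz f `<=` pdom th s -> Dual th r f -> Dual th s f.
Proof. by move=> fs /DualP[lf cf _]; apply/DualP. Qed.

Lemma Dual_le r s f : isg_le r s -> Dual th r f -> Dual th s f.
Proof.
move=> rs fr; apply: Dual_sub (fr) => x fx; apply: (pdom_le rs).
exact: Dual_pdom fr fx.
Qed.

(** Cutting is additive along disjoint sets ([fcutU]) and gives back [f] on [nz f], which is the
    form in which [co_ind] is applied to functions. *)
Definition fcut V f : X -> R := fun x => if `[< V x >] then f x else 0.

Lemma fcut_in V f x : V x -> fcut V f x = f x.
Proof. by move=> Vx; rewrite /fcut asboolT. Qed.

Lemma fcut_out V f x : ~ V x -> fcut V f x = 0.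
Proof. by move=> Vx; rewrite /fcut asboolF. Qed.

Lemma fcut0 f : fcut set0 f = fun _ => 0.
Proof. by apply/funext => x; rewrite fcut_out. Qed.

Lemma fcut_nz f : fcut (nz f) f = f.
Proof.
apply/funext => x; case: (eqVneq (f x) 0) => fx; last by rewrite fcut_in.
by rewrite fcut_out ?fx// /nz /= fx eqxx.
Qed.

Lemma fcutU V W f : V `&` W = set0 -> fcut (V `|` W) f = fun x => fcut V f x + fcut W f x.
Proof.
move=> VW; apply/funext => x; case: (pselect (V x)) => Vx.
  rewrite fcut_in; last by left.
  rewrite fcut_in// fcut_out ?addr0// => Wx.
  by have : (V `&` W) x by []; rewrite VW.
rewrite (fcut_out (V := V))// add0r; case: (pselect (W x)) => Wx.
  by rewrite !fcut_in//; right.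
by rewrite !fcut_out// => -[].
Qed.

Lemma near_compopen V x : compopen V -> \forall y \near x, V y <-> V x.
Proof.
move=> [cV oV]; case: (pselect (V x)) => Vx.
  have : \forall y \near x, V y by exact: open_nbhs_nbhs.
  by apply: filterS.
have : nbhs x (~` V).
  by apply: open_nbhs_nbhs; split => //; apply: closed_openC; exact: (compact_closed hX cV).
by apply: filterS => y nVy; split.
Qed.

Lemma fcut_loc_const V f : compopen V -> loc_const f -> loc_const (fcut V f).
Proof.
move=> cV lf x; apply: filterS2 (near_compopen x cV) (lf x) => y VV fy.
case: (pselect (V x)) => Vx; first by rewrite !fcut_in//; exact/VV.
by rewrite !fcut_out// => /VV.
Qed.

Lemma fcut_nz_sub V f : nz (fcut V f) `<=` V `&` nz f.
Proof.
move=> x; rewrite /nz /=; case: (pselect (V x)) => Vx; first by rewrite fcut_in.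
by rewrite fcut_out ?eqxx.
Qed.

Lemma Dual_fcut V s f : compopen V -> loc_const f -> V `<=` pdom th s -> Dual th s (fcut V f).
Proof.
move=> cV lf Vs; apply: (@Dual_intro _ _ V); first exact: fcut_loc_const.
- by case: cV.
- by move=> x /fcut_nz_sub[].
- by move=> x /fcut_nz_sub[/Vs].
Qed.

End DualIdeals.

(** * The map from finite sums to functions on germs *)

Section CrossedProduct.
Variables (R : comNzRingType) (S : invSemigroup) (X : topologicalType) (th : partial_action S X).
Hypotheses (hX : hausdorff_space X) (bX : co_base X).
Implicit Types (s t : S) (f : X -> R) (V : set X) (a b : S -> X -> R).
Local Notation dom s := (pdom th (istar s)).
Local Notation act s := (Defs.pmap th s).
Local Notation G := (germ_groupoid th).
Local Notation L := (@cpL R S X th).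
Local Notation "0_L" := ((fun _ _ => 0) : S -> X -> R).

Definition supp_in (r : seq {classic S}) a :=
  forall s : {classic S}, s \notin r -> a s = fun _ => 0.

Lemma cpL_seq a : L a -> exists2 r, uniq r & supp_in r a.
Proof.
move=> [fa _].
have /finite_seqP[r rE] : finite_set ([set s | a s <> fun _ => 0] : set {classic S}) by [].
exists (undup r); first exact: undup_uniq.
move=> s; rewrite mem_undup => sr; apply: contrapT => as0.
have /= rs : [set` r] s by rewrite -rE.
by rewrite rs in sr.
Qed.

Lemma cpL_intro r a : supp_in r a -> (forall s, Dual th s (a s)) -> L a.
Proof.
move=> ra Da; split => //; apply: (@sub_finite_set {classic S} _ [set` r]); last exact: finite_seq.
move=> s /= as0; apply: contrapT => /negP sr; exact: as0 (ra _ sr).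
Qed.

Lemma cpL_Dual a s : L a -> Dual th s (a s).
Proof. by move=> [_]. Qed.

Lemma cpL0 : L 0_L.
Proof. by apply: (@cpL_intro [::]) => // s; exact: Dual0. Qed.

Lemma supp_in_cat r r' a b c : (forall s x, a s x = 0 -> b s x = 0 -> c s x = 0) ->
  supp_in r a -> supp_in r' b -> supp_in (r ++ r') c.
Proof.
move=> abc ra rb s; rewrite mem_cat => /norP[sr sr']; apply/funext => x.
by apply: abc; rewrite ?(ra s sr) ?(rb s sr').
Qed.

Lemma cpL_add a b : L a -> L b -> L (cp_add a b).
Proof.
move=> La Lb; have [r _ ra] := cpL_seq La; have [r' _ rb] := cpL_seq Lb.
apply: (@cpL_intro (r ++ r')); last by move=> s; apply: DualD; exact: cpL_Dual.
by apply: supp_in_cat ra rb => s x; rewrite /cp_add => -> ->; rewrite addr0.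
Qed.

Lemma cpL_scale c a : L a -> L (cp_scale c a).
Proof.
move=> La; have [r _ ra] := cpL_seq La.
apply: (@cpL_intro r); last by move=> s; apply: DualZ; exact: cpL_Dual.
by move=> s /ra as0; apply/funext => x; rewrite /cp_scale as0 mulr0.
Qed.

Lemma cpL_opp a : L a -> L (cp_opp a).
Proof.
move=> La; have [r _ ra] := cpL_seq La.
apply: (@cpL_intro r); last by move=> s; apply: DualN; exact: cpL_Dual.
by move=> s /ra as0; apply/funext => x; rewrite /cp_opp as0 oppr0.
Qed.

Lemma delta_in s f : delta s f s = f.
Proof. by rewrite /delta asboolT. Qed.

Lemma delta_out s f u : u <> s -> delta s f u = fun _ => 0.
Proof. by move=> us; rewrite /delta asboolF. Qed.

Lemma delta_supp s f : supp_in [:: s] (delta s f).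
Proof. by move=> u; rewrite inE => /eqP us; exact: delta_out. Qed.

Lemma cpL_delta s f : Dual th s f -> L (delta s f).
Proof.
move=> sf; apply: (cpL_intro (@delta_supp s f)) => u.
case: (pselect (u = s)) => [->|us]; first by rewrite delta_in.
by rewrite delta_out//; exact: Dual0.
Qed.

Lemma deltaD s f g : delta s (fun x => f x + g x) = cp_add (delta s f) (delta s g).
Proof.
apply/funext => u; apply/funext => x; rewrite /cp_add.
case: (pselect (u = s)) => [->|us]; first by rewrite !delta_in.
by rewrite !delta_out// addr0.
Qed.

(* [psi] realises the crossed product as the Steinberg algebra: a_s delta_s
   becomes the function with value a_s(r(g)) at the germs g of s. *)
Definition rng_ev f (g : gcar G) : R :=
  if pselect (exists x, grng G g = unit_germ th x) is left e then f (projT1 (cid e)) else 0.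

Lemma rng_evE f g x : grng G g = unit_germ th x -> rng_ev f g = f x.
Proof.
move=> gx; rewrite /rng_ev; case: pselect => [e|[]]; last by exists x.
by congr f; apply: (@unit_germ_inj _ _ th); rewrite -gx; case: cid.
Qed.

Definition full_bis s : set (gcar G) := germ_basic th s (dom s).

Definition psi_term s f (g : gcar G) : R := if `[< full_bis s g >] then rng_ev f g else 0.

Definition psi a (g : gcar G) : R := fsum [set: S] (fun s => psi_term s (a s) g).

Lemma full_bis_germ s t x : dom t x -> full_bis s (germ th t x) <-> germ_eq th s t x.
Proof.
move=> tx; split=> [[y sy] E|st].
  by have [yx] := (eq_germP t x sy).1 E; rewrite yx.
have sx := germ_eq_dom st; exists x => //.
by apply/eq_germP.
Qed.

Lemma psi_term_in s f g x : full_bis s g -> grng G g = unit_germ th x -> psi_term s f g = f x.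
Proof. by move=> sg gx; rewrite /psi_term asboolT//; exact: rng_evE. Qed.

Lemma psi_term_out s f g : ~ full_bis s g -> psi_term s f g = 0.
Proof. by move=> sg; rewrite /psi_term asboolF. Qed.

Lemma full_bis_rng s g : full_bis s g -> exists2 x, pdom th s x & grng G g = unit_germ th x.
Proof.
move=> [x sx <-]; exists (act s x); last exact: grng_germ.
by apply/dom_star; exact: act_star.
Qed.

Lemma psi_term0 s g : psi_term s (fun _ => 0) g = 0.
Proof.
rewrite /psi_term; case: asboolP => // /full_bis_rng[x _ gx].
by rewrite (rng_evE _ gx).
Qed.

Lemma psi_termD s f h g : psi_term s (fun x => f x + h x) g = psi_term s f g + psi_term s h g.
Proof.
rewrite /psi_term; case: asboolP => [/full_bis_rng[x _ gx]|_]; last by rewrite addr0.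
by rewrite !(rng_evE _ gx).
Qed.

Lemma psi_termZ s c f g : psi_term s (fun x => c * f x) g = c * psi_term s f g.
Proof.
rewrite /psi_term; case: asboolP => [/full_bis_rng[x _ gx]|_]; last by rewrite mulr0.
by rewrite !(rng_evE _ gx).
Qed.

Lemma psi_seq r a g : uniq r -> supp_in r a -> psi a g = \sum_(s <- r) psi_term s (a s) g.
Proof.
by move=> ur ra; apply: fsum_seq => // s _ sr; rewrite (ra s sr) psi_term0.
Qed.

Lemma psi_delta s f g : psi (delta s f) g = psi_term s f g.
Proof. by rewrite (@psi_seq [:: s])//; [rewrite big_seq1 delta_in|exact: delta_supp]. Qed.

Lemma supp_in_sub r r' a : {subset r <= r'} -> supp_in r a -> supp_in r' a.
Proof. by move=> rr ra s sr; apply: ra; apply: contra sr => /rr. Qed.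

Lemma psiD a b g : L a -> L b -> psi (cp_add a b) g = psi a g + psi b g.
Proof.
move=> La Lb; have [r _ ra] := cpL_seq La; have [r' _ rb] := cpL_seq Lb.
have ur := undup_uniq (r ++ r').
have ra' : supp_in (undup (r ++ r')) a.
  by apply: supp_in_sub ra => s sr; rewrite mem_undup mem_cat sr.
have rb' : supp_in (undup (r ++ r')) b.
  by apply: supp_in_sub rb => s sr; rewrite mem_undup mem_cat sr orbT.
rewrite (psi_seq _ ur ra') (psi_seq _ ur rb') (@psi_seq (undup (r ++ r')))//.
  by rewrite -big_split; apply: eq_bigr => s _; exact: psi_termD.
by move=> s sr; apply/funext => x; rewrite /cp_add ra'// rb'// addr0.
Qed.

Lemma psiZ c a g : L a -> psi (cp_scale c a) g = c * psi a g.
Proof.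
move=> La; have [r ur ra] := cpL_seq La.
rewrite (psi_seq _ ur ra) (@psi_seq r)//.
  by rewrite mulr_sumr; apply: eq_bigr => s _; exact: psi_termZ.
by move=> s sr; apply/funext => x; rewrite /cp_scale ra// mulr0.
Qed.

Lemma cp_oppE a : cp_opp a = cp_scale (-1) a.
Proof. by apply/funext => s; apply/funext => x; rewrite /cp_scale mulN1r. Qed.

Lemma psiN a g : L a -> psi (cp_opp a) g = - psi a g.
Proof. by move=> La; rewrite cp_oppE psiZ// mulN1r. Qed.

Lemma psi0 g : psi 0_L g = 0.
Proof. by rewrite (@psi_seq [::])// big_nil. Qed.

Lemma act_istar s x : pdom th s x -> dom s (act (istar s) x) /\ act s (act (istar s) x) = x.
Proof. exact: pmap_inv'. Qed.

Lemma act_star_compopen s V : compopen V -> V `<=` pdom th s ->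
  compopen (act (istar s) @` V) /\ act (istar s) @` V `<=` dom s.
Proof.
move=> cV Vs; split.
  by apply: (act_compopen (s := istar s)) => // x /Vs sx; apply/dom_star.
by move=> _ [x /Vs sx <-]; have [] := act_istar sx.
Qed.

(** Coefficients live on the range side while [germ_basic] is indexed by sources, so [V] is pulled
    back by the action of [istar s]. *)
Lemma psi_term_ind s V c f : V `<=` pdom th s -> (forall x, V x -> f x = c) ->
  psi_term s (fcut V f) = fun g => c * ind R (germ_basic th s (act (istar s) @` V)) g.
Proof.
move=> Vs fc; apply/funext => g; case: (pselect (full_bis s g)) => sg; last first.
  rewrite psi_term_out// ind0 ?mulr0// => -[_ [x /Vs sx <-] gx]; apply: sg.
  by exists (act (istar s) x) => //; have [] := act_istar sx.
have [y sy gy] := sg; subst g; rewrite (psi_term_in _ sg (grng_germ sy)).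
case: (pselect (V (act s y))) => Vy.
  rewrite fcut_in// fc// indE ?mulr1//; exists y => //.
  by exists (act s y) => //; exact: actK.
rewrite fcut_out// ind0 ?mulr0// => -[_ [x Vx <-]].
have [sx xE] := act_istar (Vs _ Vx).
by move=> /(eq_germP _ _ sx)[yx _]; apply: Vy; rewrite -yx xE.
Qed.

(** Cut [f] into pieces on which it is constant; each contributes a multiple of the indicator of a
    compact open bisection. *)
Lemma psi_term_steinberg s f : Dual th s f -> steinberg R G (psi_term s f).
Proof.
move=> sf; have lf := Dual_loc_const sf; rewrite -(fcut_nz f).
apply: (co_ind hX bX (P := fun V => steinberg R G (psi_term s (fcut V f))) (Dual_compopen sf)).
- rewrite fcut0 (_ : psi_term _ _ = fun _ => 0); first exact: steinberg0.
  by apply/funext => g; rewrite psi_term0.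
- move=> V W _ _ VW sV sW; rewrite fcutU//.
  rewrite (_ : psi_term _ _ = fun g => psi_term s (fcut V f) g + psi_term s (fcut W f) g).
    exact: steinbergD.
  by apply/funext => g; rewrite psi_termD.
- move=> x fx; have : nbhs x [set y | f y = f x] := lf x.
  rewrite nbhsE => -[U [oU Ux] fU]; exists U => // V cV VU Vf.
  have Vs : V `<=` pdom th s by move=> y /Vf; exact: Dual_pdom.
  rewrite (psi_term_ind Vs (c := f x)); last by move=> y /VU/fU.
  apply: steinbergZ; apply: steinberg_ind.
  by have [cA As] := act_star_compopen cV Vs; exact: germ_basic_cobis.
Qed.

Lemma psi_steinberg a : L a -> steinberg R G (psi a).
Proof.
move=> La; have [r ur ra] := cpL_seq La.
rewrite (_ : psi a = fun g => \sum_(s <- r) psi_term s (a s) g).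
  by apply: (@steinberg_sum R G {classic S}) => s; apply: psi_term_steinberg; exact: cpL_Dual.
by apply/funext => g; exact: psi_seq.
Qed.

End CrossedProduct.
Arguments full_bis {S X} th s.
Arguments psi_term {R S X} th s f.
Arguments psi {R S X} th a.

Section FiniteSumExchange.
Variables (R : nmodType) (I J : Type).

(** The list [k j] contains the support of [F j] within [A]. All inner sums can then be taken over
    one common list [K], where exchanging two finite sums is the ordinary rule. *)
Lemma fsum_sum (A : set I) (r : seq J) (F : J -> I -> R) (k : J -> seq {classic I}) :
  (forall j (i : {classic I}), A i -> i \notin k j -> F j i = 0) ->
  fsum A (fun i => \sum_(j <- r) F j i) = \sum_(j <- r) fsum A (F j).
Proof.
move=> F0; pose K : seq {classic I} :=
  @undup {classic I} (seq.filter (fun i => `[< A i >]) (flatten (map k r))).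
have KA (i : {classic I}) : i \in K -> A i.
  by rewrite mem_undup mem_filter => /andP[/asboolP].
have FK j : {subset k j <= flatten (map k r)} ->
    fsum A (F j) = \sum_(i <- K) F j i.
  move=> kr; apply: fsum_seq => //; first exact: undup_uniq.
  move=> i Ai iK; apply: F0 => //; apply: contra iK => /kr ik.
  by rewrite mem_undup mem_filter ik andbT; apply/asboolP.
(* The induction runs over [r'] while [K], built from [r], stays fixed. *)
have E r' : {subset flatten (map k r') <= flatten (map k r)} ->
    \sum_(j <- r') fsum A (F j) = \sum_(j <- r') \sum_(i <- K) F j i.
  elim: r' => [|j r' IH] sub; first by rewrite !big_nil.
  rewrite !big_cons IH; last by move=> i ir; apply: sub; rewrite /= mem_cat ir orbT.
  by rewrite FK// => i ij; apply: sub; rewrite /= mem_cat ij.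
rewrite E// exchange_big /=; apply: fsum_seq => //; first exact: undup_uniq.
move=> i Ai iK; have : i \notin flatten (map k r).
  by apply: contra iK => ik; rewrite mem_undup mem_filter ik andbT; apply/asboolP.
elim: (r) => [|j r' IH]; first by rewrite big_nil.
by rewrite /= mem_cat => /norP[/F0 Fj /IH]; rewrite big_cons Fj// add0r.
Qed.

End FiniteSumExchange.

(** * Multiplicativity of the map to the Steinberg algebra *)

Section CrossedProductMul.
Variables (R : comNzRingType) (S : invSemigroup) (X : topologicalType) (th : partial_action S X).
Hypotheses (hX : hausdorff_space X) (bX : co_base X).
Implicit Types (s t : S) (f h : X -> R) (V : set X) (a b : S -> X -> R).
Local Notation dom s := (pdom th (istar s)).
Local Notation act s := (Defs.pmap th s).
Local Notation G := (germ_groupoid th).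
Local Notation L := (@cpL R S X th).

(* The coefficient of (f delta_s)(h delta_t). *)
Definition cp_term s f h : X -> R :=
  fun x => if `[< pdom th s x >] then f x * h (act (istar s) x) else 0.

Lemma cp_termE s f h : cp_term s f h =
  dual_act R S X th s (fun y => dual_act R S X th (istar s) f y * h y).
Proof.
apply/funext => x; rewrite /cp_term /dual_act; case: asboolP => // sx.
have [sx' sxx] := act_istar sx.
by rewrite asboolT// istarK sxx.
Qed.

Lemma cp_term_in s f h x : pdom th s x -> cp_term s f h x = f x * h (act (istar s) x).
Proof. by move=> sx; rewrite /cp_term asboolT. Qed.

Lemma cp_term_out s f h x : ~ pdom th s x -> cp_term s f h x = 0.
Proof. by move=> sx; rewrite /cp_term asboolF. Qed.

Lemma cp_term_Dual s t f h : Dual th s f -> Dual th t h -> Dual th (imul s t) (cp_term s f h).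
Proof.
move=> sf th'; have lf := Dual_loc_const sf; have lh := Dual_loc_const th'.
have [cf _] := Dual_compopen sf.
apply: (Dual_intro (K := nz f)) => // x.
(* Off X_s the function [f] vanishes at [x], hence near [x], and so does the product, even at nearby
   points of X_s. *)
- case: (pselect (pdom th s x)) => sx; last first.
    have fx : f x = 0 by apply: contrapT => /eqP/(Dual_pdom sf).
    apply: filterS (lf x) => y fy; rewrite (cp_term_out _ _ sx).
    case: (pselect (pdom th s y)) => sy; last by rewrite cp_term_out.
    by rewrite cp_term_in// fy fx mul0r.
  have sx' : dom (istar s) x by apply/dom_star.
  have := near_act sx' (lh (act (istar s) x)).
  have sn : \forall y \near x, pdom th s y.
    by apply: open_nbhs_nbhs; split => //; exact: pdom_open.
  by apply: filterS3 (lf x) sn => y fy sy hy; rewrite !cp_term_in// fy hy.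
- rewrite /nz /=; case: (pselect (pdom th s x)) => sx; last by rewrite cp_term_out ?eqxx.
  by rewrite cp_term_in//; apply: contra_neq => ->; rewrite mul0r.
- rewrite /nz /=; case: (pselect (pdom th s x)) => sx; last by rewrite cp_term_out ?eqxx.
  rewrite cp_term_in// => fh.
  have tx : pdom th t (act (istar s) x).
    by apply: (Dual_pdom th'); apply: contra_neq fh => ->; rewrite mulr0.
  have [sy sxE] := act_istar sx; have [ty txE] := act_istar tx.
  have st : dom (imul s t) (act (istar t) (act (istar s) x)) by apply: dom_mul => //; rewrite txE.
  by apply/dom_star; have := act_star st; rewrite act_mul// txE// sxE.
Qed.

Lemma cpL_sum (I : Type) (r : seq I) (F : I -> S -> X -> R) : (forall i, L (F i)) ->
  L (fun u x => \sum_(i <- r) F i u x).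
Proof.
move=> LF; elim: r => [|i r IH].
  rewrite (_ : (fun _ _ => _) = fun _ _ => 0); first exact: cpL0.
  by apply/funext => u; apply/funext => x; rewrite big_nil.
rewrite (_ : (fun _ _ => _) = cp_add (F i) (fun u x => \sum_(j <- r) F j u x)).
  exact: cpL_add.
by apply/funext => u; apply/funext => x; rewrite big_cons.
Qed.

Lemma psi_sum (I : Type) (r : seq I) (F : I -> S -> X -> R) g : (forall i, L (F i)) ->
  psi th (fun u x => \sum_(i <- r) F i u x) g = \sum_(i <- r) psi th (F i) g.
Proof.
move=> LF; elim: r => [|i r IH].
  rewrite big_nil (_ : (fun _ _ => _) = fun _ _ => 0) ?psi0//.
  by apply/funext => u; apply/funext => x; rewrite big_nil.
rewrite big_cons -IH -psiD//; last exact: cpL_sum.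
by congr psi; apply/funext => u; apply/funext => x; rewrite big_cons.
Qed.

Lemma cp_mul_seq (ra rb : seq {classic S}) a b : uniq ra -> uniq rb ->
  supp_in ra a -> supp_in rb b ->
  cp_mul th a b = fun u x => \sum_(s <- ra) \sum_(t <- rb)
    delta (imul s t) (cp_term s (a s) (b t)) u x.
Proof.
move=> ua ub sa sb; apply/funext => u; apply/funext => x; rewrite /cp_mul.
pose pr : seq {classic S * S} := [seq ((s, t) : {classic S * S}) | s <- ra, t <- rb].
have upr : uniq pr.
  apply: (@allpairs_uniq {classic S} {classic S} {classic S * S} (fun s t => (s, t))) => //.
  by move=> [s t] [s' t'] _ _ [-> ->].
have prP (s t : {classic S}) : s \in ra -> t \in rb -> ((s, t) : {classic S * S}) \in pr.
  exact: (@allpairs_f {classic S} {classic S} {classic S * S} (fun s t => (s, t))).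
rewrite (@fsum_seq _ _ _ [seq p <- pr | `[< imul p.1 p.2 = u >]]).
- rewrite big_filter big_mkcond /= big_allpairs; apply: eq_bigr => s _; apply: eq_bigr => t _ /=.
  rewrite -cp_termE; case: asboolP => [<-|st]; first by rewrite delta_in.
  by rewrite delta_out// => us; apply: st.
- by rewrite filter_uniq.
- by move=> p; rewrite mem_filter => /andP[/asboolP].
- move=> [s t] /= st; rewrite mem_filter asboolT//= -cp_termE => npr.
  case: (boolP ((s : {classic S}) \in ra)) => [sr|/sa ->]; last first.
    by rewrite /cp_term mul0r; case: ifP.
  case: (boolP ((t : {classic S}) \in rb)) => [tr|/sb ->]; first by rewrite prP in npr.
  by rewrite /cp_term mulr0; case: ifP.
Qed.

Lemma cpL_mul a b : L a -> L b -> L (cp_mul th a b).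
Proof.
move=> La Lb; have [ra ua sa] := cpL_seq La; have [rb ub sb] := cpL_seq Lb.
rewrite (cp_mul_seq ua ub sa sb).
apply: (@cpL_sum {classic S}) => s; apply: (@cpL_sum {classic S}) => t.
by apply: cpL_delta; apply: cp_term_Dual; exact: cpL_Dual.
Qed.

(** By injectivity of theta_s, the only germ of [s] with range [y] is the one at the preimage of
    [y]; the convolution sum reduces to it. *)
Lemma conv_psi_term s f (v : gcar G -> R) g y : garr G g -> grng G g = unit_germ th y ->
  conv (psi_term th s f) v g =
  if `[< pdom th s y >] then f y * v (gmul G (germ th (istar s) y) g) else 0.
Proof.
move=> gG gy; rewrite /conv asboolT//; case: asboolP => sy; last first.
  apply: fsbig1 => k [kG kr]; rewrite psi_term_out ?mul0r// => /full_bis_rng[x sx kx].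
  by apply: sy; have /unit_germ_inj <- : unit_germ th x = unit_germ th y by rewrite -kx kr.
have [sy' sE] := act_istar sy; set z := act (istar s) y in sy' sE *.
have zb : full_bis th s (germ th s z) by exists z.
rewrite (fsum1 (i := germ th s z)).
- rewrite (psi_term_in _ zb (grng_germ sy')) sE ginv_germ// sE//.
- by split; [exact: garr_germ|rewrite grng_germ// sE].
- move=> k [kG kr] kz; rewrite psi_term_out ?mul0r// => -[x sx xk]; apply: kz.
  rewrite -xk; congr germ; apply: (act_inj sx sy'); rewrite sE.
  by apply: (@unit_germ_inj _ _ th); rewrite -grng_germ// xk kr.
Qed.

(** Where [h] does not vanish, [g] is a germ of st exactly when it becomes a germ of [t] after
    division on the left by the germ of [s] with range [y]. *)
Lemma psi_term_mul s t f h g y : garr G g -> grng G g = unit_germ th y ->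
  pdom th s y -> Dual th t h ->
  psi_term th (imul s t) (cp_term s f h) g =
  f y * psi_term th t h (gmul G (germ th (istar s) y) g).
Proof.
move=> gG gy sy Dh; have [sy' sE] := act_istar sy; set z := act (istar s) y in sy' sE *.
have sy2 : dom (istar s) y by apply/dom_star.
have kG : garr G (germ th (istar s) y) by exact: garr_germ.
have kg : gsrc G (germ th (istar s) y) = grng G g by rewrite gsrc_germ.
have [mG ms mr] := gmulP kG gG kg; rewrite grng_germ// -/z in mr.
(* If h(z) = 0 both sides are 0, whichever germs occur; otherwise [z] lies in X_t and can be pulled
   back to a point [w] of the domain of st. *)
case: (eqVneq (h z) 0) => hz.
  transitivity (0 : R).
    case: (pselect (full_bis th (imul s t) g)) => stg; last by rewrite psi_term_out.
    by rewrite (psi_term_in _ stg gy) cp_term_in// -/z hz mulr0.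
  case: (pselect (full_bis th t (gmul G (germ th (istar s) y) g))) => tg.
    by rewrite (psi_term_in _ tg mr) hz mulr0.
  by rewrite psi_term_out// mulr0.
have tz := Dual_pdom Dh hz; have [tw wE] := act_istar tz.
set w := act (istar t) z in tw wE *.
have stw : dom (imul s t) w by apply: dom_mul => //; rewrite wE.
have stE : act (imul s t) w = y by rewrite act_mul ?wE.
have E : full_bis th (imul s t) g <-> full_bis th t (gmul G (germ th (istar s) y) g).
  have stg := gmul_germ tw; have zs : dom s (act t w) by rewrite wE.
  split=> [[x stx xg]|[x tx xE]].
    have xw : x = w.
      apply: (act_inj stx stw); rewrite stE; apply: (@unit_germ_inj _ _ th).
      by rewrite -grng_germ// xg gy.
    exists w => //; rewrite -xg xw -(gmul_germ tw zs).
    have -> : germ th (istar s) y = ginv G (germ th s (act t w)).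
      by rewrite ginv_germ// wE sE.
    by rewrite gmulKV//; [exact: garr_germ|exact: garr_germ|rewrite gsrc_germ// grng_germ].
  have xw : x = w.
    apply: (act_inj tx tw); rewrite wE; apply: (@unit_germ_inj _ _ th).
    by rewrite -grng_germ// xE mr.
  exists w => //; rewrite -(gmul_germ tw zs) -xw xE xw wE.
  have -> : germ th (istar s) y = ginv G (germ th s z) by rewrite ginv_germ// sE.
  by rewrite gmulVK//; [exact: garr_germ|rewrite grng_germ// sE gy].
case: (pselect (full_bis th (imul s t) g)) => stg.
  rewrite (psi_term_in _ stg gy) cp_term_in// (psi_term_in _ _ mr)//.
  exact/E.
by rewrite !psi_term_out ?mulr0// => /E.
Qed.

Lemma psiM a b : L a -> L b -> psi th (cp_mul th a b) = conv (psi th a) (psi th b).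
Proof.
move=> La Lb; apply/funext => g.
have [ra ua sa] := cpL_seq La; have [rb ub sb] := cpL_seq Lb.
have LT s t : L (delta (imul s t) (cp_term s (a s) (b t))).
  by apply: cpL_delta; apply: cp_term_Dual; exact: cpL_Dual.
case: (pselect (garr G g)) => gG; last first.
  rewrite (steinberg_garr (psi_steinberg hX bX (cpL_mul La Lb)))//.
  by rewrite /conv asboolF.
have [y gy] : exists y, grng G g = unit_germ th y.
  by move: g gG; apply: garr_ind => s x sx; exists (act s x); rewrite grng_germ.
have -> : conv (psi th a) (psi th b) g = \sum_(s <- ra) conv (psi_term th s (a s)) (psi th b) g.
  rewrite /conv asboolT//.
  rewrite (_ : (fun k => _) = fun k => \sum_(s <- ra)
    (psi_term th s (a s) k * psi th b (gmul G (ginv G k) g))); last first.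
    by apply/funext => k; rewrite (psi_seq _ ua sa) mulr_suml.
  (* For each [s] at most one arrow with range [y] is a germ of [s], so a singleton lists the
     support. *)
  apply: (@fsum_sum _ _ {classic S} _ _ _
    (fun s => [:: (germ th s (act (istar s) y) : {classic _})])).
  move=> s k [kG kr]; rewrite inE => /eqP ks; rewrite psi_term_out ?mul0r// => -[x sx xk].
  apply: ks; rewrite -xk; congr germ.
  have <- : act s x = y by apply: (@unit_germ_inj _ _ th); rewrite -grng_germ// xk kr.
  by rewrite actK.
rewrite (cp_mul_seq ua ub sa sb) (@psi_sum {classic S}); last first.
  by move=> s; exact: (@cpL_sum {classic S}).
apply: eq_bigr => s _; rewrite (@psi_sum {classic S})// (conv_psi_term _ _ _ gG gy).
case: asboolP => sy.
  rewrite (psi_seq _ ub sb) mulr_sumr; apply: eq_bigr => t _.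
  by rewrite psi_delta; apply: psi_term_mul => //; exact: cpL_Dual.
rewrite big1// => t _; rewrite psi_delta.
case: (pselect (full_bis th (imul s t) g)) => stg; last by rewrite psi_term_out.
by rewrite (psi_term_in _ stg gy) cp_term_out.
Qed.

Lemma steinberg_conv_psi a b : L a -> L b -> steinberg R G (conv (psi th a) (psi th b)).
Proof. by move=> La Lb; rewrite -psiM//; apply: psi_steinberg => //; exact: cpL_mul. Qed.

End CrossedProductMul.

(** * Kernel and image of the map to the Steinberg algebra *)

Section CrossedProductQuotient.
Variables (R : comNzRingType) (S : invSemigroup) (X : topologicalType) (th : partial_action S X).
Hypotheses (hX : hausdorff_space X) (bX : co_base X).
Implicit Types (s t : S) (f h : X -> R) (V : set X) (a b : S -> X -> R).
Local Notation dom s := (pdom th (istar s)).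
Local Notation act s := (Defs.pmap th s).
Local Notation G := (germ_groupoid th).
Local Notation L := (@cpL R S X th).
Local Notation N := (@cpN R S X th).
Local Notation sub a b := (cp_add a (cp_opp b)).

(** A germ of [s] at whose range [f] is nonzero has its range in X_r, and there [s] and its
    restriction [r] have the same germ. *)
Lemma psi_delta_le r s f : isg_le r s -> Dual th r f -> psi_term th r f = psi_term th s f.
Proof.
move=> rs rf; apply/funext => g; case: (pselect (full_bis th s g)) => sg; last first.
  rewrite (psi_term_out _ sg) psi_term_out// => -[x rx xg]; apply: sg.
  exists x; first exact: dom_le rx.
  rewrite -xg; apply/eq_germP; first exact: dom_le rx.
  by split => //; exists r; split => //; exact: isg_le_refl.
have [x sx xg] := sg; have gx : grng G g = unit_germ th (act s x) by rewrite -xg grng_germ.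
rewrite (psi_term_in _ sg gx); case: (eqVneq (f (act s x)) 0) => fx.
  rewrite fx; case: (pselect (full_bis th r g)) => rg; last by rewrite psi_term_out.
  by rewrite (psi_term_in _ rg gx).
have [ry rE] := act_istar (Dual_pdom rf fx).
have sr : dom s (act (istar r) (act s x)) by exact: dom_le ry.
have xE : act (istar r) (act s x) = x by apply: (act_inj sr sx); rewrite -(act_le rs ry) rE.
rewrite (psi_term_in (s := r) _ _ gx)//; exists x; first by rewrite -xE.
rewrite -xg; apply/eq_germP; first by rewrite -xE.
by split => //; exists r; split => //; [exact: isg_le_refl|rewrite -xE].
Qed.

Lemma conv0l (v : gcar G -> R) : conv (fun _ => 0) v = fun _ => 0.
Proof.
apply/funext => g; rewrite /conv; case: asboolP => // gG.
by apply: fsbig1 => k _; rewrite mul0r.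
Qed.

Lemma conv0r (v : gcar G -> R) : conv v (fun _ => 0) = fun _ => 0.
Proof.
apply/funext => g; rewrite /conv; case: asboolP => // gG.
by apply: fsbig1 => k _; rewrite mulr0.
Qed.

Lemma psi_ker_ideal : cp_ideal R S X th [set a | L a /\ psi th a = fun _ => 0].
Proof.
split.
- by move=> a [].
- by split; [exact: cpL0|apply/funext => g; exact: psi0].
- move=> a b [La a0] [Lb b0]; split; first exact: cpL_add.
  by apply/funext => g; rewrite psiD// a0 b0 addr0.
- move=> a [La a0]; split; first exact: cpL_opp.
  by apply/funext => g; rewrite psiN// a0 oppr0.
- move=> a b La [Lb b0]; split; split; try exact: cpL_mul.
    by rewrite psiM// b0 conv0r.
  by rewrite psiM// b0 conv0l.
Qed.

(** [cpN] is the smallest ideal containing the relations, and the kernel of [psi] is such an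
    ideal. *)
Lemma cpN_ker a : N a -> L a /\ psi th a = fun _ => 0.
Proof.
move=> /(_ _ psi_ker_ideal); apply => r s f rs rf.
have sf := Dual_le rs rf; have Lr := cpL_delta rf; have Ls := cpL_delta sf.
split; first by apply: cpL_add => //; exact: cpL_opp.
apply/funext => g; rewrite psiD//; last exact: cpL_opp.
by rewrite psiN// !psi_delta (psi_delta_le rs rf) subrr.
Qed.

Lemma cpN0 : N (fun _ _ => 0).
Proof. by move=> I [_ I0]. Qed.

Lemma cpN_add a b : N a -> N b -> N (cp_add a b).
Proof. by move=> Na Nb I hI rI; have [_ _ hD _ _] := hI; apply: hD; [exact: Na|exact: Nb]. Qed.

Lemma cpN_opp a : N a -> N (cp_opp a).
Proof. by move=> Na I hI rI; have [_ _ _ hN _] := hI; apply: hN; exact: Na. Qed.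

Lemma cpN_rel r s f : isg_le r s -> Dual th r f -> N (sub (delta r f) (delta s f)).
Proof. by move=> rs rf I hI rI; exact: rI. Qed.

Lemma cp_funext a b : (forall s x, a s x = b s x) -> a = b.
Proof. by move=> ab; apply/funext => s; apply/funext => x. Qed.

(* The germ of a_s0 delta_s0 at a point where psi a vanishes is cancelled by
   another term a_s delta_s, so modulo N it can locally be moved to the index s. *)
Lemma delta_move (s0 : S) (r : seq {classic S}) a : uniq ((s0 : {classic S}) :: r) -> L a ->
  supp_in ((s0 : {classic S}) :: r) a -> psi th a = (fun _ => 0) ->
  exists b, [/\ L b, supp_in r b & N (sub (delta s0 (a s0)) b)].
Proof.
move=> us La sa a0; have Da := cpL_Dual s0 La; have lf := Dual_loc_const Da.
rewrite -(fcut_nz (a s0)).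
apply: (co_ind hX bX (P := fun V => exists b, [/\ L b, supp_in r b &
  N (sub (delta s0 (fcut V (a s0))) b)]) (Dual_compopen Da)).
- exists (fun _ _ => 0); split => //; first exact: cpL0.
  rewrite (_ : sub _ _ = fun _ _ => 0); first exact: cpN0.
  apply: cp_funext => s x; rewrite /cp_add /cp_opp subr0 fcut0.
  by case: (pselect (s = s0)) => [->|ss]; rewrite ?delta_in// delta_out.
- move=> V W cV cW VW [b [Lb sb Nb]] [c [Lc sc Nc]]; exists (cp_add b c); split.
  + exact: cpL_add.
  + by move=> s sr; apply/funext => x; rewrite /cp_add sb// sc// addr0.
  + rewrite fcutU// deltaD (_ : sub _ _ =
      cp_add (sub (delta s0 (fcut V (a s0))) b) (sub (delta s0 (fcut W (a s0))) c)).
      exact: cpN_add.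
    by apply: cp_funext => s x; rewrite /cp_add /cp_opp opprD addrACA.
- move=> x fx; have [sx sE] := act_istar (Dual_pdom Da fx).
  set z := act (istar s0) x in sx sE.
  have sg : full_bis th s0 (germ th s0 z) by exists z.
  have gx : grng G (germ th s0 z) = unit_germ th x by rewrite grng_germ// sE.
  have [s [sr tg]] : exists s : {classic S}, s \in r /\ full_bis th s (germ th s0 z).
    apply: contrapT => nex; have := congr1 (fun u => u (germ th s0 z)) a0.
    rewrite /= (psi_seq _ us sa) big_cons (psi_term_in _ sg gx) big1_seq ?addr0.
      by move/eqP; rewrite (negbTE fx).
    move=> s /= sr; rewrite psi_term_out// => tg; apply: nex.
    by exists s.
  have [u [us' us0 uz]] := (full_bis_germ s sx).1 tg.
  exists (pdom th u); first split; first exact: pdom_open.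
    by apply/dom_star; rewrite -sE -(act_le us0)//; exact: act_star.
  move=> V cV Vu Vf; have Du : Dual th u (fcut V (a s0)) by exact: Dual_fcut.
  have Ds : Dual th s (fcut V (a s0)) by exact: Dual_le Du.
  exists (delta s (fcut V (a s0))); split.
  + exact: cpL_delta.
  + by move=> t tr; apply: delta_out => ts; rewrite ts sr in tr.
  (* The indices [s0] and [s] need not be comparable; the move passes through their common lower
     bound [u], whose range contains [V]. *)
  + rewrite (_ : sub _ _ = cp_add (sub (delta u (fcut V (a s0))) (delta s (fcut V (a s0))))
      (cp_opp (sub (delta u (fcut V (a s0))) (delta s0 (fcut V (a s0)))))).
      by apply: cpN_add; [|apply: cpN_opp]; exact: cpN_rel.
    apply: cp_funext => t y; rewrite /cp_add /cp_opp opprD opprK.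
    by rewrite [RHS]addrACA subrr add0r addrC.
Qed.

(** Induction on a list of indices supporting [a]: [delta_move] shifts the first term onto the
    remaining indices by an element of N, which does not change the value of [psi]. *)
Lemma psi_ker_cpN a : L a -> psi th a = (fun _ => 0) -> N a.
Proof.
move=> La; have [r ur sa] := cpL_seq La; elim: r ur a La sa => [|s0 r IH] ur a La sa a0.
  rewrite (_ : a = fun _ _ => 0); first exact: cpN0.
  by apply: cp_funext => s x; rewrite sa.
have [b [Lb sb Nb]] := delta_move ur La sa a0.
have Ld : L (delta s0 (a s0)) by apply: cpL_delta; exact: cpL_Dual.
have Lsub : L (sub (delta s0 (a s0)) b) by apply: cpL_add => //; exact: cpL_opp.
have aE : a = cp_add (sub a (sub (delta s0 (a s0)) b)) (sub (delta s0 (a s0)) b).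
  by apply: cp_funext => s x; rewrite /cp_add /cp_opp subrK.
rewrite aE; apply: cpN_add => //; apply: IH.
- by move: ur => /= /andP[].
- by apply: cpL_add => //; exact: cpL_opp.
- move=> s sr; apply/funext => x; rewrite /cp_add /cp_opp sb// subr0.
  case: (pselect (s = s0)) => [->|ss]; first by rewrite delta_in subrr.
  rewrite delta_out// subr0 sa// inE negb_or sr andbT; exact/eqP.
- apply/funext => g; rewrite psiD//; last exact: cpL_opp.
  by rewrite psiN// a0 (cpN_ker Nb).2 subr0.
Qed.

Lemma cpN_psi a b : L a -> L b -> N (sub a b) <-> psi th a = psi th b.
Proof.
move=> La Lb; have Ls : L (sub a b) by apply: cpL_add => //; exact: cpL_opp.
have E g : psi th (sub a b) g = psi th a g - psi th b g.
  by rewrite psiD ?psiN//; exact: cpL_opp.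
split=> [/cpN_ker[_ ab]|ab].
  by apply/funext => g; apply/eqP; rewrite -subr_eq0 -E ab.
by apply: psi_ker_cpN => //; apply/funext => g; rewrite E ab subrr.
Qed.

Lemma psi_basic s V : compopen V -> V `<=` dom s ->
  exists2 a, L a & psi th a = ind R (germ_basic th s V).
Proof.
move=> cV Vs; have cA := act_compopen cV Vs.
have As : act s @` V `<=` pdom th s.
  by move=> _ [x /Vs sx <-]; apply/dom_star; exact: act_star.
have D1 : Dual th s (fcut (act s @` V) (fun _ => 1 : R)).
  by apply: Dual_fcut => // x; apply: filterS filterT.
exists (delta s (fcut (act s @` V) (fun _ => 1))); first exact: cpL_delta.
apply/funext => g; rewrite psi_delta (psi_term_ind As (c := 1))// mul1r.
congr (ind R (germ_basic th s _) g); apply/seteqP; split.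
  by move=> _ [_ [x Vx <-] <-]; rewrite actK//; exact: Vs.
by move=> x Vx; exists (act s x); [exists x|rewrite actK//; exact: Vs].
Qed.

(** Cut the source of [U] into compact open pieces so small that above each of them [U] is a single
    bisection [s,V]. *)
Lemma psi_ind U : cobis G U -> exists2 a, L a & psi th a = ind R U.
Proof.
move=> cU; have [oU [_ [Ua Us _]]] := cU.
have -> : U = [set g | U g /\ exists2 x, src_set th U x & gsrc G g = unit_germ th x].
  apply/seteqP; split=> [g Ug|g []//]; split => //.
  by have [x gx] := arr_unit (Ua _ Ug); exists x => //; exists g.
apply: (co_ind hX bX (P := fun V => exists2 a, L a &
  psi th a = ind R [set g | U g /\ exists2 x, V x & gsrc G g = unit_germ th x]) (src_set_cobis cU)).
- exists (fun _ _ => 0); first exact: cpL0.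
  by apply/funext => g; rewrite psi0 ind0// => -[_ []].
- move=> V W cV cW VW [a La aV] [b Lb bW]; exists (cp_add a b); first exact: cpL_add.
  apply/funext => g; rewrite psiD// aV bW.
  case: (pselect (U g /\ exists2 x, V x & gsrc G g = unit_germ th x)) => gV.
    rewrite [RHS]indE; last by case: gV => Ug [x Vx gx]; split => //; exists x => //; left.
    rewrite [X in X + _]indE//.
    rewrite ind0 ?addr0// => -[_ [x Wx gx]]; case: gV => _ [y Vy].
    rewrite gx => /unit_germ_inj xy; subst y.
    by have : (V `&` W) x by []; rewrite VW.
  rewrite [X in X + _]ind0// add0r; apply: eq_ind; split=> -[Ug [x Vx gx]]; split => //.
    by exists x => //; right.
  by case: Vx => [Vx|Wx]; [case: gV; split => //|]; exists x.
- move=> x [g Ug gx]; have [s sx gs] := arr_at (Ua _ Ug) gx; subst g.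
  have /gopenP[_ /(_ _ _ sx Ug) nU] := oU.
  exists ([set y | dom s y /\ U (germ th s y)]°); first split; first exact: open_interior.
    by apply: filterS2 (near_dom sx) nU.
  move=> V cV /(subset_trans)/(_ (@interior_subset _ _)) VU _.
  have Vs : V `<=` dom s by move=> y /VU[].
  have [a La aE] := psi_basic cV Vs; exists a => //; rewrite aE.
  congr (ind R); apply/seteqP; split=> [_ [y Vy <-]|h [Uh [y Vy hy]]].
    have [sy Uy] := VU _ Vy; split => //; exists y => //; exact: gsrc_germ.
  have [sy Uy] := VU _ Vy; exists y => //.
  by apply: Us; rewrite ?inE// hy gsrc_germ.
Qed.

Lemma psi_surj (f : gcar G -> R) : steinberg R G f -> exists2 a, L a & psi th a = f.
Proof.
move=> [n [c [U [cU ->]]]].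
have /choice[a aP] : forall i, exists a, L a /\ psi th a = ind R (U i).
  by move=> i; have [a La aE] := psi_ind (cU i); exists a.
exists (fun u x => \sum_(i < n) cp_scale (c i) (a i) u x).
  by apply: cpL_sum => i; apply: cpL_scale; case: (aP i).
apply/funext => g; rewrite psi_sum; last by move=> i; apply: cpL_scale; case: (aP i).
by apply: eq_bigr => i _; have [La aE] := aP i; rewrite psiZ// aE.
Qed.

Lemma cpDiag0_psi d : cpDiag0 th d -> L d /\ steinberg_diag R G (psi th d).
Proof.
move=> hd; suff [Ld dd] : L d /\ forall g, psi th d g != 0 -> gunits G g.
  by split => //; split => //; exact: psi_steinberg.
apply: (hd [set d | L d /\ forall g, psi th d g != 0 -> gunits G g]).
- by split; [exact: cpL0|move=> g; rewrite psi0 eqxx].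
- move=> a b [La da] [Lb db]; split; first exact: cpL_add.
  move=> g; rewrite psiD//; case: (eqVneq (psi th a g) 0) => [->|/da//].
  by rewrite add0r => /db.
- move=> a [La da]; split; first exact: cpL_opp.
  by move=> g; rewrite psiN// oppr_eq0 => /da.
- move=> e f ee ef; split; first exact: cpL_delta.
  move=> g; rewrite psi_delta; case: (pselect (full_bis th e g)) => eg.
    by move=> _; have [x ex <-] := eg; apply/gunitsP; exists x; exact: germ_idem.
  by rewrite psi_term_out// eqxx.
Qed.

Hypothesis hG : groupoid_hausdorff G.

(** Each sufficiently small piece of the support of [f] lies in the domain of one idempotent [e] and
    is represented by a single term with index [e]. Comparison on units is enough, since both
    functions vanish elsewhere. *)
Lemma psi_diag_surj (f : gcar G -> R) :
  steinberg_diag R G f -> exists2 d, cpDiag0 th d & psi th d = f.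
Proof.
move=> [sf df]; pose f0 x := f (unit_germ th x).
have lf : loc_const f0 by move=> x; exact: steinberg_near_unit.
have cN : compopen (nz f0) := steinberg_unit_supp hG sf.
suff [d Dd dE] : exists2 d, cpDiag0 th d &
    forall x, psi th d (unit_germ th x) = fcut (nz f0) f0 x.
  exists d => //; apply/funext => g; have [Ld [_ dd]] := cpDiag0_psi Dd.
  case: (pselect (gunits G g)) => [/gunitsP[x ->]|ng]; first by rewrite dE fcut_nz.
  have -> : f g = 0 by apply: contrapT => /eqP/df.
  by apply: contrapT => /eqP/dd.
apply: (co_ind hX bX (P := fun V => exists2 d, cpDiag0 th d &
  forall x, psi th d (unit_germ th x) = fcut V f0 x) cN).
- exists (fun _ _ => 0); first by move=> I.
  by move=> x; rewrite psi0 fcut0.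
- move=> V W _ _ VW [d Dd dE] [d' Dd' dE']; exists (cp_add d d').
    by move=> I I0 ID IN Id; apply: (ID); [exact: Dd|exact: Dd'].
  have [Ld _] := cpDiag0_psi Dd; have [Ld' _] := cpDiag0_psi Dd'.
  by move=> x; rewrite psiD// dE dE' fcutU.
- move=> x _; have [e ee ex] := idem_at th x; exists (dom e).
    by split => //; exact: dom_open.
  rewrite (idem_star ee) => V cV Ve _; have De := Dual_fcut hX cV lf Ve.
  exists (delta e (fcut V f0)); first by move=> I I0 ID IN; apply.
  move=> y; rewrite psi_delta; case: (pselect (full_bis th e (unit_germ th y))) => ey.
    by rewrite (psi_term_in _ ey (grng_unit th y)).
  rewrite psi_term_out// fcut_out// => Vy; apply: ey; exists y; last first.
    by apply: germ_idem => //; rewrite (idem_star ee); exact: Ve.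
  by rewrite (idem_star ee); exact: Ve.
Qed.

End CrossedProductQuotient.

(** * Passing between crossed products and Steinberg algebras *)

Section CrossedSteinberg.
Variables (R : comNzRingType) (S T : invSemigroup) (X Y : topologicalType).
Variables (th : partial_action S X) (ga : partial_action T Y) (alg : bool).
Hypotheses (hX : hausdorff_space X) (bX : co_base X) (hG : groupoid_hausdorff (germ_groupoid th)).
Hypotheses (hY : hausdorff_space Y) (bY : co_base Y) (hH : groupoid_hausdorff (germ_groupoid ga)).

(** Conjugate by [psi], using a chosen lift [l] of functions to representatives. The lift is not
    additive or multiplicative; [key] says that the outcome is independent of it, because [psi] has
    kernel exactly N. *)
Lemma steinberg_of_crossed : crossed_diag_iso R alg th ga ->
  steinberg_diag_iso R alg (germ_groupoid th) (germ_groupoid ga).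
Proof.
move=> [P [PL Pinj Psurj PM [Pd Pd' Pz]]].
have /choice[l lP] : forall f, exists a, steinberg R (germ_groupoid th) f ->
    cpL th a /\ psi th a = f.
  move=> f; case: (pselect (steinberg R (germ_groupoid th) f)) => sf.
    by have [a La aE] := psi_surj hX bX sf; exists a.
  by exists (fun _ _ => 0).
have N2 (a b : T -> Y -> R) : cpL ga a -> cpL ga b ->
    cpN ga (cp_add a (cp_opp b)) -> psi ga a = psi ga b.
  by move=> La Lb; move/(cpN_psi hY bY La Lb).
have key a : cpL th a -> psi ga (P (l (psi th a))) = psi ga (P a).
  move=> La; have [Ll lE] := lP _ (psi_steinberg hX bX La).
  by apply: N2; [exact: PL|exact: PL|]; apply/Pinj => //; apply/(cpN_psi hX bX).
exists (fun f => psi ga (P (l f))); split.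
- split=> [f sf|f h|v sv].
  + by apply: psi_steinberg => //; apply: PL; case: (lP _ sf).
  + rewrite !inE => sf sh fh; have [Lf fE] := lP _ sf; have [Lh hE] := lP _ sh.
    rewrite -fE -hE; apply/(cpN_psi hX bX) => //; apply/Pinj => //.
    by apply/(cpN_psi hY bY) => //; exact: PL.
  + have [c Lc cE] := psi_surj hY bY sv; have [a La ac] := Psurj _ Lc.
    exists (psi th a); first exact: psi_steinberg.
    by rewrite key// -cE; apply: N2 => //; exact: PL.
- move=> f h sf sh; have [Lf fE] := lP _ sf; have [Lh hE] := lP _ sh.
  rewrite (_ : (fun g => f g + h g) = psi th (cp_add (l f) (l h))); last first.
    by apply/funext => g; rewrite psiD// fE hE.
  rewrite key; last exact: cpL_add.
  have [E _] := PM _ _ Lf Lh; rewrite (N2 _ _ _ _ E).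
  - by apply/funext => g; rewrite psiD//; exact: PL.
  - by apply: PL; exact: cpL_add.
  - by apply: cpL_add; exact: PL.
- move=> f h sf sh; have [Lf fE] := lP _ sf; have [Lh hE] := lP _ sh.
  rewrite -{1}fE -{1}hE -psiM// key; last exact: cpL_mul.
  have [_ E] := PM _ _ Lf Lh; rewrite (N2 _ _ _ _ E).
  - by rewrite psiM//; exact: PL.
  - by apply: PL; exact: cpL_mul.
  - by apply: cpL_mul => //; exact: PL.
- apply/seteqP; split=> [_ [f df <-]|v dv].
    have [d Dd dE] := psi_diag_surj hX bX hG df; have [Ld _] := cpDiag0_psi hX bX Dd.
    have [d' Dd' /N2 E] := Pd _ Dd; have [Ld' dd'] := cpDiag0_psi hY bY Dd'.
    by rewrite -dE key// E//; exact: PL.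
  have [d Dd dE] := psi_diag_surj hY bY hH dv; have [Ld _] := cpDiag0_psi hY bY Dd.
  have [a Da /N2 E] := Pd' _ Dd; have [La da] := cpDiag0_psi hX bX Da.
  by exists (psi th a) => //; rewrite key// -dE E//; exact: PL.
- move=> /Pz {}Pz r f sf; have [Lf fE] := lP _ sf.
  rewrite (_ : (fun g => r * f g) = psi th (cp_scale r (l f))); last first.
    by apply/funext => g; rewrite psiZ// fE.
  rewrite key; last exact: cpL_scale.
  have E := Pz r _ Lf; rewrite (N2 _ _ _ _ E).
  - by apply/funext => g; rewrite psiZ//; exact: PL.
  - by apply: PL; exact: cpL_scale.
  - by apply: cpL_scale; exact: PL.
Qed.

(** Now the lift [l] is on the target side; the choice is harmless because the conclusion only
    concerns classes modulo N. *)
Lemma crossed_of_steinberg : steinberg_diag_iso R alg (germ_groupoid th) (germ_groupoid ga) ->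
  crossed_diag_iso R alg th ga.
Proof.
move=> [P [[PS Pinj Psurj] PD PM Pd Pz]].
have /choice[l lP] : forall v, exists c, steinberg R (germ_groupoid ga) v ->
    cpL ga c /\ psi ga c = v.
  move=> v; case: (pselect (steinberg R (germ_groupoid ga) v)) => sv.
    by have [c Lc cE] := psi_surj hY bY sv; exists c.
  by exists (fun _ _ => 0).
have sS a : cpL th a -> steinberg R (germ_groupoid th) (psi th a).
  exact: psi_steinberg.
have LE a : cpL th a -> cpL ga (l (P (psi th a))) /\ psi ga (l (P (psi th a))) = P (psi th a).
  by move=> /sS/PS/lP.
have N2 (a b : T -> Y -> R) : cpL ga a -> cpL ga b ->
    psi ga a = psi ga b -> cpN ga (cp_add a (cp_opp b)).
  by move=> La Lb ab; apply/(cpN_psi hY bY La Lb).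
exists (fun a => l (P (psi th a))); split.
- by move=> a /LE[].
- move=> a b La Lb; have [Ma aE] := LE _ La; have [Mb bE] := LE _ Lb.
  split=> [/(cpN_psi hX bX La Lb) ->|/(cpN_psi hY bY Ma Mb)]; first exact: N2.
  rewrite aE bE => ab; apply/(cpN_psi hX bX La Lb).
  by apply: Pinj => //; rewrite inE; exact: sS.
- move=> c Lc; have [f sf fE] := Psurj _ (psi_steinberg hY bY Lc).
  have [a La aE] := psi_surj hX bX sf; exists a => //; have [Ma E] := LE _ La.
  by apply: N2 => //; rewrite E aE fE.
- move=> a b La Lb; have [Ma aE] := LE _ La; have [Mb bE] := LE _ Lb; split.
    have Lab := cpL_add La Lb; have [Mab abE] := LE _ Lab.
    apply: N2 => //; first exact: cpL_add.
    rewrite abE (_ : psi th (cp_add a b) = fun g => psi th a g + psi th b g).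
      by rewrite PD; [apply/funext => g; rewrite psiD// aE bE|exact: sS|exact: sS].
    by apply/funext => g; rewrite psiD.
  have Lab := cpL_mul La Lb; have [Mab abE] := LE _ Lab.
  apply: N2 => //; first exact: cpL_mul.
  by rewrite abE !psiM// PM ?aE ?bE//; exact: sS.
split.
- move=> a Da; have [La da] := cpDiag0_psi hX bX Da; have [Ma aE] := LE _ La.
  have [|d Dd dE] := psi_diag_surj hY bY hH (f := P (psi th a)).
    by rewrite -Pd; exists (psi th a).
  have [Ld _] := cpDiag0_psi hY bY Dd.
  by exists d => //; apply: N2 => //; rewrite aE dE.
- move=> d Dd; have [Ld dd] := cpDiag0_psi hY bY Dd.
  rewrite -Pd in dd; have [f df fE] := dd.
  have [a Da aE] := psi_diag_surj hX bX hG df; have [La _] := cpDiag0_psi hX bX Da.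
  have [Ma E] := LE _ La.
  by exists a => //; apply: N2 => //; rewrite E aE fE.
- move=> /Pz {}Pz r a La; have [Ma aE] := LE _ La.
  have Lra := cpL_scale r La; have [Mra raE] := LE _ Lra.
  apply: N2 => //; first exact: cpL_scale.
  rewrite raE (_ : psi th (cp_scale r a) = fun g => r * psi th a g).
    by rewrite Pz; [apply/funext => g; rewrite psiZ// aE|exact: sS].
  by apply/funext => g; rewrite psiZ.
Qed.

End CrossedSteinberg.

(** Elements of the algebra are images under [psi], and [psi] turns the product of finite sums into
    convolution. *)
Lemma steinberg_conv (R : comNzRingType) (S : invSemigroup) (X : topologicalType)
    (th : partial_action S X) : hausdorff_space X -> co_base X ->
  forall a b, steinberg R (germ_groupoid th) a -> steinberg R (germ_groupoid th) b ->
  steinberg R (germ_groupoid th) (conv a b).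
Proof.
move=> hX bX a b /(psi_surj hX bX)[a' La <-] /(psi_surj hX bX)[b' Lb <-].
exact: steinberg_conv_psi.
Qed.

Lemma set_bij_image (A B : Type) (SA : set A) (SB : set B) (f : A -> B) :
  set_bij SA SB f -> f @` SA = SB.
Proof.
move=> [fS _ fsurj]; apply/seteqP; split=> [_ [a Sa <-]|b /fsurj//]; exact: fS.
Qed.

Theorem theorem8p15 (R : comNzRingType) (S T : invSemigroup)
  (X Y : topologicalType) (th : partial_action S X) (ga : partial_action T Y) :
  indecomposable R ->
  almost_ample th -> almost_ample ga ->
  topologically_principal th -> topologically_principal ga ->
  groupoid_hausdorff (germ_groupoid th) -> groupoid_hausdorff (germ_groupoid ga) ->
  let G := germ_groupoid th in let H := germ_groupoid ga in
  (cont_orbit_equiv th ga <-> topgroupoid_iso G H) /\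
  (cont_orbit_equiv th ga <->
     semigroup_iso_on (cobis G) (@bis_mul G) (cobis H) (@bis_mul H)) /\
  (cont_orbit_equiv th ga <->
     semigroup_iso_on (full_pseudogroup G) (@pb_mul (gcar G))
                      (full_pseudogroup H) (@pb_mul (gcar H))) /\
  (cont_orbit_equiv th ga <-> steinberg_diag_iso R false G H) /\
  (cont_orbit_equiv th ga <-> steinberg_diag_iso R true G H) /\
  (cont_orbit_equiv th ga <-> crossed_diag_iso R false th ga) /\
  (cont_orbit_equiv th ga <-> crossed_diag_iso R true th ga).
Proof.
move=> hR aX aY pth pga hG hH G H.
have bX := almost_ample_base aX; have bY := almost_ample_base aY.
have [_ [hX _]] := aX; have [_ [hY _]] := aY.
have coe := coe_orbit_homeo aX aY.
have i12 : cont_orbit_equiv th ga -> topgroupoid_iso G H.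
  by move=> /coe[phi [psi o]]; exact: orbit_homeo_iso o pth hG pga hH.
have Gc := germ_groupoid_closed th; have Hc := germ_groupoid_closed ga.
have halves := topgroupoid_iso_halves (set0 : gcar G) Gc Hc.
have i23 : topgroupoid_iso G H ->
    semigroup_iso_on (cobis G) (@bis_mul G) (cobis H) (@bis_mul H).
  by move=> /halves[f [f' [hf hf']]]; exact: iso_cobis_semigroup hf hf'.
have i24 : topgroupoid_iso G H ->
    semigroup_iso_on (full_pseudogroup G) (@pb_mul (gcar G))
                     (full_pseudogroup H) (@pb_mul (gcar H)).
  by move=> /halves[f [f' [hf hf']]]; exact: iso_pseudogroup hf hf'.
have i25 : topgroupoid_iso G H -> steinberg_diag_iso R true G H.
  by move=> /halves[f [f' [hf hf']]]; exact: steinberg_iso_of_groupoid_iso hf hf'.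
(* Groupoid isomorphisms produce algebra isomorphisms, while the return to (1) starts from a ring
   isomorphism; forgetting scalars closes the cycle for both readings of (5) and (6). *)
have i55 : steinberg_diag_iso R true G H -> steinberg_diag_iso R false G H.
  by move=> [P [Pb PD PM Pd _]]; exists P; split.
have i31 : semigroup_iso_on (cobis G) (@bis_mul G) (cobis H) (@bis_mul H) ->
    cont_orbit_equiv th ga.
  move=> [f [fb fM]]; apply/coe.
  exact: (diag_system_orbit_homeo (cobis_system th hX) (cobis_system ga hY)
    bX hX bY hY fb (set_bij_image fb) fM).
have i41 : semigroup_iso_on (full_pseudogroup G) (@pb_mul (gcar G))
    (full_pseudogroup H) (@pb_mul (gcar H)) -> cont_orbit_equiv th ga.
  move=> [f [fb fM]]; apply/coe.
  exact: (diag_system_orbit_homeo (pseudogroup_system hX pth hG)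
    (pseudogroup_system hY pga hH) bX hX bY hY fb (set_bij_image fb) fM).
have i51 : steinberg_diag_iso R false G H -> cont_orbit_equiv th ga.
  move=> [P [Pb _ PM Pd _]]; apply/coe.
  exact: (diag_system_orbit_homeo (steinberg_system hG hR (steinberg_conv hX bX))
    (steinberg_system hH hR (steinberg_conv hY bY)) bX hX bY hY Pb Pd PM).
have i56 b : steinberg_diag_iso R b G H -> crossed_diag_iso R b th ga.
  exact: crossed_of_steinberg.
have i65 b : crossed_diag_iso R b th ga -> steinberg_diag_iso R b G H.
  exact: steinberg_of_crossed.
split; first by split=> [/i12|/i23/i31].
split; first by split=> [/i12/i23|/i31].
split; first by split=> [/i12/i24|/i41].
split; first by split=> [/i12/i25/i55|/i51].
split; first by split=> [/i12/i25|/i55/i51].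
split; first by split=> [/i12/i25/i55/i56|/i65/i51].
by split=> [/i12/i25/i56|/i65/i55/i51].
Qed.
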